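(* Let $d=2k+1$ be an odd prime, let $g\ge2$, let $f:\widetilde C\to C$ be a connected étale cyclic cover of degree $d$ of a hyperelliptic curve of genus $g$, and let $C_0$, $n=g(C_0)=k(g-1)$, $h:C_0\to\mathbb P^1$, $A=h^*\mathcal O_{\mathbb P^1}(1)$, $x\in C_0$, $D_i$, $\beta_i$, $W_r(C_0)$ and $T_i'$ be as defined in the context, for $1\le i\le k$. Put $b:=n+1-d=k(g-3)$. Then for every $1\le i\le k$, set-theoretically, $$T_i'=\bigl(D_i+W_{n-3}(C_0)\bigr)\cup\bigl(D_i+K_{C_0}-A-W_b(C_0)\bigr),$$ where the second term is the image of $W_b(C_0)$ under $B\mapsto D_i+K_{C_0}-A-B$.
   Context: All varieties are over $\mathbb C$; curves are smooth, projective and connected. Let $\sigma$ be a generator of the deck group of $f:\widetilde C\to C$. The hyperelliptic involution of $C$ lifts to an involution $j\in\mathrm{Aut}(\widetilde C)$ with $j\sigma j=\sigma^{-1}$, so $\langle\sigma,j\rangle\cong D_d$ is dihedral of order $2d$. Put $C_0:=\widetilde C/\langle j\rangle$, a curve of genus $n=k(g-1)$. The quotient $\widetilde C\to\widetilde C/D_d\cong\mathbb P^1$ induces a degree-$d$ map $h:C_0\to\mathbb P^1$; set $A:=h^*\mathcal O_{\mathbb P^1}(1)$. Divisors, divisor classes and line bundles are written additively, and $K_{C_0}$ is the canonical class. For $p\in C_0$ choose a lift $p'\in\widetilde C$ and, for $a\in\mathbb Z/d\mathbb Z$, let $p_a\in C_0$ be the image of $\sigma^a(p')$; the divisor $p_i+p_{d-i}$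 does not depend on the choice of lift. Fix $x\in C_0$ and put $D_i:=x_i+x_{d-i}$ for $1\le i\le k$. The endomorphism $\sigma^i+\sigma^{-i}$ of $J\widetilde C$ preserves $JC_0$ (embedded in $J\widetilde C$ by pullback) and induces an endomorphism $\beta_i$ of $JC_0$, given on the Abel–Jacobi curve by $\beta_i([p-x])=[p_i+p_{d-i}-D_i]$. Write $\beta_i(C_0):=\{\beta_i([p-x]):p\in C_0\}\subset JC_0$. For $r\ge0$, $W_r(C_0):=\{L\in\mathrm{Pic}^r(C_0):h^0(C_0,L)>0\}$, and $W_r(C_0):=\varnothing$ for $r<0$. The set-theoretic theta-dual is $T_i':=\{\xi\in\mathrm{Pic}^{n-1}(C_0):\beta_i(C_0)+\xi\subset W_{n-1}(C_0)\}$. *)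

(* Defs.v *)
From HB Require Import structures.
From mathcomp Require Import all_boot all_order all_algebra.
From mathcomp Require Import fraction generic_quotient ring_quotient.
From mathcomp Require Import freeg.
From mathcomp Require Import boolp classical_sets reals.
From mathcomp Require Import complex.

Set Implicit Arguments.
Unset Strict Implicit.
Unset Printing Implicit Defensive.

Import Order.TTheory GRing.Theory Num.Theory.

Local Open Scope ring_scope.
Local Open Scope quotient_scope.
Local Open Scope classical_set_scope.

(* Smooth projective connected curves over an algebraically closed field k are
   modelled as abstract nonsingular curves (Hartshorne, I.6): a curve is given
   by its function field, its closed points are the discrete valuations of the
   function field that are trivial on k, and f^* contravariantly describes a
   (nonconstant) morphism f. *)

(* The last field says that ratfun is finitely generated of transcendence
   degree one over k: a finite extension of k(t), with t transcendental. *)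
Record curve (k : closedFieldType) := Curve {
  ratfun : fieldType;
  cst : {rmorphism k -> ratfun};
  _ : exists t : ratfun,
      (forall p : {poly k}, p != 0 -> (map_poly cst p).[t] != 0) /\
      (exists (m : nat) (e : 'I_m -> ratfun), forall y : ratfun,
         exists p q : 'I_m -> {poly k}, (forall l, q l != 0) /\
         y = \sum_l (map_poly cst (p l)).[t] / (map_poly cst (q l)).[t] * e l)
}.
Arguments cst {k} c.

(* Normalized discrete valuations; ord 0 is pinned to the dummy value 0, so
   that a point is determined by its function ord. *)
Record closed_point (k : closedFieldType) (X : curve k) := ClosedPoint {
  ord : ratfun X -> int;
  _ : ord 0 = 0;
  _ : forall y z, y != 0 -> z != 0 -> ord (y * z) = ord y + ord z;
  _ : forall y z, y != 0 -> z != 0 -> y + z != 0 ->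
        Num.min (ord y) (ord z) <= ord (y + z);
  _ : forall c : k, ord (cst X c) = 0;
  _ : exists s, ord s = 1
}.

HB.instance Definition _ (k : closedFieldType) (X : curve k) :=
  gen_eqMixin (closed_point X).
HB.instance Definition _ (k : closedFieldType) (X : curve k) :=
  gen_choiceMixin (closed_point X).

(* Since k is algebraically closed, points have degree one and the degree of a
   divisor is the sum of its coefficients. *)
Notation divisor X := {freeg (closed_point X)}.

Section Picard.
Context (k : closedFieldType) (X : curve k).

Definition is_div (y : ratfun X) (D : divisor X) : Prop :=
  forall P : closed_point X, coeff P D = ord P y.

Definition principal : {pred divisor X} :=
  fun D => `[< exists2 y : ratfun X, y != 0 & is_div y D >].

Lemma ord1 (P : closed_point X) : ord P 1 = 0.
Proof. by case: P => /= o _ _ _ oC _; rewrite -(rmorph1 (cst X)) oC. Qed.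

Lemma ordM (P : closed_point X) y z :
  y != 0 -> z != 0 -> ord P (y * z) = ord P y + ord P z.
Proof. by case: P => /= o _ oM _ _ _; exact: oM. Qed.

Lemma principal_zmod_closed : zmod_closed principal.
Proof.
split=> [|D E /asboolP[y y0 Dy] /asboolP[z z0 Ez]]; apply/asboolP.
  by exists 1; [exact: oner_neq0|move=> P; rewrite coeff0 ord1].
exists (y / z) => [|P]; first by rewrite mulf_neq0 ?invr_eq0.
have oV : ord P z^-1 = - ord P z.
  apply/eqP; rewrite eq_sym -subr_eq0 -opprD oppr_eq0 -ordM ?invr_eq0//.
  by rewrite divff// ord1.
by rewrite coeffB Dy Ez ordM ?invr_eq0// oV.
Qed.

HB.instance Definition _ :=
  GRing.isZmodClosed.Build (divisor X) principal principal_zmod_closed.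

(* Divisors modulo linear equivalence. *)
Definition Pic := Quotient.quot principal.

HB.instance Definition _ := GRing.Zmodule.on Pic.

Definition cls (D : divisor X) : Pic := \pi_(Quotient.quot principal) D.

Definition rep (L : Pic) : divisor X := repr (L : Quotient.quot principal).

Definition Picd (r : int) : set Pic := [set cls D | D in [set D | deg D = r]].

End Picard.

(* V is an F-linear subspace of L of dimension m, where F acts through phi. *)
Definition has_dim (F L : fieldType) (phi : {rmorphism F -> L}) (V : set L)
    (m : nat) : Prop :=
  exists e : 'I_m -> L,
    (forall y, V y <-> exists c : 'I_m -> F, y = \sum_l phi (c l) * e l) /\
    (forall c : 'I_m -> F, \sum_l phi (c l) * e l = 0 -> forall l, c l = 0).

Section Sections.
Context (k : closedFieldType) (X : curve k).

(* The space of global sections of O_X(D). *)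
Definition Lspace (D : divisor X) : set (ratfun X) :=
  [set y | y = 0 \/ forall P : closed_point X, - coeff P D <= ord P y].

(* Below, xget x0 S selects the element of a set S that is known to be a
   singleton; the default x0 is a dummy value. *)
Definition h0 (L : Pic X) : nat :=
  xget 0%N [set m | has_dim (cst X) (Lspace (rep L)) m].

Definition W (r : int) : set (Pic X) :=
  if r < 0 then set0 else [set L | Picd r L /\ (0 < h0 L)%N].

Definition derivation (D : ratfun X -> ratfun X) : Prop :=
  [/\ forall y z, D (y + z) = D y + D z,
      forall y z, D (y * z) = D y * z + y * D z
    & forall c, D (cst X c) = 0].

(* E is the divisor of the rational differential y dt: at P, with a local
   parameter s, one has y dt = y (dt/ds) ds, and D below is d/ds. *)
Definition is_div_diff (y t : ratfun X) (E : divisor X) : Prop :=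
  forall P : closed_point X, exists s D,
    [/\ ord P s = 1, derivation D, D s = 1 & coeff P E = ord P (y * D t)].

(* In characteristic zero, dt is nonzero exactly when t is not constant. *)
Definition canonical_class : Pic X :=
  xget 0 [set cls E | E in [set E | exists y t,
    [/\ y != 0, forall c, t != cst X c & is_div_diff y t E]]].

Definition genus : nat := h0 canonical_class.

End Sections.
Arguments canonical_class {k} X.
Arguments genus {k} X.

(* A nonconstant morphism, given by its action fpt on points, the pullback of
   rational functions and the ramification indices.  The pullback determines
   the other two components through ord_P (f^* y) = e_P ord_{f(P)} y. *)
Record morphism (k : closedFieldType) (X Y : curve k) := Morphism {
  fpt : closed_point X -> closed_point Y;
  pull : {rmorphism ratfun Y -> ratfun X};
  ram : closed_point X -> nat;
  pull_cst : forall c : k, pull (cst Y c) = cst X c;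
  ram_gt0 : forall P, (0 < ram P)%N;
  ord_pull : forall P y, ord P (pull y) = (ram P)%:Z * ord (fpt P) y
}.

Section Composition.
Context (k : closedFieldType) (X Y Z : curve k).
Context (b : morphism Y Z) (a : morphism X Y).

Lemma comp_cst c : (pull a \o pull b) (cst Z c) = cst X c.
Proof. by rewrite /= !pull_cst. Qed.

Lemma comp_ram_gt0 P : (0 < ram a P * ram b (fpt a P))%N.
Proof. by rewrite muln_gt0 !ram_gt0. Qed.

Lemma comp_ord P y : ord P ((pull a \o pull b) y) =
  (ram a P * ram b (fpt a P))%N%:Z * ord (fpt b (fpt a P)) y.
Proof. by rewrite /= !ord_pull PoszM mulrA. Qed.

Definition mcomp : morphism X Z := Morphism comp_cst comp_ram_gt0 comp_ord.

End Composition.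

Section ProjectiveLine.
Context (k : closedFieldType).

Local Notation "x %:F" := (@tofrac _ x).

Lemma fracE (R : idomainType) (y : {fraction R}) :
  exists p q : R, q != 0 /\ y = p%:F / q%:F.
Proof.
elim/quotW: y => r; exists \n_r, \d_r; split; first exact: denom_ratioP.
have d0 := denom_ratioP r; apply: (canRL (mulfK _)).
  by rewrite tofrac_eq0.
rewrite /GRing.mul /= !piE; apply/eqmodP => /=.
rewrite /equivf /mulf !numden_Ratio ?mulr1 ?mul1r ?oner_neq0 ?mulf_neq0//.
by rewrite mulrC.
Qed.

Definition P1_cst : {rmorphism k -> {fraction {poly k}}} :=
  @tofrac {poly k} \o polyC.

Lemma P1_curve : exists t : {fraction {poly k}},
  (forall p : {poly k}, p != 0 -> (map_poly P1_cst p).[t] != 0) /\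
  (exists (m : nat) (e : 'I_m -> {fraction {poly k}}), forall y,
     exists p q : 'I_m -> {poly k}, (forall l, q l != 0) /\
     y = \sum_l (map_poly P1_cst (p l)).[t] / (map_poly P1_cst (q l)).[t] * e l).
Proof.
have evX (p : {poly k}) : (map_poly P1_cst p).['X%:F] = p%:F.
  rewrite map_poly_comp horner_map /=; congr (_%:F).
  exact: comp_polyXr.
exists 'X%:F; split=> [p p0|]; first by rewrite evX tofrac_eq0.
exists 1%N, (fun=> 1) => y; have [p [q [q0 ->]]] := fracE y.
by exists (fun=> p), (fun=> q); split=> //; rewrite big_ord1 !evX mulr1.
Qed.

Definition P1 : curve k := Curve P1_curve.

(* O(1) is the class of any point of the projective line. *)
Definition O1 : Pic P1 :=
  xget 0 [set cls (<< y >> : divisor P1) | y in [set: closed_point P1]].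

End ProjectiveLine.
Arguments P1 : clear implicits.
Arguments O1 : clear implicits.

Section Morphisms.
Context (k : closedFieldType) (X Y : curve k).

Definition pull_div (f : morphism X Y) (D : divisor Y) : divisor X :=
  xget 0 [set E | forall P, coeff P E = (ram f P)%:Z * coeff (fpt f P) D].

Definition pull_Pic (f : morphism X Y) (L : Pic Y) : Pic X :=
  cls (pull_div f (rep L)).

Definition has_degree (f : morphism X Y) (m : nat) : Prop :=
  has_dim (pull f) setT m.

Definition etale (f : morphism X Y) : Prop := forall P, ram f P = 1%N.

Definition has_order (s : morphism X X) (m : nat) : Prop :=
  (0 < m)%N /\ iter m (pull s) =1 id /\
  forall l, (0 < l < m)%N -> ~ (iter l (pull s) =1 id).

(* Connectedness is part of the definition of a curve.  A deck transformation
   of order [X : Y] generates the deck group. *)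
Definition etale_cyclic_cover (f : morphism X Y) (s : morphism X X) (m : nat) :
    Prop :=
  [/\ etale f, has_degree f m, has_order s m & pull (mcomp f s) =1 pull f].

(* Y is the quotient of X by the group generated by G. *)
Definition is_quotient (f : morphism X Y) (G : set (morphism X X)) : Prop :=
  forall y, (exists z, pull f z = y) <-> (forall s, G s -> pull s y = y).

End Morphisms.

Definition hyperelliptic_involution (k : closedFieldType) (X : curve k)
    (iota : morphism X X) : Prop :=
  has_order iota 2 /\
  exists pi : morphism X (P1 k),
    has_degree pi 2 /\ pull (mcomp pi iota) =1 pull pi.

Section ThetaDual.
Context (k : closedFieldType) (Ct C0 : curve k).
Context (q : morphism Ct C0) (sigma : morphism Ct Ct) (d i : nat).

(* The class of x_i + x_(d-i), where x' is a lift of x. *)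
Definition Dcls (x' : closed_point Ct) : Pic C0 :=
  cls (<< fpt q (iter i (fpt sigma) x') >> +
       << fpt q (iter (d - i) (fpt sigma) x') >>).

(* The endomorphism of JC_0 induced, through the embedding q^*, by
   sigma^i + sigma^(-i), with sigma^(-i) = sigma^(d-i). *)
Definition beta (L : Pic C0) : Pic C0 :=
  xget 0 [set M | Picd 0 M /\
    pull_Pic q M = iter i (pull_Pic sigma) (pull_Pic q L)
                 + iter (d - i) (pull_Pic sigma) (pull_Pic q L)].

Definition beta_curve (x : closed_point C0) : set (Pic C0) :=
  [set beta (cls (<< p >> - << x >>)) | p in [set: closed_point C0]].

Definition theta_dual (n : nat) (x : closed_point C0) : set (Pic C0) :=
  [set xi | Picd (n%:Z - 1) xi /\
    forall eta, beta_curve x eta -> W (n%:Z - 1) (eta + xi)].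

End ThetaDual.

(* Main.v *)
Require Import Defs.
From HB Require Import structures.
From mathcomp Require Import all_boot all_order all_algebra.
From mathcomp Require Import freeg.
From mathcomp Require Import boolp classical_sets reals complex.
From mathcomp Require Import zify ring.

Set Implicit Arguments.
Unset Strict Implicit.
Unset Printing Implicit Defensive.

Import Order.TTheory GRing.Theory Num.Theory.

Local Open Scope ring_scope.
Local Open Scope classical_set_scope.

(* Put M = xi - D_i, of degree n - 3.  Since q^* is injective on Pic (an
   anti-invariant function cannot trivialize q^*D because j has a fixed point),
   xi lies in T_i' iff h^0(M + p_i + p_(d-i)) > 0 for every p.  This holds if M
   is effective, and also, by Riemann-Roch, if M = K - A - B with B effective,
   because p_i + p_(d-i) is part of the fibre of h through p.

   Conversely, if h^0(M) = 0, then N = K - M has h^0(N) = 2 and a member of the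
   pencil |N| passes through p_i + p_(d-i) for every p: the ratio y of two
   sections of N takes the same value at p_i and p_(d-i).  So q^*y is invariant
   under sigma^(2(d-i)), hence under sigma, since d is an odd prime, and under j.
   Thus y comes from the projective line, and its poles contain a fibre of h, so
   that N - A is effective.

   Riemann-Roch is proved on a cover h of the line: h_* O(D) splits as a sum of
   line bundles, and the trace form gives the duality, with the ramification
   divisor of h minus twice a fibre as canonical divisor. *)

(** * Linear algebra over a field extension *)

(** A curve is given by its function field only, so its points have to be produced. Chevalley's
    argument does it: a maximal subring containing y but not 1 / y is a valuation ring, and the
    finite degree of the field over rational function fields makes it discrete.

    Invertibility of the degree in characteristic zero makes the trace form of a cover
    nondegenerate. Its dual bases serve three times: for the duality in Riemann-Roch, for extending
    d/dT from the line to the curve, and for the finiteness of the ramification. The splitting of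
    h_* O(D) is obtained from a basis whose twists have the least possible sum.

    The number h^0(N) = 2 is Riemann-Roch in degree n - 3. The delicate case of the inclusion of p_i
    + p_(d-i) in a fibre of h is p_i = p_(d-i), where h has to be shown to ramify. The fixed point
    of j lies over a fixed point of the hyperelliptic involution: the fibre of f there has d points,
    an odd number, and j permutes them. *)

Section LinearAlgebra.
Context (F L : fieldType) (phi : {rmorphism F -> L}).

Definition lfree (I : finType) (e : I -> L) : Prop :=
  forall c : I -> F, \sum_i phi (c i) * e i = 0 -> forall i, c i = 0.

Definition lspan (I : finType) (e : I -> L) : set L :=
  [set y | exists c : I -> F, y = \sum_i phi (c i) * e i].

Definition subspace (V : set L) : Prop :=
  V 0 /\ forall c y z, V y -> V z -> V (phi c * y + z).

(** With more members in u than in e, the coordinate matrix has a nonzero left kernel vector, which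
    is a dependence among the u's. *)
Lemma steinitz (I J : finType) (u : I -> L) (e : J -> L) :
  lfree u -> (forall i, lspan e (u i)) -> (#|I| <= #|J|)%N.
Proof.
move=> uf /choice[A uA]; rewrite leqNgt; apply/negP => lt_JI.
pose M : 'M[F]_(#|I|, #|J|) := \matrix_(i, j) A (enum_val i) (enum_val j).
have : kermx M != 0.
  rewrite -mxrank_eq0 mxrank_ker subn_eq0 -ltnNge.
  exact: leq_ltn_trans (rank_leq_col M) lt_JI.
case/rowV0Pn=> v /sub_kermxP vM v0.
have c0 : forall i, v 0 (enum_rank i) = 0.
  apply: uf; under eq_bigr do rewrite uA mulr_sumr.
  rewrite exchange_big /= big1// => j _.
  under eq_bigr do rewrite mulrA -rmorphM.
  rewrite -mulr_suml -rmorph_sum.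
  have := congr1 (fun B : 'rV_ _ => B 0 (enum_rank j)) vM.
  rewrite !mxE (reindex _ (onW_bij _ (@enum_rank_bij I))) /=.
  under eq_bigr do rewrite mxE !enum_rankK.
  by move=> ->; rewrite rmorph0 mul0r.
case/eqP: v0; apply/rowP=> i; rewrite mxE.
by rewrite -(enum_valK i) c0.
Qed.

Lemma lfree_neq0 (I : finType) (e : I -> L) i : lfree e -> e i != 0.
Proof.
move=> ef; apply/negP => /eqP ei0; move: (ef (fun j => (j == i)%:R)).
move/(_ _ i); rewrite eqxx => /(_ _)/eqP; rewrite oner_eq0 => H; apply: notF.
apply: H; rewrite big1// => j _; case: eqP => [->|_]; first by rewrite ei0 mulr0.
by rewrite rmorph0 mul0r.
Qed.

Lemma lspan_mem (I : finType) (e : I -> L) i : lspan e (e i).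
Proof.
exists (fun j => (j == i)%:R); rewrite (bigD1 i)//= eqxx rmorph1 mul1r.
by rewrite big1 ?addr0// => j /negPf->; rewrite rmorph0 mul0r.
Qed.

Lemma lspan_subspace (I : finType) (e : I -> L) : subspace (lspan e).
Proof.
split; first by exists (fun=> 0); rewrite big1// => i _; rewrite rmorph0 mul0r.
move=> c _ _ [a ->] [b ->]; exists (fun i => c * a i + b i).
rewrite mulr_sumr -big_split; apply: eq_bigr => i _ /=.
by rewrite rmorphD rmorphM mulrDl mulrA.
Qed.

Lemma subspaceZ V c y : subspace V -> V y -> V (phi c * y).
Proof. by case=> V0 VD Vy; rewrite -[_ * _]addr0; exact: VD. Qed.

Lemma subspace_sum V (I : finType) (P : pred I) (c : I -> F) (e : I -> L) :
  subspace V -> (forall i, P i -> V (e i)) ->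
  V (\sum_(i | P i) phi (c i) * e i).
Proof.
move=> sV Ve; elim/big_rec: _ => [|i y Pi Vy]; first by case: sV.
by case: sV => _; apply=> //; exact: Ve.
Qed.

Lemma lspan_sub V (I : finType) (e : I -> L) :
  subspace V -> (forall i, V (e i)) -> lspan e `<=` V.
Proof. by move=> sV Ve _ [c ->]; exact: subspace_sum. Qed.

Lemma has_dimE V m : has_dim phi V m <->
  exists e : 'I_m -> L, lfree e /\ V = lspan e.
Proof.
split=> -[e]; first by case=> Ve ef; exists e; split=> //; apply/seteqP; split=> y /Ve.
by case=> ef ->; exists e.
Qed.

Lemma has_dim_fin V (I : finType) (e : I -> L) :
  lfree e -> (forall y, V y <-> lspan e y) -> has_dim phi V #|I|.
Proof.
have reidx (G : I -> L) : \sum_(i : 'I_#|I|) G (enum_val i) = \sum_i G i.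
  by rewrite [RHS](reindex _ (onW_bij _ (@enum_val_bij I))).
move=> ef Ve; exists (e \o enum_val); split=> [y|c c0 i].
  rewrite Ve; split=> -[c ->].
    by exists (c \o enum_val); rewrite /= (reidx (fun i => phi (c i) * e i)).
  exists (c \o enum_rank); rewrite -reidx; apply: eq_bigr => i _ /=.
  by rewrite enum_valK.
rewrite -(enum_valK i); apply: (ef (c \o enum_rank)); rewrite -[RHS]c0 -reidx.
by apply: eq_bigr => l _ /=; rewrite enum_valK.
Qed.

Lemma has_dim_free V m (I : finType) (u : I -> L) :
  has_dim phi V m -> lfree u -> (forall i, V (u i)) -> (#|I| <= m)%N.
Proof.
by move=> /has_dimE[e [_ ->]] uf Vu; rewrite -[m]card_ord; exact: steinitz uf Vu.
Qed.

Lemma has_dim_le V W m n :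
  V `<=` W -> has_dim phi V m -> has_dim phi W n -> (m <= n)%N.
Proof.
move=> VW /has_dimE[e [ef Ve]] dW; rewrite -[m]card_ord.
by apply: (has_dim_free dW ef) => i; apply: VW; rewrite Ve; exact: lspan_mem.
Qed.

Lemma has_dim_uniq V m n : has_dim phi V m -> has_dim phi V n -> m = n.
Proof. by move=> dm dn; apply/eqP; rewrite eqn_leq !(has_dim_le (@subset_refl _ V)). Qed.

Lemma big_option (I : finType) (G : option I -> L) :
  \sum_o G o = G None + \sum_i G (Some i).
Proof.
rewrite (bigD1 None)//=; congr (_ + _).
rewrite (reindex_omap Some id); last by case.
by apply: eq_bigl => i; rewrite eqxx.
Qed.

Definition ocons (I : Type) (y : L) (e : I -> L) (o : option I) : L :=
  if o is Some i then e i else y.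

Lemma lfree_ocons (I : finType) (e : I -> L) y :
  lfree e -> ~ lspan e y -> lfree (ocons y e).
Proof.
move=> ef nspan c; rewrite big_option /= => c0.
have cN : c None = 0.
  apply/eqP/negPn/negP => cN; apply: nspan.
  exists (fun i => - (c None)^-1 * c (Some i)).
  under eq_bigr do rewrite rmorphM -mulrA.
  rewrite -mulr_sumr rmorphN fmorphV; apply: (mulfI (x := phi (c None))).
    by rewrite fmorph_eq0.
  rewrite mulrA mulrN mulfV ?fmorph_eq0// mulN1r.
  by apply/eqP; rewrite -subr_eq0 opprK c0.
case=> [i|//]; apply: (ef (c \o Some)).
by rewrite -[RHS]c0 cN rmorph0 mul0r add0r.
Qed.

(** A free family of maximal length in V spans it, since a vector outside its span could be
    adjoined. *)
Lemma has_dim_bounded V N : subspace V ->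
  (forall n (u : 'I_n -> L), lfree u -> (forall i, V (u i)) -> (n <= N)%N) ->
  exists2 m, (m <= N)%N & has_dim phi V m.
Proof.
move=> sV bd.
pose Q n := `[< exists u : 'I_n -> L, lfree u /\ (forall i, V (u i)) >].
have Q0 : exists n, Q n.
  exists 0%N; apply/asboolP; exists (fun=> 0); split; last by case.
  by move=> c _ [].
have QN n : Q n -> (n <= N)%N by move=> /asboolP[u [uf Vu]]; exact: bd uf Vu.
case: (ex_maxnP Q0 QN) => m /asboolP[u [uf Vu]] mmax; exists m.
  exact: bd uf Vu.
apply/has_dimE; exists u; split=> //; apply/seteqP; split; last exact: lspan_sub.
move=> y Vy; apply: contrapT => nspan.
(* The enlarged family is indexed by [option 'I_m]; a basis of its span gives a family indexed by an
   ordinal, to which maximality applies. *)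
have dW := has_dim_fin (lfree_ocons uf nspan) (fun=> conj id id).
have [w [wf We]] := (has_dimE _ _).1 dW.
have Vw i : V (w i).
  have : lspan w (w i) by exact: lspan_mem.
  by rewrite -We; apply: lspan_sub => // -[j|] /=; [exact: Vu|].
have: Q #|{: option 'I_m}| by apply/asboolP; exists w.
by move/mmax; rewrite card_option card_ord ltnn.
Qed.

Lemma has_dim_sub V W n : subspace V -> V `<=` W -> has_dim phi W n ->
  exists2 m, (m <= n)%N & has_dim phi V m.
Proof.
move=> sV VW dW; apply: has_dim_bounded => // m u uf Vu.
by rewrite -[m]card_ord; apply: has_dim_free dW uf _ => i; exact/VW.
Qed.

(** Codimension one: modulo V every element of W is a multiple of w0, so w0 completes a basis of
    V. *)
Lemma has_dimS V W m w0 : subspace W -> V `<=` W -> W w0 -> ~ V w0 ->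
  (forall w, W w -> exists c, V (w - phi c * w0)) ->
  has_dim phi V m -> has_dim phi W m.+1.
Proof.
move=> sW VW Ww0 nV co /has_dimE[e [ef Ve]].
rewrite -[m]card_ord -card_option; apply: (has_dim_fin (e := ocons w0 e)).
  by apply: lfree_ocons => //; rewrite -Ve.
move=> y; split=> [/co[c]|[c ->]].
  rewrite Ve => -[a ya]; exists (fun o => if o is Some i then a i else c).
  by rewrite big_option /= -ya addrC subrK.
apply: subspace_sum => // -[i|] _ //=; apply: VW; rewrite Ve; exact: lspan_mem.
Qed.

Lemma lfree_span V m (I : finType) (e : I -> L) :
  has_dim phi V m -> lfree e -> (forall i, V (e i)) -> #|I| = m ->
  V `<=` lspan e.
Proof.
move=> dm ef Ve cI y Vy; apply: contrapT => nspan.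
have := has_dim_free dm (lfree_ocons ef nspan).
by rewrite card_option cI ltnn => H; apply: notF; apply: H; case.
Qed.

Lemma lspan_dim (I : finType) (e : I -> L) :
  exists2 m, (m <= #|I|)%N & has_dim phi (lspan e) m.
Proof.
apply: has_dim_bounded; first exact: lspan_subspace.
by move=> n u uf ue; rewrite -(card_ord n); exact: steinitz uf ue.
Qed.

End LinearAlgebra.

Lemma has_dim_eq (F L : fieldType) (phi psi : {rmorphism F -> L}) V m :
  phi =1 psi -> has_dim phi V m -> has_dim psi V m.
Proof.
move=> eq [e [Ve ef]]; exists e; split=> [y|c c0].
  by rewrite Ve; split=> -[c ->]; exists c; apply: eq_bigr => i _; rewrite eq.
by apply: ef; rewrite -[RHS]c0; apply: eq_bigr => i _; rewrite eq.
Qed.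

Section Tower.
Context (K F L : fieldType) (psi : {rmorphism K -> F}) (phi : {rmorphism F -> L}).

Lemma lfree_tower (I J : finType) (e : I -> L) (u : J -> F) :
  lfree phi e -> lfree psi u ->
  lfree (phi \o psi) (fun ij : I * J => phi (u ij.2) * e ij.1).
Proof.
move=> ef uf c c0 [i j]; pose C i := \sum_j psi (c (i, j)) * u j.
apply: (uf (fun j => c (i, j))); apply: (ef C) i; rewrite -[RHS]c0.
under [LHS]eq_bigr do rewrite /C rmorph_sum mulr_suml.
rewrite pair_bigA; apply: eq_bigr => -[i' j'] _ /=.
by rewrite rmorphM mulrA.
Qed.

Lemma has_dim_gt0 V y m : y != 0 -> V y -> has_dim phi V m -> (0 < m)%N.
Proof.
move=> y0 Vy dm; rewrite -(card_ord 1).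
apply: (has_dim_free dm (u := fun=> y)) => // c; rewrite big_ord1 => /eqP.
by rewrite mulf_eq0 (negPf y0) orbF fmorph_eq0 => /eqP + i; rewrite (ord1 i).
Qed.

Lemma has_dim_tower m n : has_dim phi setT m -> has_dim psi setT n ->
  has_dim (phi \o psi) setT (m * n).
Proof.
move=> /has_dimE[e [ef eT]] /has_dimE[u [uf uT]].
have := has_dim_fin (lfree_tower ef uf) (fun=> conj id id).
rewrite card_prod !card_ord; congr has_dim; apply/seteqP; split=> // y _.
have [c ->] : lspan phi e y by rewrite -eT.
have /choice[a ca] : forall i, lspan psi u (c i) by rewrite -uT.
exists (fun ij => a ij.1 ij.2); under eq_bigr do rewrite ca rmorph_sum mulr_suml.
rewrite pair_bigA; apply: eq_bigr => -[i j] _ /=.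
by rewrite rmorphM mulrA.
Qed.

(** Products of free families are free, so free families of F over K have at most N members and F is
    finite over K. *)
Lemma has_dim_tower_base m N :
  has_dim phi setT m -> has_dim (phi \o psi) setT N ->
  exists2 n, N = (m * n)%N & has_dim psi setT n.
Proof.
move=> dm dN; have m0 := has_dim_gt0 (oner_neq0 L) Logic.I dm.
have [e [ef _]] := (has_dimE _ _ _).1 dm.
have [|n _ dn] := @has_dim_bounded _ _ psi setT N (conj Logic.I (fun _ _ _ _ _ => Logic.I)).
  move=> n u uf _; have := has_dim_free dN (lfree_tower ef uf) (fun=> Logic.I).
  by rewrite card_prod !card_ord; apply: leq_trans; rewrite leq_pmull.
by exists n => //; apply: has_dim_uniq dN (has_dim_tower dm dn).
Qed.

End Tower.

(** * Valuations and function fields *)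

Lemma frac_lift (D : idomainType) (L : fieldType) (f : {rmorphism D -> L}) :
  injective f -> exists phi : {rmorphism {fraction D} -> L},
    forall r, phi (tofrac r) = f r.
Proof.
move=> finj; have f0 r : (f r == 0) = (r == 0) by rewrite -(inj_eq finj) rmorph0.
have /choice[g gE] : forall z : {fraction D}, exists y, forall p q, q != 0 ->
    z = tofrac p / tofrac q -> y = f p / f q.
  move=> z; have [p [q [q0 ->]]] := fracE z; exists (f p / f q) => p' q' q'0.
  move/eqP; rewrite eqr_div ?tofrac_eq0// -!tofracM tofrac_eq => /eqP e.
  by apply/eqP; rewrite eqr_div ?f0// -!rmorphM e.
have gfrac p q : q != 0 -> g (tofrac p / tofrac q) = f p / f q.
  by move=> q0; exact: gE.
have gr r : g (tofrac r) = f r.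
  by rewrite -[tofrac r]divr1 -tofrac1 gfrac ?oner_neq0// rmorph1 divr1.
have gB : zmod_morphism g.
  move=> y z; have [p [q [q0 ->]]] := fracE y; have [r [s [s0 ->]]] := fracE z.
  rewrite -mulNr -tofracN addf_div ?tofrac_eq0// -!tofracM -tofracD.
  by rewrite !gfrac ?mulf_neq0// rmorphD !rmorphM rmorphN -mulNr addf_div ?f0.
have gM : monoid_morphism g.
  split=> [|y z]; first by rewrite -tofrac1 gr rmorph1.
  have [p [q [q0 ->]]] := fracE y; have [r [s [s0 ->]]] := fracE z.
  by rewrite mulf_div -!tofracM !gfrac ?mulf_neq0// !rmorphM mulf_div.
pose Z := GRing.isZmodMorphism.Build _ _ g gB.
pose M := GRing.isMonoidMorphism.Build _ _ g gM.
pose phi : {rmorphism {fraction D} -> L} := HB.pack g Z M.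
by exists phi.
Qed.

Section Valuations.
Context (k : closedFieldType) (X : curve k).
Implicit Types (P : closed_point X) (y z : ratfun X) (n : int).

Lemma ord_0 P : ord P 0 = 0. Proof. by case: P. Qed.

Lemma ord_cst P c : ord P (cst X c) = 0. Proof. by case: P. Qed.

Lemma ord_unif P : exists s, ord P s = 1. Proof. by case: P. Qed.

Lemma ord_neq0 P y : ord P y != 0 -> y != 0.
Proof. by apply: contra_neq => ->; exact: ord_0. Qed.

Lemma closed_point_ext P Q : ord P =1 ord Q -> P = Q.
Proof.
case: P Q => [o1 a1 a2 a3 a4 a5] [o2 b1 b2 b3 b4 b5] /= /funext e.
rewrite -{}e in b1 b2 b3 b4 b5 *.
by congr ClosedPoint; exact: Prop_irrelevance.
Qed.

Lemma ordV P y : ord P y^-1 = - ord P y.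
Proof.
have [->|y0] := eqVneq y 0; first by rewrite invr0 ord_0 oppr0.
by apply/eqP; rewrite -addr_eq0 -ordM ?invr_eq0// mulVf// Defs.ord1.
Qed.

Lemma ordX P y (m : nat) : ord P (y ^+ m) = ord P y *+ m.
Proof.
have [->|y0] := eqVneq y 0.
  by rewrite expr0n; case: m => [|m] /=; rewrite ?Defs.ord1// ord_0 mul0rn.
elim: m => [|m IH]; first by rewrite Defs.ord1.
by rewrite exprS ordM ?expf_neq0// IH mulrS.
Qed.

Lemma ordZ P y (m : int) : ord P (y ^ m) = ord P y * m.
Proof.
case: m => m; first by rewrite -exprnP ordX -mulr_natr natz.
by rewrite NegzE -exprnN ordV ordX mulrN -mulr_natr natz.
Qed.

Lemma ord_div P y z : y != 0 -> z != 0 -> ord P (y / z) = ord P y - ord P z.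
Proof. by move=> y0 z0; rewrite ordM ?invr_eq0// ordV. Qed.

Lemma ordN P y : ord P (- y) = ord P y.
Proof.
have [->|y0] := eqVneq y 0; first by rewrite oppr0.
rewrite -mulN1r ordM ?oppr_eq0 ?oner_eq0//.
by rewrite -(rmorph1 (cst X)) -rmorphN ord_cst add0r.
Qed.

(* [ord P 0] is a junk value; [vge P n y] says that the true valuation of y,
   which is infinite at y = 0, is at least n. *)
Definition vge P n y := (y == 0) || (n <= ord P y).

Lemma vgeE P n y : y != 0 -> vge P n y = (n <= ord P y).
Proof. by rewrite /vge => /negPf->. Qed.

Lemma vge0 P n : vge P n 0. Proof. by rewrite /vge eqxx. Qed.

Lemma vge_ord P y : vge P (ord P y) y. Proof. by rewrite /vge lexx orbT. Qed.

Lemma vge_le P m n y : m <= n -> vge P n y -> vge P m y.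
Proof. by rewrite /vge => mn /orP[->//|/(le_trans mn)->]; rewrite orbT. Qed.

Lemma vgeD P n y z : vge P n y -> vge P n z -> vge P n (y + z).
Proof.
have [->|y0] := eqVneq y 0; first by rewrite add0r.
have [->|z0] := eqVneq z 0; first by rewrite addr0.
have [->|yz0] := eqVneq (y + z) 0; first by rewrite vge0.
rewrite !vgeE// => ny nz; case: P ny nz => /= o _ _ oD _ _ ny nz.
by apply: le_trans (oD _ _ y0 z0 yz0); rewrite le_min ny.
Qed.

Lemma vgeN P n y : vge P n (- y) = vge P n y.
Proof. by rewrite /vge oppr_eq0 ordN. Qed.

Lemma vgeB P n y z : vge P n y -> vge P n z -> vge P n (y - z).
Proof. by move=> ny nz; rewrite vgeD// vgeN. Qed.

Lemma vgeM P m n y z : vge P m y -> vge P n z -> vge P (m + n) (y * z).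
Proof.
have [->|y0] := eqVneq y 0; first by rewrite mul0r !vge0.
have [->|z0] := eqVneq z 0; first by rewrite mulr0 !vge0.
by rewrite !vgeE ?mulf_neq0// ordM//; exact: lerD.
Qed.

Lemma vge_cst P c : vge P 0 (cst X c). Proof. by rewrite /vge ord_cst lexx orbT. Qed.

Lemma vgeMl P n y z : vge P 0 y -> vge P n z -> vge P n (y * z).
Proof. by move=> ny nz; rewrite -[n]add0r vgeM. Qed.

Lemma vge1 P : vge P 0 1. Proof. by rewrite -(rmorph1 (cst X)) vge_cst. Qed.

Lemma vgeX P y m : vge P 0 y -> vge P 0 (y ^+ m).
Proof. by move=> y0; elim: m => [|m IH]; rewrite ?vge1// exprS vgeMl. Qed.

Lemma vge_sum P n (I : Type) (r : seq I) (p : pred I) (F : I -> ratfun X) :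
  (forall i, p i -> vge P n (F i)) -> vge P n (\sum_(i <- r | p i) F i).
Proof.
move=> H; elim/big_rec: _ => [|i y /H Fi]; first exact: vge0.
exact: vgeD.
Qed.

Lemma vge_mulE P n y z : z != 0 -> vge P n (y * z) = vge P (n - ord P z) y.
Proof.
have [->|y0] := eqVneq y 0; first by rewrite mul0r !vge0.
by move=> z0; rewrite !vgeE ?mulf_neq0// ordM// lerBlDr.
Qed.

Lemma vge_horner P (p : {poly k}) y : vge P 0 y -> vge P 0 (map_poly (cst X) p).[y].
Proof.
move=> y0; elim/poly_ind: p => [|p c IH]; first by rewrite rmorph0 horner0 vge0.
rewrite rmorphD rmorphM /= map_polyX map_polyC hornerMXaddC.
by rewrite vgeD ?vge_cst// vgeMl.
Qed.

(** Strict case of the ultrametric inequality: if y + z had larger order than y, so would y = (y +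
    z) - z. *)
Lemma ord_addl P y z : y != 0 -> vge P (ord P y + 1) z ->
  y + z != 0 /\ ord P (y + z) = ord P y.
Proof.
move=> y0 zP; have n0 : y + z != 0.
  apply: contraTneq zP => /eqP; rewrite addrC addr_eq0 => /eqP->.
  by rewrite vgeN vgeE// -ltNge ltrDl.
split=> //; apply/eqP; rewrite eq_le andbC.
have -> : ord P y <= ord P (y + z).
  by rewrite -vgeE// vgeD ?vge_ord// (vge_le _ zP)// lerDl.
rewrite leNgt; apply: contraTN (y0) => lt_y; rewrite negbK.
have : vge P (ord P y + 1) (y + z) by rewrite vgeE// lezD1.
move/vgeB => /(_ z zP); rewrite addrK vgeE//; first by rewrite -lezD1 in lt_y *; lia.
Qed.

Lemma vge_eq0 P y : (forall n, vge P n y) -> y = 0.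
Proof.
move=> /(_ (ord P y + 1)); rewrite /vge => /orP[/eqP//|].
by rewrite gerDl.
Qed.

Lemma unit_ord P y : y != 0 -> vge P 0 y -> ~~ vge P 1 y -> ord P y = 0.
Proof. by move=> y0; rewrite !vgeE// -ltNge; lia. Qed.

End Valuations.

(** * Finiteness of the function field over k(x) for every nonconstant x *)

Section FiniteDegree.
Context (k : closedFieldType) (X : curve k).
Local Notation L := (ratfun X).
Local Notation F := {fraction {poly k}}.

Definition nonconst (y : L) : Prop := forall c, y != cst X c.

Definition ev (x : L) : {rmorphism {poly k} -> L} :=
  horner_eval x \o map_poly (cst X).

Lemma evX x : ev x 'X = x.
Proof. by rewrite /ev /= map_polyX horner_evalE hornerX. Qed.

Lemma evC x c : ev x c%:P = cst X c.
Proof. by rewrite /ev /= map_polyC horner_evalE hornerC. Qed.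

Lemma evE x p : ev x p = (map_poly (cst X) p).[x]. Proof. by []. Qed.

Lemma ev_coef x p : ev x p = \sum_(i < size p) cst X p`_i * x ^+ i.
Proof.
rewrite evE horner_coef size_map_poly; apply: eq_bigr => i _.
by rewrite coef_map.
Qed.

Lemma ev_shift x p : exists q, ev x p = cst X p`_0 + x * ev x q.
Proof.
elim/poly_ind: p => [|p c _].
  by exists 0; rewrite coef0 !rmorph0 mulr0 addr0.
exists p; rewrite rmorphD rmorphM evX evC addrC mulrC; congr (cst X _ + _).
by rewrite coefD coefMX coefC eqxx add0r.
Qed.

Lemma ev_split x (p : {poly k}) :
  exists r, ev x p = cst X (lead_coef p) * \prod_(c <- r) (x - cst X c).
Proof.
have [r rE] := closed_field_poly_normal p; exists r.
rewrite {1}rE -mul_polyC rmorphM evC rmorph_prod; congr (_ * _).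
by apply: eq_bigr => c _; rewrite rmorphB evX evC.
Qed.

(** Polynomials split over k, so nonconstant elements are transcendental. *)
Lemma ev_eq0 x p : nonconst x -> (ev x p == 0) = (p == 0).
Proof.
move=> xn; apply/idP/idP => [|/eqP->]; last by rewrite rmorph0.
have [r ->] := ev_split x p; rewrite mulf_eq0 fmorph_eq0 lead_coef_eq0.
rewrite prodf_seq_eq0 => /orP[//|/hasP[c _]] /=.
by rewrite subr_eq0 (negPf (xn c)).
Qed.

Lemma nonconst_emb x : nonconst x ->
  exists phi : {rmorphism F -> L}, forall p, phi (tofrac p) = ev x p.
Proof.
move=> xn; apply: frac_lift => p q /eqP; rewrite -subr_eq0 -rmorphB ev_eq0//.
by rewrite subr_eq0 => /eqP.
Qed.

Lemma common_denom (I : finType) (c : I -> F) :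
  exists (d : {poly k}) (p : I -> {poly k}),
    d != 0 /\ forall i, tofrac d * c i = tofrac (p i).
Proof.
have /choice[n] : forall i, exists n, exists q, q != 0 /\ c i = tofrac n / tofrac q.
  by move=> i; exact: fracE.
move=> /choice[q qP]; exists (\prod_i q i), (fun i => n i * \prod_(j | j != i) q j).
split=> [|i]; first by apply/prodf_neq0 => i _; case: (qP i).
have [qi ci] := qP i; rewrite {1}ci (bigD1 i)//= !tofracM.
have : tofrac (q i) != 0 by rewrite tofrac_eq0.
by move=> q0; rewrite mulrC mulrA divfK.
Qed.

Lemma poly_dep (phi : {rmorphism F -> L}) x (I : finType) (u : I -> L) :
  (forall p, phi (tofrac p) = ev x p) -> ~ lfree phi u ->
  exists p : I -> {poly k},
    (exists i, p i != 0) /\ \sum_i ev x (p i) * u i = 0.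
Proof.
move=> phix /existsNP[c /not_implyP[c0 /existsNP[i /eqP ci]]].
have [d [p [d0 pE]]] := common_denom c; exists p; split.
  have d0' : tofrac d != 0 by rewrite tofrac_eq0.
  by exists i; have := mulf_neq0 d0' ci; rewrite pE tofrac_eq0.
rewrite -[RHS](mulr0 (phi (tofrac d))) -[in RHS]c0 mulr_sumr.
by apply: eq_bigr => j _; rewrite mulrA -rmorphM pE phix.
Qed.

(** A dependence whose coefficients are all divisible by 'X can be divided by x. The constant
    coefficients are what survives of a dependence at a place where x vanishes. *)
Lemma poly_dep0 (phi : {rmorphism F -> L}) x (I : finType) (u : I -> L) :
  (forall p, phi (tofrac p) = ev x p) -> nonconst x -> ~ lfree phi u ->
  exists p : I -> {poly k},
    (exists i, (p i)`_0 != 0) /\ \sum_i ev x (p i) * u i = 0.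
Proof.
move=> phix xn /(poly_dep phix)[p [[i ]]].
have [n] := ubnP (size (p i)); elim: n p => // n IH p /ltnSE pn p0 su.
have [[j pj]|pN] := pselect (exists j, (p j)`_0 != 0).
  by exists p; split=> //; exists j.
have /choice[q pq] : forall j, exists q, p j = q * 'X.
  move=> j; exists (drop_poly 1 (p j)); rewrite -{1}[p j](poly_take_drop 1).
  suff -> : take_poly 1 (p j) = 0 by rewrite add0r.
  apply/polyP=> -[|l]; rewrite coef_take_poly coef0//=.
  by apply: contrapT => /eqP pj; apply: pN; exists j.
have q0 : q i != 0 by apply: contra_neq p0 => q0; rewrite pq q0 mul0r.
apply: (IH q) => //.
  by move: pn; rewrite pq size_mulX.
have x0 : x != 0 by have := xn 0; rewrite rmorph0.
apply: (mulfI x0); rewrite mulr0 mulr_sumr -[RHS]su; apply: eq_bigr => j _.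
by rewrite pq rmorphM evX mulrA [x * _]mulrC.
Qed.

(** The span S of the powers of t below the degree of G is a domain of finite dimension over the
    image of [phi], hence a field; it contains k(t), so the products t^i e_l span L. *)
Lemma finite_over_algebraic (phi : {rmorphism F -> L}) (t : L) (m : nat)
    (e : 'I_m -> L) (G : {poly F}) :
  (forall p, phi (tofrac p) = ev (phi (tofrac 'X)) p) ->
  G != 0 -> root (map_poly phi G) t ->
  (forall y : L, exists p q : 'I_m -> {poly k}, (forall l, ev t (q l) != 0) /\
         y = \sum_l ev t (p l) / ev t (q l) * e l) ->
  exists N, has_dim phi setT N.
Proof.
move=> phix G0 /rootP Gt tspan.
have Gl : lead_coef G != 0 by rewrite lead_coef_eq0.
case sG : (size G) => [|N]; first by move/eqP: sG; rewrite size_poly_eq0 (negPf G0).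
pose u (i : 'I_N) := t ^+ i; pose S := lspan phi u.
have sS : subspace phi S := lspan_subspace phi u.
have S1 : S 1.
  case: N sG @u @S sS => [|N] sG u S sS; last first.
    by have := lspan_mem phi u ord0; rewrite /u expr0.
  have /size_poly1P[c c0 Gc] : size G == 1%N by rewrite sG.
  by move: Gt; rewrite Gc map_polyC hornerC => /eqP; rewrite fmorph_eq0 (negPf c0).
have SX : S (t ^+ N).
  move: Gt; rewrite horner_coef size_map_poly sG big_ord_recr /= coef_map /=.
  move=> /eqP; rewrite addrC addr_eq0 => /eqP GN.
  have Gl' : phi G`_N != 0 by rewrite fmorph_eq0; move: Gl; rewrite lead_coefE sG.
  suff -> : t ^+ N = phi (- (G`_N)^-1) * (\sum_(i < N) phi G`_i * t ^+ i).
    by apply: subspaceZ => //; exists (fun i : 'I_N => G`_i).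
  apply: (mulfI Gl'); rewrite GN mulrA -rmorphM mulrN mulfV -?(fmorph_eq0 phi)//.
  rewrite rmorphN1 mulN1r; congr (- _); apply: eq_bigr => i _.
  by rewrite coef_map.
have St y : S y -> S (t * y).
  case=> c ->; rewrite mulr_sumr.
  under eq_bigr do rewrite mulrCA.
  apply: subspace_sum => // i _; rewrite /u -exprS.
  have [iN|] := ltnP i.+1 N; first exact: (lspan_mem phi u (Ordinal iN)).
  move=> Ni; suff -> : i.+1 = N by [].
  by apply/eqP; rewrite eqn_leq Ni ltn_ord.
have StX n y : S y -> S (t ^+ n * y).
  by move=> Sy; elim: n => [|n IH]; rewrite ?expr0 ?mul1r// exprS -mulrA; exact: St.
have SM y z : S y -> S z -> S (y * z).
  case=> c -> Sz; rewrite mulr_suml.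
  under eq_bigr do rewrite -mulrA.
  by apply: subspace_sum => // i _; exact: StX.
have phic c : phi (tofrac c%:P) = cst X c by rewrite phix evC.
have Sev p : S (ev t p).
  rewrite ev_coef; under eq_bigr do rewrite -phic.
  by apply: subspace_sum => // i _; rewrite -[t ^+ i]mulr1; exact: StX.
(* Multiplication by z sends a basis of S to a free family of the same size in S, which spans S;
   hence 1 = z w with w in S. *)
have SV z : S z -> z != 0 -> S z^-1.
  move=> Sz z0; have [n _ dS] := lspan_dim phi u.
  have [w [wf Sw]] := (has_dimE _ _ _).1 dS.
  have zwf : lfree phi (fun i => z * w i).
    move=> c; under eq_bigr do rewrite mulrCA.
    by rewrite -mulr_sumr => /eqP; rewrite mulf_eq0 (negPf z0) => /eqP /wf.
  have Sw' i : S (w i) by rewrite /S Sw; exact: lspan_mem.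
  have [c] := lfree_span dS zwf (fun i => SM _ _ Sz (Sw' i)) (card_ord n) S1.
  under eq_bigr do rewrite mulrCA.
  rewrite -mulr_sumr => zc; suff -> : z^-1 = \sum_i phi (c i) * w i.
    by apply: subspace_sum.
  by apply: (mulfI z0); rewrite mulfV// zc.
pose v (il : 'I_N * 'I_m) := u il.1 * e il.2.
have vT y : lspan phi v y.
  have [p [q [q0 ->]]] := tspan y.
  have /choice[c cE] : forall l, S (ev t (p l) / ev t (q l)).
    by move=> l; apply: SM => //; exact: SV.
  exists (fun il => c il.2 il.1); under eq_bigr do rewrite cE mulr_suml.
  rewrite exchange_big pair_bigA; apply: eq_bigr => -[i l] _ /=.
  by rewrite mulrA.
have [n _ dn] := lspan_dim phi v; exists n.
by move: dn; congr has_dim; apply/seteqP; split=> // y _; exact: vT.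
Qed.

Lemma curve_axiom : exists t : L, nonconst t /\
  exists (m : nat) (e : 'I_m -> L), forall y : L,
    exists p q : 'I_m -> {poly k}, (forall l, ev t (q l) != 0) /\
      y = \sum_l ev t (p l) / ev t (q l) * e l.
Proof.
have [t [tr [m [e eT]]]] : exists t : L,
    (forall p, p != 0 -> (map_poly (cst X) p).[t] != 0) /\
    (exists (m : nat) (e : 'I_m -> L), forall y : L,
     exists p q : 'I_m -> {poly k}, (forall l, q l != 0) /\
     y = \sum_l (map_poly (cst X) (p l)).[t] / (map_poly (cst X) (q l)).[t] * e l).
  by case: (X).
exists t; split=> [c|].
  by have := tr _ (negbT (polyXsubC_eq0 c)); rewrite -evE rmorphB evX evC subr_eq0.
exists m, e => y; have [p [q [q0 ->]]] := eT y; exists p, q; split=> // l.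
exact: tr.
Qed.

(** Powers of x are dependent over k(t). The same relation, read as a polynomial in t with
    coefficients in k[x], makes t algebraic over k(x). *)
Lemma finite_degree x (phi : {rmorphism F -> L}) : nonconst x ->
  (forall p, phi (tofrac p) = ev x p) -> exists N, has_dim phi setT N.
Proof.
move=> xn phix; have [t [tn [m [e eT]]]] := curve_axiom.
have [psi psit] := nonconst_emb tn.
have [n0 _ dn] := lspan_dim psi e.
have {}dn : has_dim psi setT n0.
  move: dn; congr has_dim; apply/seteqP; split=> // y _.
  have [p [q [q0 ->]]] := eT y; exists (fun l => tofrac (p l) / tofrac (q l)).
  by apply: eq_bigr => l _; rewrite fmorph_div !psit.
have /(poly_dep psit)[p [[i0 pi0] sp]] : ~ lfree psi (fun i : 'I_n0.+1 => x ^+ i).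
  by move=> /(has_dim_free dn)/(_ (fun=> Logic.I)); rewrite card_ord ltnn.
pose h j : {poly k} := \sum_i (p i)`_j *: 'X^i.
have hE j (i : 'I_n0.+1) : (h j)`_i = (p i)`_j.
  rewrite coef_sum (bigD1 i)//= coefZ coefXn eqxx mulr1 big1 ?addr0// => l li.
  by rewrite coefZ coefXn eq_sym (inj_eq val_inj) (negPf li) mulr0.
pose D := (\max_i size (p i))%N.
apply: (@finite_over_algebraic phi t m e (\poly_(j < D) tofrac (h j))) => //.
- by move=> q; rewrite !phix evX.
- apply: contra_neq pi0 => /polyP/(_ (size (p i0)).-1); rewrite coef0 coef_poly.
  have [sp0|sp0] := posnP (size (p i0)).
    by move=> _; apply/eqP; rewrite -size_poly_eq0 sp0.
  rewrite (leq_trans _ (leq_bigmax i0)) ?prednK// => /eqP; rewrite tofrac_eq0.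
  move=> /eqP/polyP/(_ i0); rewrite hE coef0 => /eqP.
  by rewrite lead_coef_eq0 => /eqP.
apply/rootP; rewrite -[RHS]sp.
have evD i : ev t (p i) = \sum_(j < D) cst X (p i)`_j * t ^+ j.
  rewrite evE (@horner_coef_wide _ D) => [|]; last by rewrite size_map_poly leq_bigmax.
  by apply: eq_bigr => j _; rewrite coef_map.
rewrite (@horner_coef_wide _ D); last first.
  by rewrite size_map_poly (leq_trans (size_poly _ _)).
under [RHS]eq_bigr do rewrite evD mulr_suml.
rewrite exchange_big; apply: eq_bigr => j _.
rewrite coef_map coef_poly ltn_ord /= phix /h rmorph_sum mulr_suml.
apply: eq_bigr => i _; rewrite -mul_polyC rmorphM rmorphXn evC evX.
by rewrite mulrAC.
Qed.

End FiniteDegree.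

(** * Existence of points *)

Section Chevalley.
Context (k : closedFieldType) (X : curve k).
Local Notation L := (ratfun X).

(** The objects of Chevalley's construction, used with w = y^-1: a maximal one containing y is a
    valuation ring in which y is not a unit. *)
Record subring_avoiding (w : L) (A : set L) : Prop := SubringAvoiding {
  sa_cst : forall c, A (cst X c);
  sa_sub : forall a b, A a -> A b -> A (a - b);
  sa_mul : forall a b, A a -> A b -> A (a * b);
  sa_avoid : ~ A w }.

Section Subring.
Context (w : L) (A : set L) (Aw : subring_avoiding w A).

Lemma sa0 : A 0. Proof. by rewrite -(rmorph0 (cst X)); exact: (sa_cst Aw). Qed.
Lemma sa1 : A 1. Proof. by rewrite -(rmorph1 (cst X)); exact: (sa_cst Aw). Qed.
Lemma sa_opp a : A a -> A (- a).
Proof. by move=> Aa; rewrite -sub0r; apply: (sa_sub Aw) => //; exact: sa0. Qed.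
Lemma sa_add a b : A a -> A b -> A (a + b).
Proof.
by move=> Aa Ab; rewrite -[b]opprK; apply: (sa_sub Aw) => //; exact: sa_opp.
Qed.
Lemma sa_sum (I : Type) (r : seq I) (P : pred I) (G : I -> L) :
  (forall i, P i -> A (G i)) -> A (\sum_(i <- r | P i) G i).
Proof. by move=> H; elim/big_rec: _ => [|i y /H]; [exact: sa0|exact: sa_add]. Qed.
Lemma sa_exp a n : A a -> A (a ^+ n).
Proof.
move=> Aa; elim: n => [|n IH]; rewrite ?expr0 ?exprS; first exact: sa1.
exact: (sa_mul Aw).
Qed.
Lemma sa_ev x p : A x -> A (ev x p).
Proof.
move=> Ax; rewrite ev_coef; apply: sa_sum => i _; apply: (sa_mul Aw).
  exact: (sa_cst Aw).
exact: sa_exp.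
Qed.

Definition pspan (x : L) (n : nat) : set L :=
  [set z | exists2 a : 'I_n -> L, (forall i, A (a i)) & z = \sum_i a i * x ^+ i].

Lemma pspanD x n y z : pspan x n y -> pspan x n z -> pspan x n (y + z).
Proof.
case=> [a Aa ->] [b Ab ->]; exists (fun i => a i + b i).
  by move=> i; exact: sa_add.
by rewrite -big_split; apply: eq_bigr => i _; rewrite mulrDl.
Qed.

Lemma pspanZ x n c y : A c -> pspan x n y -> pspan x n (c * y).
Proof.
move=> Ac [a Aa ->]; exists (fun i => c * a i); first by move=> i; exact: (sa_mul Aw).
by rewrite mulr_sumr; apply: eq_bigr => i _; rewrite mulrA.
Qed.

Lemma pspanX x n i : (i < n)%N -> pspan x n (x ^+ i).
Proof.
move=> lt_in; exists (fun j => (j == i :> nat)%:R).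
  by move=> j; case: eqP => _; [exact: sa1|exact: sa0].
rewrite (bigD1 (Ordinal lt_in))//= eqxx mul1r big1 ?addr0// => j.
by rewrite -val_eqE /= => /negPf->; rewrite mul0r.
Qed.

Lemma pspan_sum x n (I : finType) (G : I -> L) :
  (forall i, pspan x n (G i)) -> pspan x n (\sum_i G i).
Proof.
move=> H; elim/big_rec: _ => [|i y _]; last exact: pspanD.
exists (fun=> 0); first by move=> i; exact: sa0.
by rewrite big1// => i _; rewrite mul0r.
Qed.

Lemma pspan1 x y : pspan x 1 y -> A y.
Proof. by case=> a Aa ->; rewrite big_ord1 mulr1. Qed.

(** Let 1/y = w0 + a x^n and 1/y = b + v, where v has only negative powers of x. Then 1 - y b = y v,
    and 1/y = b + (1 - y b) w0 + a y (v x^n); since m <= n, the exponents in v x^n lie between 0 and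
    n - 1. *)
Lemma pspan_reduce x y m n : A y -> y != 0 -> x != 0 -> (0 < m <= n)%N ->
  pspan x n.+1 y^-1 -> pspan x^-1 m.+1 y^-1 -> pspan x n y^-1.
Proof.
move=> Ay y0 x0 /andP[m0 mn] [a Aa]; rewrite big_ord_recr /= => ya.
case=> b Ab; rewrite big_ord_recl /= mulr1 => yb.
set w0 := \sum_(i < n) _ in ya; set v := \sum_(i < m) _ in yb.
have n0 : (0 < n)%N by exact: leq_trans mn.
have uv : 1 - y * b ord0 = y * v.
  by apply: (mulfI (invr_neq0 y0)); rewrite mulrBr !mulKf// mulr1 yb addrC addKr.
have Au : A (1 - y * b ord0).
  by apply: (sa_sub Aw); [exact: sa1|exact: (sa_mul Aw)].
have -> : y^-1 = b ord0 * x ^+ 0 + (1 - y * b ord0) * w0 + a ord_max * y * (v * x ^+ n).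
  have -> : a ord_max * y * (v * x ^+ n) = (1 - y * b ord0) * (a ord_max * x ^+ n).
    by rewrite uv; ring.
  rewrite -addrA -mulrDr -ya mulr1 mulrBl mul1r mulrAC divff// mul1r.
  by rewrite addrC subrK.
apply: pspanD; first apply: pspanD.
- by apply: pspanZ => //; exact: pspanX.
- by apply: pspanZ => //; exists (fun i => a (widen_ord (leqnSn n) i)).
apply: pspanZ; first exact: (sa_mul Aw).
rewrite /v mulr_suml; apply: pspan_sum => i; rewrite -mulrA.
apply: pspanZ => //; rewrite exprVn.
have -> : (x ^+ bump 0 i)^-1 * x ^+ n = x ^+ (n - i.+1).
  rewrite /bump leq0n add1n expfB_cond; last by rewrite (negPf x0); exact: leq_trans (ltn_ord i) mn.
  by rewrite mulrC.
by apply: pspanX; rewrite ltn_subrL.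
Qed.

End Subring.

Lemma maximal_subring (y : L) : nonconst y ->
  exists A, [/\ subring_avoiding y^-1 A, A y &
    forall B, subring_avoiding y^-1 B -> A `<=` B -> B `<=` A].
Proof.
move=> yn; have y0 : y != 0 by have := yn 0; rewrite rmorph0.
pose good A := subring_avoiding y^-1 A /\ A y.
have [|A [PA Amax]] := @Zorn_bigcup L (fun A => A = set0 \/ good A).
- move=> C CP Ctot; have [[A0 [CA0 gA0]]|none] := pselect (exists A, C A /\ good A).
  have gC A a : C A -> A a -> good A.
    by move=> /CP[->|//].
    right; split; last by exists A0 => //; case: gA0.
    have dir a b : (\bigcup_(Z in C) Z) a -> (\bigcup_(Z in C) Z) b ->
        exists A, [/\ C A, good A, A a & A b].
      move=> [Aa CAa aA] [Ab CAb bA].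
      have [AB|BA] := Ctot _ _ CAa CAb.
        by exists Ab; split=> //; [exact: gC bA|exact: AB].
      by exists Aa; split=> //; [exact: gC aA|exact: BA].
    split.
    + by move=> c; exists A0 => //; case: gA0 => sA _; exact: (sa_cst sA).
    + move=> a b aC bC; have [A [CA [sA _] Aa Ab]] := dir a b aC bC.
      by exists A => //; exact: (sa_sub sA).
    + move=> a b aC bC; have [A [CA [sA _] Aa Ab]] := dir a b aC bC.
      by exists A => //; exact: (sa_mul sA).
    + by case=> A CA Ay; have [sA _] := gC _ _ CA Ay; case: (sa_avoid sA).
  left; apply/seteqP; split=> // a [A CA Aa].
  by case: (CP _ CA) => [A0|gA]; [move: Aa; rewrite A0|apply: none; exists A].
have gA0 : good (range (ev y)).
  split; last by exists 'X => //; rewrite evX.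
  split=> [c|_ _ [p _ <-] [q _ <-]|_ _ [p _ <-] [q _ <-]|[p _ py]].
  - by exists c%:P => //; rewrite evC.
  - by exists (p - q) => //; rewrite rmorphB.
  - by exists (p * q) => //; rewrite rmorphM.
  have /eqP : ev y (p * 'X - 1) = 0 by rewrite rmorphB rmorphM rmorph1 evX py mulVf// subrr.
  rewrite ev_eq0// => /eqP/polyP/(_ 0%N)/eqP.
  by rewrite coefB coefMX coefC coef0 sub0r oppr_eq0 oner_eq0.
case: PA => [A0|[sA Ay]].
  exfalso; apply: (Amax (range (ev y))); last by right.
  rewrite A0; split=> //; move=> /(_ y); apply.
  by case: gA0.
exists A; split=> // B sB AB; apply: contrapT => BA.
by apply: (Amax B); [split|right; split=> //; exact: AB].
Qed.

Lemma valuation_ring (y : L) : nonconst y ->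
  exists A, [/\ subring_avoiding y^-1 A, A y & forall x, x != 0 -> A x \/ A x^-1].
Proof.
move=> yn; have y0 : y != 0 by have := yn 0; rewrite rmorph0.
have [A [sA Ay Amax]] := maximal_subring yn; exists A; split=> // x x0.
(* By maximality, A[z] contains y^-1 as soon as z is not in A. *)
have ext z : ~ A z -> exists n, pspan A z n.+1 y^-1.
  move=> Az; pose B : set L := [set b | exists2 q : {poly L},
    forall i, A q`_i & b = q.[z]].
  have [//|By] := pselect (B y^-1 -> exists n, pspan A z n.+1 y^-1).
    apply; apply: contrapT => nB; apply: Az.
    apply: (Amax B).
    + split=> //.
      * move=> c; exists (cst X c)%:P; last by rewrite hornerC.
        by move=> i; rewrite coefC; case: eqP => _; [exact: (sa_cst sA)|exact: sa0 sA].
      * move=> _ _ [p Ap ->] [q Aq ->]; exists (p - q); last by rewrite hornerD hornerN.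
        by move=> i; rewrite coefB; exact: (sa_sub sA).
      * move=> _ _ [p Ap ->] [q Aq ->]; exists (p * q); last by rewrite hornerM.
        by move=> i; rewrite coefM; apply: (sa_sum sA) => j _; exact: (sa_mul sA).
    + move=> a Aa; exists a%:P; last by rewrite hornerC.
      by move=> i; rewrite coefC; case: eqP => _; [|exact: sa0 sA].
    + exists 'X; last by rewrite hornerX.
      by move=> i; rewrite coefX; case: eqP => _; [exact: sa1 sA|exact: sa0 sA].
  exfalso; apply: By => -[q Aq ->]; exists (size q).
  exists (fun i => q`_i) => //.
  by rewrite (@horner_coef_wide _ (size q).+1).
have [|/ext[n xn]] := pselect (A x); first by left.
have [|/ext[m xm]] := pselect (A x^-1); first by right.
(* Descent: the longer of the two expressions of y^-1, in powers of x and of x^-1, can be shortened,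
   until one has degree zero and puts y^-1 in A. *)
exfalso; move: {ext} x x0 xn xm.
have [N] := ubnP (n + m); elim: N n m => // N IH [|n] m /ltnSE nmN x x0 xn xm.
  exact: (sa_avoid sA) (pspan1 xn).
case: m => [|m] in nmN xm *; first exact: (sa_avoid sA) (pspan1 xm).
have [mn|nm] := leqP m n.
  apply: (IH n m.+1 _ x x0) => //.
  exact: (pspan_reduce sA Ay y0 x0 (m := m.+1)).
apply: (IH m n.+1 _ x^-1); rewrite ?invr_eq0 ?invrK//; first by lia.
apply: (pspan_reduce sA Ay y0 (m := n.+1)); rewrite ?invr_eq0 ?invrK//.
by lia.
Qed.

End Chevalley.

Section ValuationRing.
Context (k : closedFieldType) (X : curve k).
Local Notation L := (ratfun X).
Context (w : L) (A : set L) (sA : subring_avoiding w A).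
Context (val : forall x : L, x != 0 -> A x \/ A x^-1).

(** The nonunits of A. Zero is listed apart because [0^-1] is 0, which lies in A. *)
Definition maxideal : set L := [set z | A z /\ (z = 0 \/ ~ A z^-1)].
Local Notation m := maxideal.

Lemma notA_maxideal z : z != 0 -> ~ A z^-1 -> m z.
Proof. by move=> z0 Az; split; [case: (val z0)|right]. Qed.

Lemma maxideal_mul a z : A a -> m z -> m (a * z).
Proof.
move=> Aa [Az mz]; split; first exact: (sa_mul sA).
have [->|a0] := eqVneq a 0; first by left; rewrite mul0r.
case: mz => [->|mz]; first by left; rewrite mulr0.
by right=> Aaz; apply: mz; rewrite -[z^-1](mulVKf a0) -invfM; exact: (sa_mul sA).
Qed.

Lemma maxideal_add y z : m y -> m z -> m (y + z).
Proof.
have [->|y0] := eqVneq y 0; first by rewrite add0r.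
have [->|z0] := eqVneq z 0; first by rewrite addr0.
have H u v : u != 0 -> v != 0 -> m u -> m v -> A (u / v) -> m (u + v).
  move=> u0 v0 mu mv uv.
  have -> : u + v = (1 + u / v) * v by rewrite mulrDl mul1r divfK// addrC.
  by apply: maxideal_mul => //; apply: (sa_add sA) => //; exact: sa1 sA.
move=> my mz; have yz0 : y / z != 0 by rewrite mulf_neq0 ?invr_eq0.
have [|] := val yz0.
  exact: H.
by rewrite invf_div addrC; exact: H.
Qed.

Lemma maxideal0 : m 0. Proof. by split; [exact: sa0 sA|left]. Qed.

Lemma maxideal_sum (I : Type) (r : seq I) (P : pred I) (G : I -> L) :
  (forall i, P i -> m (G i)) -> m (\sum_(i <- r | P i) G i).
Proof.
by move=> H; elim/big_rec: _ => [|i y /H]; [exact: maxideal0|exact: maxideal_add].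
Qed.

Lemma maxideal_opp y : m y -> m (- y).
Proof.
move=> my; rewrite -mulN1r; apply: maxideal_mul => //.
by apply: (sa_opp sA); exact: sa1 sA.
Qed.

Lemma maxideal_cst c : m (cst X c) -> c = 0.
Proof.
case=> _ [/eqP|]; first by rewrite fmorph_eq0 => /eqP.
by case; rewrite -fmorphV; exact: (sa_cst sA).
Qed.

Lemma maxideal_nonconst y : y != 0 -> m y -> nonconst y.
Proof.
move=> y0 my c; apply: contra_neq y0 => yc.
by rewrite yc (maxideal_cst (c := c)) ?rmorph0// -yc.
Qed.

(* A chain of elements with strictly decreasing valuations dominated by that
   of x is independent over k(x). *)
Lemma chain_lfree (phi : {rmorphism {fraction {poly k}} -> L}) x n (u : 'I_n -> L) :
  (forall p, phi (tofrac p) = ev x p) -> nonconst x ->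
  (forall j, u j != 0) -> (forall j, m (u j)) -> (forall j, A (x / u j)) ->
  (forall i j : 'I_n, (i < j)%N -> m (u i / u j)) -> lfree phi u.
Proof.
move=> phix xn u0 mu xu uu; apply: contrapT => /(poly_dep0 phix xn)[p [[i0 pi0] su]].
(* With j the last index whose constant coefficient is nonzero, the terms before j are small because
   u_i / u_j is in the ideal, those after j because their coefficients are divisible by x, hence by
   u_j. *)
pose j := [arg max_(j > i0 | (p j)`_0 != 0) (j : nat)].
have [pj jmax] : (p j)`_0 != 0 /\ forall i : 'I_n, (p i)`_0 != 0 -> (i <= j)%N.
  by rewrite /j; case: arg_maxnP.
have mx : m x by rewrite -(divfK (u0 j) x); exact: maxideal_mul.
suff : m (ev x (p j)).
  have [q ->] := ev_shift x (p j) => mp.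
  case/eqP: pj; apply: maxideal_cst; rewrite -[cst X _](addrK (x * ev x q)).
  apply: maxideal_add => //; apply: maxideal_opp; rewrite mulrC.
  by apply: maxideal_mul => //; apply: (sa_ev sA); case: mx.
have -> : ev x (p j) = - \sum_(i | i != j) ev x (p i) * (u i / u j).
  apply/eqP; rewrite -addr_eq0; apply/eqP.
  rewrite -[RHS](mul0r (u j)^-1) -[in RHS]su [in RHS](bigD1 j)//= mulrDl mulfK//.
  congr (_ + _); rewrite mulr_suml; apply: eq_bigr => i _.
  by rewrite mulrA.
have Ax : A x by case: mx.
apply: maxideal_opp; apply: maxideal_sum => i ij.
have [lt_ij|lt_ji|/val_inj e] := ltngtP i j; last by rewrite e eqxx in ij.
  by apply: maxideal_mul; [exact: (sa_ev sA)|exact: uu].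
have [q ->] := ev_shift x (p i).
have -> : (p i)`_0 = 0.
  by apply/eqP; apply: contraTT lt_ji => /jmax; rewrite -leqNgt.
rewrite rmorph0 add0r.
have -> : x * ev x q * (u i / u j) = ev x q * (x / u j) * u i by ring.
by apply: maxideal_mul => //; apply: (sa_mul sA) => //; exact: (sa_ev sA).
Qed.

Lemma chain_bound x : nonconst x -> exists N, forall n (u : 'I_n -> L),
  (forall j, u j != 0) -> (forall j, m (u j)) -> (forall j, A (x / u j)) ->
  (forall i j : 'I_n, (i < j)%N -> m (u i / u j)) -> (n <= N)%N.
Proof.
move=> xn; have [phi phix] := nonconst_emb xn.
have [N dN] := finite_degree xn phix; exists N => n u u0 mu xu uu.
rewrite -(card_ord n); apply: (has_dim_free dN) => //.
exact: chain_lfree phix xn u0 mu xu uu.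
Qed.

(** Without a generator, every nonzero s in the ideal has a z in the ideal with s / z in the ideal.
    Iterating from y gives a chain longer than the degree over k(y) allows. *)
Lemma maxideal_principal y : y != 0 -> m y ->
  exists s, [/\ s != 0, m s & forall z, m z -> A (z / s)].
Proof.
move=> y0 my; apply: contrapT => np.
have /choice[f fP] : forall s, exists z, s != 0 -> m s ->
    [/\ z != 0, m z & m (s / z)].
  move=> s; have [s0|] := eqVneq s 0; first by exists 0.
  have [ms s0|] := pselect (m s); last by exists 0.
  have [z [mz zs]] : exists z, m z /\ ~ A (z / s).
    apply: contrapT => none; apply: np; exists s; split=> // z mz.
    by apply: contrapT => zs; apply: none; exists z.
  have z0 : z != 0 by apply: contra_not_neq zs => ->; rewrite mul0r; exact: sa0 sA.
  exists z => _ _; split=> //; apply: notA_maxideal; rewrite ?mulf_neq0 ?invr_eq0//.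
  by rewrite invf_div.
pose u i := iter i f y.
have uP i : u i != 0 /\ m (u i).
  elim: i => [|i [ui mi]] //=; by have [] := fP _ ui mi.
have uu i j : m (u i / u (i + j.+1)%N).
  elim: j => [|j IH].
    by rewrite addn1 /=; have [ui mi] := uP i; have [] := fP _ ui mi.
  have [ui mi] := uP (i + j.+1)%N; have [u0 _ mm] := fP _ ui mi.
  have -> : u i / u (i + j.+2)%N = (u i / u (i + j.+1)%N) * (u (i + j.+1)%N / f (u (i + j.+1)%N)).
    by rewrite mulrA divfK// [in LHS]addnS.
  by apply: maxideal_mul; [case: IH|exact: mm].
have ltu i j : (i < j)%N -> m (u i / u j).
  by move=> /subnKC <-; rewrite addSnnS; exact: uu.
have [N bd] := chain_bound (maxideal_nonconst y0 my).
have := bd N.+1 (fun i => u i); rewrite ltnn => H; apply: notF; apply: H.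
- by move=> j; case: (uP j).
- by move=> j; case: (uP j).
- move=> [[|j] jN] /=; first by rewrite divff//; exact: sa1 sA.
  by have [] := ltu 0%N j.+1 isT.
- by move=> i j; exact: ltu.
Qed.

Section Uniformizer.
Context (s : L) (s0 : s != 0) (ms : m s) (sP : forall z, m z -> A (z / s)).

Lemma unif_pow (n : nat) : m (s ^+ n.+1).
Proof. by rewrite exprSr; apply: maxideal_mul => //; apply: (sa_exp sA); case: ms. Qed.

Lemma unif_powz (n : int) : A (s ^ n) <-> 0 <= n.
Proof.
case: n => n; split=> //.
  by move=> _; rewrite -exprnP; apply: (sa_exp sA); case: ms.
rewrite NegzE -exprnN; have [_ [/eqP|//]] := unif_pow n.
by rewrite expf_eq0 (negPf s0).
Qed.

(** The exponent is the last one with z / s^n in A: otherwise the powers of s would give chains of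
    any length whose members divide z. The quotient is then a unit, since a nonunit is divisible by
    s. *)
Lemma unit_decomp_pos z : A z -> z != 0 ->
  exists n : nat, A (z / s ^+ n) /\ A (z / s ^+ n)^-1.
Proof.
move=> Az z0; have [mz|nmz] := pselect (m z); last first.
  exists 0%N; rewrite expr0 divr1; split=> //.
  by apply: contrapT => Az'; apply: nmz; exact: notA_maxideal.
have [n nA] : exists n, ~ A (z / s ^+ n).
  apply/existsNP => allA; have [N bd] := chain_bound (maxideal_nonconst z0 mz).
  have := bd N.+1 (fun i => s ^+ (N.+1 - i)); rewrite ltnn => H.
  apply: notF; apply: H => [j|j|j|i j ij].
  - exact: expf_neq0.
  - by rewrite subSn -1?ltnS//; exact: unif_pow.
  - exact: allA.
  have le_jN : (j <= N)%N by rewrite -ltnS.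
  suff -> : s ^+ (N.+1 - i) / s ^+ (N.+1 - j) = s ^+ (j - i.+1).+1 by exact: unif_pow.
  rewrite -expfB_cond; last by rewrite (negPf s0) add0n leq_sub2l// ltnW.
  by congr (_ ^+ _); lia.
have exn : exists n, `[< ~ A (z / s ^+ n) >] by exists n; apply/asboolP.
case: (ex_minnP exn) => -[|n'] /asboolP nAn nmin; first by rewrite expr0 divr1 in nAn.
have An : A (z / s ^+ n').
  apply: contrapT => nAn'; have := nmin n' (asboolT nAn').
  by rewrite ltnn.
exists n'; split=> //; apply: contrapT => nAi; apply: nAn.
have -> : z / s ^+ n'.+1 = z / s ^+ n' / s by rewrite exprSr invfM mulrA.
by apply: sP; apply: notA_maxideal => //; rewrite mulf_neq0 ?invr_eq0 ?expf_neq0.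
Qed.

Lemma unit_decomp z : z != 0 -> exists n : int, A (z / s ^ n) /\ A (z / s ^ n)^-1.
Proof.
move=> z0; have [Az|Az] := val z0.
  by have [n] := unit_decomp_pos Az z0; exists n%:Z.
have [|n [H1 H2]] := unit_decomp_pos Az; first by rewrite invr_eq0.
exists (- n%:Z).
suff -> : z / s ^ (- n%:Z) = (z^-1 / s ^+ n)^-1 by rewrite invrK.
by rewrite invfM invrK -exprnN.
Qed.

Lemma valuation_point : exists P : closed_point X,
  forall z, z != 0 -> A z <-> 0 <= ord P z.
Proof.
pose U z := A z /\ A z^-1.
have /choice[v vP] : forall z, exists n : int,
    (z = 0 -> n = 0) /\ (z != 0 -> U (z / s ^ n)).
  move=> z; have [->|z0] := eqVneq z 0; first by exists 0.
  by have [n Un] := unit_decomp z0; exists n; split=> // z0'; rewrite z0' eqxx in z0.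
have vU z : z != 0 -> U (z / s ^ v z) by case: (vP z).
have s0z (n : int) : s ^ n != 0 by exact: expfz_neq0.
have vA z (n : int) : z != 0 -> A (z / s ^ n) <-> n <= v z.
  move=> z0; rewrite -subr_ge0 -unif_powz.
  have e : z / s ^ n = (z / s ^ v z) * s ^ (v z - n).
    by rewrite expfzDr// -invr_expz mulrA divfK.
  have [U1 U2] := vU _ z0; split; last by rewrite e; exact: (sa_mul sA).
  move=> An; have := sa_mul sA U2 An; rewrite e mulKf// mulf_neq0// invr_eq0//.
have vuniq z (n : int) : z != 0 -> U (z / s ^ n) -> v z = n.
  move=> z0 [/(vA _ _ z0) H1 H2]; apply/eqP; rewrite eq_le H1 andbT.
  have [U1 _] := vU _ z0.
  have := sa_mul sA H2 U1; rewrite invf_div mulrA divfK//.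
  by rewrite invr_expz -expfzDr// unif_powz subr_ge0.
have v0 : v 0 = 0 by case: (vP 0) => ->.
have vM y z : y != 0 -> z != 0 -> v (y * z) = v y + v z.
  move=> y0 z0; apply: vuniq; rewrite ?mulf_neq0// expfzDr// invfM mulrACA.
  have [U1 U2] := vU _ y0; have [U3 U4] := vU _ z0.
  by split; rewrite ?[X in A X]invfM; exact: (sa_mul sA).
have vD y z : y != 0 -> z != 0 -> y + z != 0 -> Num.min (v y) (v z) <= v (y + z).
  move=> y0 z0 yz0; rewrite -vA// mulrDl.
  by apply: (sa_add sA); rewrite vA// ge_min lexx ?orbT.
have vC c : v (cst X c) = 0.
  have [->|c0] := eqVneq c 0; first by rewrite rmorph0.
  apply: vuniq; rewrite ?fmorph_eq0// expr0z divr1.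
  by split; rewrite -?fmorphV; exact: (sa_cst sA).
have vs : v s = 1 by apply: vuniq; rewrite // expr1z divff// /U invr1; split; exact: sa1 sA.
exists (ClosedPoint v0 vM vD vC (ex_intro _ s vs)) => z z0 /=.
by rewrite -vA// expr0z divr1.
Qed.

End Uniformizer.

End ValuationRing.

Section Points.
Context (k : closedFieldType) (X : curve k).
Local Notation L := (ratfun X).

Lemma exists_zero (y : L) : nonconst y -> exists P : closed_point X, 0 < ord P y.
Proof.
move=> yn; have y0 : y != 0 by have := yn 0; rewrite rmorph0.
have [A [sA Ay vA]] := valuation_ring yn.
have my : maxideal A y by split=> //; right; exact: (sa_avoid sA).
have [s [s0 ms sP]] := maxideal_principal sA vA y0 my.
have [P PE] := valuation_point sA vA s0 ms sP; exists P.
rewrite ltNge -oppr_ge0 -ordV; apply/negP; rewrite -PE ?invr_eq0//.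
exact: (sa_avoid sA).
Qed.

Lemma ord_nonconst (P : closed_point X) (y : L) : ord P y != 0 -> nonconst y.
Proof. by move=> Py c; apply: contra_neq Py => ->; exact: ord_cst. Qed.

(** The residue field is k. Were every y - c a unit at P, so would be q(y) for every nonzero q; but
    the powers of y are dependent over k(x) for a uniformizer x, and reducing a dependence modulo x
    gives a q(y) vanishing at P. *)
Lemma residue (P : closed_point X) (y : L) : vge P 0 y ->
  exists c, vge P 1 (y - cst X c).
Proof.
move=> y0; apply: contrapT => none.
have oy c : y - cst X c != 0 /\ ord P (y - cst X c) = 0.
  have nv : ~~ vge P 1 (y - cst X c) by apply/negP => H; apply: none; exists c.
  have yc : y - cst X c != 0 by apply: contraNneq nv => ->; exact: vge0.
  by split=> //; apply: unit_ord => //; rewrite vgeB// vge_cst.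
have [x Px] := ord_unif P.
have xn : nonconst x by apply: (@ord_nonconst P); rewrite Px.
have [phi phix] := nonconst_emb xn; have [N dN] := finite_degree xn phix.
have : ~ lfree phi (fun j : 'I_N.+1 => y ^+ j).
  by move=> /(has_dim_free dN)/(_ (fun=> Logic.I)); rewrite card_ord ltnn.
move=> /(poly_dep0 phix xn)[p [[i0 pi0] sp]].
pose q := \poly_(j < N.+1) (p (inord j))`_0.
have q0 : q != 0.
  apply: contra_neq pi0 => /polyP/(_ i0); rewrite coef_poly ltn_ord coef0.
  by rewrite inord_val.
have oq : ev y q != 0 /\ ord P (ev y q) = 0.
  have [r ->] := ev_split y q.
  have l0 : cst X (lead_coef q) != 0 by rewrite fmorph_eq0 lead_coef_eq0.
  suff [h1 h2] : \prod_(c <- r) (y - cst X c) != 0 /\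
      ord P (\prod_(c <- r) (y - cst X c)) = 0.
    by rewrite mulf_neq0// ordM// ord_cst h2.
  elim: r => [|c r [h1 h2]]; first by rewrite big_nil oner_neq0 Defs.ord1.
  by have [g1 g2] := oy c; rewrite big_cons mulf_neq0// ordM// g2 h2.
have : vge P 1 (ev y q); last by rewrite vgeE ?oq.1// oq.2.
have -> : ev y q = - \sum_(j < N.+1) (ev x (p j) - cst X (p j)`_0) * y ^+ j.
  rewrite -sumrN evE (@horner_coef_wide _ N.+1); last first.
    by rewrite size_map_poly size_poly.
  apply: etrans (_ : _ - \sum_(j < N.+1) ev x (p j) * y ^+ j = _).
    by rewrite sp subr0.
  rewrite -sumrB; apply: eq_bigr => j _.
  by rewrite coef_map coef_poly ltn_ord inord_val -mulrBl -mulNr opprB.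
rewrite vgeN; apply: vge_sum => j _; have [g ->] := ev_shift x (p j).
rewrite addrC addKr mulrC; apply: vgeMl; first exact: vgeX.
rewrite mulrC; apply: vgeMl; last by rewrite /vge Px orbT.
by rewrite evE vge_horner// /vge Px orbT.
Qed.

Lemma regular_const (y : L) : (forall P, vge P 0 y) -> exists c, y = cst X c.
Proof.
move=> reg; apply: contrapT => nc.
have yn : nonconst y by move=> c; apply/negP => /eqP yc; apply: nc; exists c.
have y0 : y != 0 by have := yn 0; rewrite rmorph0.
have [|P] := @exists_zero y^-1.
  move=> c; apply: contra_neq (yn c^-1) => yc.
  by rewrite -[y]invrK yc fmorphV.
by rewrite ordV oppr_gt0 ltNge -vgeE// reg.
Qed.

End Points.

(** * Weak approximation *)

Section WeakApproximation.
Context (k : closedFieldType) (X : curve k).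
Local Notation L := (ratfun X).
Implicit Types (P Q : closed_point X).

(** If the valuation ring of P lay in that of Q, units at P would be units at Q and the two orders
    proportional; both being normalized, they would be equal. *)
Lemma separate_weak P Q : P != Q -> exists y, vge P 0 y /\ ~~ vge Q 0 y.
Proof.
apply: contraPP => none; have le y : vge P 0 y -> vge Q 0 y.
  by move=> Py; apply: contrapT => /negP Qy; apply: none; exists y.
apply/negP; rewrite negbK; apply/eqP; apply: closed_point_ext => z.
have unit u : u != 0 -> ord P u = 0 -> ord Q u = 0.
  move=> u0 Pu; have := le u; have := le u^-1.
  by rewrite !vgeE ?invr_eq0// !ordV Pu oppr0 => /(_ isT) ? /(_ isT) ?; lia.
have [s Ps] := ord_unif P.
have s0 : s != 0 by apply: (@ord_neq0 _ _ P); rewrite Ps.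
have oQ y : y != 0 -> ord Q y = ord P y * ord Q s.
  move=> y0; have := unit (y / s ^ ord P y).
  rewrite mulf_neq0 ?invr_eq0 ?expfz_neq0// !ord_div ?expfz_neq0// !ordZ Ps mul1r subrr.
  by move=> /(_ isT erefl)/eqP; rewrite subr_eq0 mulrC => /eqP.
have [r Qr] := ord_unif Q.
have r0 : r != 0 by apply: (@ord_neq0 _ _ Q); rewrite Qr.
have : 0 <= ord Q s by rewrite -vgeE// le// /vge Ps orbT.
have := oQ r r0; rewrite Qr => e Qs0.
have Pr : 0 < ord P r by nia.
have {e Qs0 Pr}Qs1 : ord Q s = 1 by nia.
have [->|z0] := eqVneq z 0; first by rewrite !ord_0.
by rewrite (oQ z)// Qs1 mulr1.
Qed.

Lemma separate P Q : P != Q -> exists y, [/\ y != 0, 0 < ord P y & ord Q y < 0].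
Proof.
move=> PQ; have [y [Py Qy]] := separate_weak PQ.
have [z [Qz Pz]] : exists z, vge Q 0 z /\ ~~ vge P 0 z.
  by apply: separate_weak; rewrite eq_sym.
have y0 : y != 0 by apply: contraNneq Qy => ->; exact: vge0.
have z0 : z != 0 by apply: contraNneq Pz => ->; exact: vge0.
move: Py Qy Qz Pz; rewrite !vgeE// => Py Qy Qz Pz.
exists (y / z); rewrite mulf_neq0 ?invr_eq0// !ord_div//; split=> //; lia.
Qed.

Lemma separate_seq P (S : seq (closed_point X)) : P \notin S ->
  exists y, [/\ y != 0, 0 < ord P y & forall Q, Q \in S -> ord Q y < 0].
Proof.
elim: S => [_|Q S IH].
  have [s Ps] := ord_unif P; exists s; rewrite Ps; split=> //.
  by apply: (@ord_neq0 _ _ P); rewrite Ps.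
rewrite inE negb_or => /andP[PQ /IH[y [y0 Py Sy]]].
have [Qy|Qy] := ltP (ord Q y) 0.
  by exists y; split=> // R; rewrite inE => /orP[/eqP->|/Sy].
have [z [z0 Pz Qz]] := separate PQ.
(* The exponent exceeds |ord_R y| for all R in S, so z^r dominates y wherever z has a pole; at the
   other points of S, y dominates. *)
pose r := (\sum_(R <- S) `|ord R y|%N).+1.
have zr0 : z ^+ r != 0 by rewrite expf_neq0.
have rS R : R \in S -> (`|ord R y| < r)%N.
  by move=> RS; rewrite ltnS (big_rem R)//= leq_addr.
have oz R : ord R (z ^+ r) = ord R z * r%:Z.
  by rewrite ordX -mulr_natr natz.
have r0 : 0 < r%:Z by [].
exists (z ^+ r + y); split.
- have [] // := @ord_addl _ _ Q (z ^+ r) y zr0.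
  by rewrite vgeE// oz; nia.
- rewrite -lezD1 add0r -vgeE.
    by apply: vgeD; rewrite vgeE// ?oz; nia.
  have [] // := @ord_addl _ _ Q (z ^+ r) y zr0.
  by rewrite vgeE// oz; nia.
move=> R; rewrite inE => /orP[/eqP->|RS].
  have [|_ ->] := @ord_addl _ _ Q (z ^+ r) y zr0; first by rewrite vgeE// oz; nia.
  by rewrite oz; nia.
have := rS R RS; have := Sy R RS => Ry rR.
have [Rz|Rz] := ltP (ord R z) 0.
  have [|_ ->] := @ord_addl _ _ R (z ^+ r) y zr0; first by rewrite vgeE// oz; nia.
  by rewrite oz; nia.
rewrite addrC; have [|_ -> //] := @ord_addl _ _ R y (z ^+ r) y0.
by rewrite vgeE// oz; nia.
Qed.

Lemma weak_approximation P (S : seq (closed_point X)) (a N : int) : P \notin S ->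
  exists b, [/\ b != 0, ord P b = a & forall Q, Q \in S -> N <= ord Q b].
Proof.
move=> /separate_seq[y [y0 Py Sy]]; have [s Ps] := ord_unif P.
have s0 : s != 0 by apply: (@ord_neq0 _ _ P); rewrite Ps.
(* The function sought is s^a / (1 + y^M): the denominator is a unit at P, and M makes its pole at
   each Q of S outweigh both N and the order of s^a. *)
pose M := (absz N + \sum_(Q <- S) absz (a * ord Q s)%R).+1.
have M0 : 0 < M%:Z by [].
have oy R : ord R (y ^+ M) = ord R y * M%:Z by rewrite ordX -mulr_natr natz.
have [d0 Pd] : 1 + y ^+ M != 0 /\ ord P (1 + y ^+ M) = 0.
  have [||h1 h2] := @ord_addl _ _ P 1 (y ^+ M); rewrite ?oner_neq0//.
    by rewrite vgeE ?expf_neq0// Defs.ord1 oy; nia.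
  by rewrite h2 Defs.ord1.
exists (s ^ a / (1 + y ^+ M)).
have sa0 : s ^ a != 0 by exact: expfz_neq0.
rewrite mulf_neq0 ?invr_eq0// ord_div// Pd ordZ Ps mul1r subr0; split=> // Q QS.
have Qy := Sy Q QS.
have [||_ Qd] := @ord_addl _ _ Q (y ^+ M) 1; rewrite ?expf_neq0//.
  by rewrite vgeE ?oner_neq0// Defs.ord1 oy; nia.
rewrite ord_div// ordZ addrC in Qd *; rewrite addrC Qd oy.
have : (absz N + absz (a * ord Q s)%R < M)%N.
  by rewrite ltnS leq_add2l (big_rem Q)//= leq_addr.
by nia.
Qed.

End WeakApproximation.

(** * Morphisms from inclusions of function fields *)

Section Restriction.
Context (k : closedFieldType) (X Y : curve k).
Context (phi : {rmorphism ratfun Y -> ratfun X}).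
Context (phiC : forall c, phi (cst Y c) = cst X c).

Lemma restrict_nontrivial (Q : closed_point X) : exists z, 0 < ord Q (phi z).
Proof.
have [t [tn _]] := curve_axiom Y.
have [Qt|Qt] := ltP (ord Q (phi t)) 0.
  by exists t^-1; rewrite fmorphV ordV oppr_gt0.
have [|c Qc] := @residue _ _ Q (phi t); first by rewrite /vge Qt orbT.
exists (t - cst Y c); rewrite rmorphB phiC gtz0_ge1 -?vgeE//.
by rewrite -phiC -rmorphB fmorph_eq0 subr_eq0.
Qed.

(** The ramification index is the least positive order at Q of a function from Y; by Euclidean
    division it divides all such orders, and the quotient is a normalized valuation. *)
Lemma restrict_point (Q : closed_point X) : exists (e : nat) (P : closed_point Y),
  (0 < e)%N /\ forall y, ord Q (phi y) = e%:Z * ord P y.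
Proof.
have exe : exists e, (0 < e)%N && `[< exists z, ord Q (phi z) = e%:Z >].
  have [z Qz] := restrict_nontrivial Q; exists `|ord Q (phi z)|%N.
  rewrite absz_gt0 gt_eqF//=; apply/asboolP; exists z.
  by rewrite gez0_abs// ltW.
case: (ex_minnP exe) => e /andP[e0 /asboolP[s Qs]] emin.
have s0 : s != 0.
  rewrite -(fmorph_eq0 phi); apply: (@ord_neq0 _ _ Q).
  by rewrite Qs; case: (e) e0.
have phi0 y : y != 0 -> phi y != 0 by rewrite fmorph_eq0.
have eP : e%:Z != 0 by case: (e) e0.
have dvd y : ord Q (phi y) = e%:Z * (ord Q (phi y) %/ e%:Z)%Z.
  have [->|y0] := eqVneq y 0; first by rewrite rmorph0 ord_0 div0z mulr0.
  rewrite {1}(divz_eq (ord Q (phi y)) e%:Z) mulrC.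
  suff -> : (ord Q (phi y) %% e%:Z)%Z = 0 by rewrite addr0.
  apply: contrapT => /eqP r0.
  have r_ge0 := modz_ge0 (ord Q (phi y)) eP.
  have := emin `|(ord Q (phi y) %% e%:Z)%Z|%N; rewrite absz_gt0 r0 /= => H.
  have : (e <= `|(ord Q (phi y) %% e%:Z)%Z|)%N.
    apply: H; apply/asboolP; exists (y / s ^ (ord Q (phi y) %/ e%:Z)%Z).
    rewrite fmorph_div fmorphXz ord_div ?phi0// ?expfz_neq0 ?phi0// ordZ Qs.
    rewrite gez0_abs// {1}(divz_eq (ord Q (phi y)) e%:Z) mulrC addrAC subrr add0r//.
  have := ltz_pmod (ord Q (phi y)) (_ : 0 < e%:Z).
  by lia.
pose v y := (ord Q (phi y) %/ e%:Z)%Z.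
have v0 : v 0 = 0 by rewrite /v rmorph0 ord_0 div0z.
have vM y z : y != 0 -> z != 0 -> v (y * z) = v y + v z.
  move=> y0 z0; apply: (mulfI eP); rewrite mulrDr /v -!dvd rmorphM.
  by rewrite ordM ?phi0.
have e0' : 0 < e%:Z by lia.
have vD y z : y != 0 -> z != 0 -> y + z != 0 -> Num.min (v y) (v z) <= v (y + z).
  move=> y0 z0 yz0; rewrite -(ler_pM2l e0') [v (y + z)]/v -dvd.
  rewrite -vgeE ?phi0// rmorphD; apply: vgeD; rewrite vgeE ?phi0// dvd (ler_pM2l e0').
    by rewrite ge_min lexx.
  by rewrite ge_min lexx orbT.
have vC c : v (cst Y c) = 0 by rewrite /v phiC ord_cst div0z.
have v1 : v s = 1 by rewrite /v Qs divzz eP.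
by exists e, (ClosedPoint v0 vM vD vC (ex_intro _ s v1)).
Qed.

Lemma morphism_of : exists f : morphism X Y, pull f = phi.
Proof.
have /choice[e /choice[P eP]] := restrict_point.
by exists (Morphism phiC (fun Q => (eP Q).1) (fun Q => (eP Q).2)).
Qed.

End Restriction.

(** * Divisors and the projective line *)

Section PolynomialValues.
Context (k : closedFieldType) (X : curve k) (P : closed_point X).

Lemma ord_ev_unit (y : ratfun X) c (q : {poly k}) :
  0 < ord P (y - cst X c) -> ~~ root q c -> ev y q != 0 /\ ord P (ev y q) = 0.
Proof.
move=> Pc qc; have yc0 : y - cst X c != 0 by apply: (@ord_neq0 _ _ P); rewrite gt_eqF.
have [g qg] : exists g, q = q.[c]%:P + g * ('X - c%:P).
  have /factor_theorem[g qg] : root (q - q.[c]%:P) c.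
    by rewrite /root hornerD hornerN hornerC subrr.
  by exists g; rewrite -qg addrC subrK.
have c0 : cst X q.[c] != 0 by rewrite fmorph_eq0.
rewrite qg rmorphD rmorphM rmorphB evX !evC.
have [|h1 h2] := @ord_addl _ _ P _ (ev y g * (y - cst X c)) c0; last by rewrite h2 ord_cst.
rewrite ord_cst; apply: vgeMl; last by rewrite vgeE.
rewrite evE; apply: vge_horner; rewrite -[y](subrK (cst X c)).
by apply: vgeD; rewrite ?vge_cst// vgeE// ltW.
Qed.

Lemma ord_ev_zero (y : ratfun X) c (q : {poly k}) n :
  0 < ord P (y - cst X c) -> ~~ root q c ->
  ord P (ev y q * (y - cst X c) ^+ n) = n%:Z * ord P (y - cst X c).
Proof.
move=> Pc qc; have yc0 : y - cst X c != 0 by apply: (@ord_neq0 _ _ P); rewrite gt_eqF.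
have [h1 h2] := ord_ev_unit Pc qc.
by rewrite ordM ?expf_neq0// h2 add0r ordX -mulr_natl natz.
Qed.

Lemma ord_ev_pole (y : ratfun X) (p : {poly k}) :
  ord P y < 0 -> p != 0 -> ord P (ev y p) = (size p).-1%:Z * ord P y.
Proof.
move=> Py p0; have y0 : y != 0 by apply: (@ord_neq0 _ _ P); rewrite lt_eqF.
rewrite ev_coef; case sp: (size p) => [|n].
  by move/eqP: sp; rewrite size_poly_eq0 (negPf p0).
have pn : cst X p`_n != 0.
  by rewrite fmorph_eq0; have := p0; rewrite -lead_coef_eq0 lead_coefE sp.
have oy i : ord P (y ^+ i) = i%:Z * ord P y by rewrite ordX -mulr_natl natz.
have yn : cst X p`_n * y ^+ n != 0 by rewrite mulf_neq0// expf_neq0.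
have oyn : ord P (cst X p`_n * y ^+ n) = n%:Z * ord P y.
  by rewrite ordM ?expf_neq0// ord_cst add0r oy.
rewrite big_ord_recr /= addrC; 
have [|_ ->] := @ord_addl _ _ P _ (\sum_(i < n) cst X p`_i * y ^+ i) yn;
  last exact: oyn.
rewrite oyn; apply: vge_sum => i _; apply: vgeMl; first exact: vge_cst.
by rewrite vgeE ?expf_neq0// oy; have := ltn_ord i; nia.
Qed.

End PolynomialValues.

Section ProjectiveLinePoints.
Context (k : closedFieldType).
Local Notation F := (ratfun (P1 k)).
Implicit Types (P : closed_point (P1 k)).

Definition P1T : F := tofrac ('X : {poly k}).
Local Notation T := P1T.

Lemma P1_cstE c : cst (P1 k) c = tofrac c%:P. Proof. by []. Qed.

Lemma P1_ev p : ev T p = tofrac p.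
Proof.
elim/poly_ind: p => [|p c IH]; first by rewrite !rmorph0.
by rewrite rmorphD rmorphM evX evC IH P1_cstE -tofracM -tofracD.
Qed.

Lemma P1T_nonconst : nonconst T.
Proof.
move=> c; rewrite P1_cstE tofrac_eq -subr_eq0; exact: negbT (polyXsubC_eq0 c).
Qed.

Lemma nonconstB (X : curve k) (y : ratfun X) c : nonconst y -> nonconst (y - cst X c).
Proof. by move=> yn b; rewrite subr_eq -rmorphD. Qed.

Lemma nonconstV (X : curve k) (y : ratfun X) : nonconst y -> nonconst y^-1.
Proof.
by move=> yn c; apply: contra_neq (yn c^-1) => yc; rewrite -[y]invrK yc fmorphV.
Qed.

Lemma nonconst_neq0 (X : curve k) (y : ratfun X) : nonconst y -> y != 0.
Proof. by move/(_ 0); rewrite rmorph0. Qed.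

Definition P1_param (tau : F) : Prop :=
  (exists c, tau = T - cst (P1 k) c) \/ tau = T^-1.

Lemma P1_param_nonconst tau : P1_param tau -> nonconst tau.
Proof.
case=> [[c ->]|->]; first exact/nonconstB/P1T_nonconst.
exact/nonconstV/P1T_nonconst.
Qed.

Lemma P1_param_poly tau (p : {poly k}) : P1_param tau -> p != 0 ->
  exists a : int, forall P, 0 < ord P tau -> ord P (tofrac p) = a * ord P tau.
Proof.
case=> [[c ->]|->] p0.
  have [n [q]] := multiplicity_XsubC p c; rewrite p0 /= => qc pq.
  exists n%:Z => P Pc; rewrite -P1_ev pq rmorphM rmorphXn rmorphB evX evC.
  exact: ord_ev_zero.
exists (- (size p).-1%:Z) => P; rewrite ordV oppr_gt0 mulrNN -P1_ev => PT.
exact: ord_ev_pole.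
Qed.

(** The exponent a does not depend on P, which is why a point of the line is determined by the
    parameter vanishing there. *)
Lemma P1_param_val tau z : P1_param tau ->
  exists a : int, forall P, 0 < ord P tau -> ord P z = a * ord P tau.
Proof.
move=> tp; have [->|z0] := eqVneq z 0; first by exists 0 => P _; rewrite ord_0 mul0r.
have [p [q [q0 zE]]] := fracE z.
have p0 : p != 0 by apply: contraNneq z0 => p0; rewrite zE p0 tofrac0 mul0r.
have [a aP] := P1_param_poly tp p0; have [b bP] := P1_param_poly tp q0.
exists (a - b) => P Pt; rewrite zE ord_div ?tofrac_eq0// aP// bP//.
by rewrite mulrBl.
Qed.

Lemma P1_param_ord tau P : P1_param tau -> 0 < ord P tau -> ord P tau = 1.
Proof.
move=> tp Pt; have [s Ps] := ord_unif P; have [a aP] := P1_param_val s tp.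
have := aP P Pt; rewrite Ps => e.
have a0 : 0 < a by nia.
by nia.
Qed.

Lemma P1_param_uniq tau P Q : P1_param tau -> 0 < ord P tau -> 0 < ord Q tau -> P = Q.
Proof.
move=> tp Pt Qt; apply: closed_point_ext => z; have [a aP] := P1_param_val z tp.
by rewrite (aP P Pt) (aP Q Qt) (P1_param_ord tp Pt) (P1_param_ord tp Qt).
Qed.

Lemma P1_point_param P : exists tau, [/\ P1_param tau, ord P tau = 1 &
  forall Q, Q != P -> ord Q tau <= 0].
Proof.
suff [tau [tp Pt]] : exists tau, P1_param tau /\ 0 < ord P tau.
  exists tau; split=> //; first exact: P1_param_ord.
  by move=> Q; apply: contra_neqT; rewrite -ltNge => Qt; exact: P1_param_uniq Qt Pt.
have [PT|PT] := ltP (ord P T) 0.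
  by exists T^-1; rewrite ordV oppr_gt0; split=> //; right.
have [|c Pc] := @residue _ _ P T; first by rewrite /vge PT orbT.
exists (T - cst (P1 k) c); split; first by left; exists c.
by rewrite gtz0_ge1 -vgeE// nonconst_neq0//; apply: P1_param_nonconst; left; exists c.
Qed.

End ProjectiveLinePoints.

Arguments P1T {k}.

Section Divisors.
Context (k : closedFieldType) (X : curve k).
Local Notation L := (ratfun X).
Implicit Types (D E : divisor X) (P Q : closed_point X).

Lemma div_ext D E : (forall P, coeff P D = coeff P E) -> D = E.
Proof. by move=> h; apply/eqP/freeg_eqP. Qed.

Lemma coeff_pt P Q : coeff P (<< Q >> : divisor X) = (Q == P)%:R.
Proof. by rewrite coeffU mul1r. Qed.

Lemma coeff_sum (I : Type) (r : seq I) (G : I -> divisor X) P :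
  coeff P (\sum_(i <- r) G i) = \sum_(i <- r) coeff P (G i).
Proof. exact: raddf_sum. Qed.

Lemma div_exists (c : closed_point X -> int) (S : seq (closed_point X)) :
  (forall P, c P != 0 -> P \in S) -> exists D, forall P, coeff P D = c P.
Proof.
move=> cS; exists (\sum_(Q <- undup S) << c Q *g Q >>) => P.
rewrite coeff_sum; under eq_bigr do rewrite coeffU.
have [PS|PS] := boolP (P \in undup S).
  rewrite (bigD1_seq P)//= ?undup_uniq// eqxx mulr1 big1 ?addr0// => Q /negPf->.
  by rewrite mulr0.
rewrite big_seq big1 => [|Q QS]; last first.
  by case: eqP => [e|_]; rewrite ?mulr0//; rewrite -e QS in PS.
by apply/esym/eqP; apply: contraNT PS => /cS; rewrite mem_undup.
Qed.

Lemma deg_sum D (S : seq (closed_point X)) : uniq S ->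
  (forall P, coeff P D != 0 -> P \in S) -> deg D = \sum_(P <- S) coeff P D.
Proof.
move=> uS DS; suff {1}-> : D = \sum_(P <- S) << coeff P D *g P >>.
  by rewrite raddf_sum; apply: eq_bigr => P _; exact: degU.
apply: div_ext => P; rewrite coeff_sum; under eq_bigr do rewrite coeffU.
have [PS|PS] := boolP (P \in S).
  rewrite (bigD1_seq P)//= eqxx mulr1 big1 ?addr0// => Q /negPf->.
  by rewrite mulr0.
rewrite big_seq big1 => [|Q QS]; last first.
  by case: eqP => [e|_]; rewrite ?mulr0//; rewrite -e QS in PS.
by apply/eqP; apply: contraNT PS => /DS.
Qed.

Lemma deg_ge0 D : (forall P, 0 <= coeff P D) -> 0 <= deg D.
Proof.
move=> D0; rewrite (@deg_sum D (dom D)) ?uniq_dom// => [|P]; last by rewrite mem_dom.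
by apply: sumr_ge0 => P _.
Qed.

Lemma deg_pt P : deg (<< P >> : divisor X) = 1. Proof. exact: degU. Qed.

Lemma LspaceP D y : Lspace D y <-> forall P, vge P (- coeff P D) y.
Proof.
split=> [[->|h] P|h]; rewrite ?vge0// /vge ?h ?orbT//.
have [->|y0] := eqVneq y 0; first by left.
by right=> P; rewrite -vgeE.
Qed.

Lemma Lspace_subspace D : subspace (cst X) (Lspace D).
Proof.
split=> [|c y z /LspaceP Dy /LspaceP Dz]; first by left.
by apply/LspaceP => P; apply: vgeD => //; apply: vgeMl => //; exact: vge_cst.
Qed.

Lemma Lspace_le D E : (forall P, coeff P D <= coeff P E) -> Lspace D `<=` Lspace E.
Proof.
move=> DE y /LspaceP Dy; apply/LspaceP => P.
by apply: vge_le (Dy P); rewrite lerN2.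
Qed.

Lemma Lspace0_dim : has_dim (cst X) (Lspace 0) 1.
Proof.
exists (fun=> 1); split=> [y|c].
  split=> [/LspaceP h|[c ->]].
    have [|c ->] := @regular_const _ _ y.
      by move=> P; have := h P; rewrite coeff0 oppr0.
    by exists (fun=> c); rewrite big_ord1 mulr1.
  by rewrite big_ord1 mulr1; apply/LspaceP => P; rewrite coeff0 oppr0 vge_cst.
rewrite big_ord1 mulr1 => /eqP; rewrite fmorph_eq0 => /eqP c0 l.
by rewrite ord1.
Qed.

(** For w0 in the larger space only, the residue at P of w / w0 is the multiple of w0 to subtract
    from w to return to the smaller space; so the codimension is at most one. *)
Lemma Lspace_step D P m : has_dim (cst X) (Lspace D) m ->
  exists2 m', has_dim (cst X) (Lspace (D + << P >>)) m' & (m <= m' <= m.+1)%N.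
Proof.
move=> dm; have sub : Lspace D `<=` Lspace (D + << P >>).
  by apply: Lspace_le => Q; rewrite coeffD coeff_pt lerDl ler0n.
have [sub'|] := pselect (Lspace (D + << P >>) `<=` Lspace D).
  exists m; last by rewrite leqnn leqnSn.
  by suff -> : Lspace (D + << P >>) = Lspace D by []; apply/seteqP.
move=> /existsNP[w0 /not_implyP[/[dup] Ww0 /LspaceP Dw0 nw0]].
exists m.+1; last by rewrite leqnSn leqnn.
apply: (has_dimS (Lspace_subspace _) sub Ww0 nw0) => // w /LspaceP Dw.
have w00 : w0 != 0 by apply: contra_not_neq nw0 => ->; left.
set n := - coeff P D - 1.
have cPP : - coeff P (D + << P >>) = n by rewrite coeffD coeff_pt eqxx opprD.
have ow0 : ord P w0 = n.
  have := Dw0 P; rewrite cPP vgeE// => n1.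
  apply/eqP; rewrite eq_le n1 andbT leNgt; apply/negP => n2; apply: nw0.
  apply/LspaceP => Q; have [<-|PQ] := eqVneq P Q.
    by rewrite vgeE//; rewrite /n in n2; lia.
  by have := Dw0 Q; rewrite coeffD coeff_pt (negPf PQ) addr0.
have [|c Pc] := @residue _ _ P (w / w0).
  rewrite vge_mulE ?invr_eq0// ordV opprK add0r ow0 -cPP; exact: Dw.
exists c; apply/LspaceP => Q; have [<-|PQ] := eqVneq P Q.
  have -> : w - cst X c * w0 = (w / w0 - cst X c) * w0 by rewrite mulrBl divfK.
  by rewrite vge_mulE// ow0 /n opprB addrC opprK addrAC addrNK; apply: vge_le Pc; lia.
have := vgeB (Dw Q) (vgeMl (vge_cst Q c) (Dw0 Q)).
by rewrite coeffD coeff_pt (negPf PQ) addr0.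
Qed.

Lemma Lspace_dim_pos D : (forall P, 0 <= coeff P D) ->
  exists2 m, has_dim (cst X) (Lspace D) m & m%:Z <= deg D + 1.
Proof.
have [n] := ubnP `|deg D|%N; elim: n D => // n IH D /ltnSE Dn D0.
have [->|Dneq] := eqVneq D 0; first by exists 1%N; [exact: Lspace0_dim|rewrite deg0].
have [P PD] : exists P, 0 < coeff P D.
  apply: contrapT => none; case/eqP: Dneq; apply: div_ext => P; rewrite coeff0.
  apply/eqP; rewrite eq_le D0 andbT leNgt; apply/negP => h; apply: none.
  by exists P.
have D0' Q : 0 <= coeff Q (D - << P >>).
  rewrite coeffB coeff_pt; case: eqP => [<-|_]; last by rewrite subr0.
  by rewrite subr_ge0 -gtz0_ge1.
have dD : deg (D - << P >>) = deg D - 1 by rewrite degB deg_pt.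
have d1 := deg_ge0 D0'.
have [m dm mD] : exists2 m, has_dim (cst X) (Lspace (D - << P >>)) m & m%:Z <= deg (D - << P >>) + 1.
  by apply: IH => //; rewrite dD in d1 *; lia.
have [m' dm' mm'] := Lspace_step P dm; exists m'; first by rewrite subrK in dm'.
by rewrite dD in mD; lia.
Qed.

Lemma Lspace_dim D : exists m, has_dim (cst X) (Lspace D) m.
Proof.
have [E DE] : exists E, forall P, coeff P E = Num.max 0 (coeff P D).
  apply: (div_exists (S := dom D)) => P; rewrite mem_dom.
  by apply: contra_neq => ->; rewrite maxxx.
have [|m dm _] := @Lspace_dim_pos E; first by move=> P; rewrite DE le_max lexx.
have [|m' _ dm'] := has_dim_sub (Lspace_subspace D) _ dm; last by exists m'.
by apply: Lspace_le => P; rewrite DE le_max lexx orbT.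
Qed.

End Divisors.

(** * Degrees of morphisms *)

(** Base-N digits: it allows a lexicographic minimum to be taken as the minimum of a single
    integer. *)
Lemma lex_min (u v a a0 N : int) :
  0 <= a < N -> 0 <= a0 -> u * N + a0 <= v * N + a -> u <= v.
Proof. by nia. Qed.

Lemma lex_step (r u v a a0 : int) :
  0 <= a0 < r -> 0 <= a -> u < v -> r * u + a0 + 1 <= r * v + a.
Proof.
move=> /andP[a00 a0r] a_ge0 uv; have : r * (u + 1) <= r * v.
  by rewrite ler_wpM2l ?lezD1// (le_trans a00)// ltW.
by rewrite mulrDr mulr1; lia.
Qed.

Section FibreFamily.
Context (k : closedFieldType) (X Y : curve k) (f : morphism X Y).
Context (P : closed_point Y) (S : seq (closed_point X)).
Context (uS : uniq S) (SP : forall Q, Q \in S -> fpt f Q = P).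

Definition fib_pt (i : 'I_(size S)) := tnth (in_tuple S) i.
Definition fib_idx : finType := {i : 'I_(size S) & 'I_(ram f (fib_pt i))}.

Lemma fib_ptP i : fpt f (fib_pt i) = P.
Proof. by apply: SP; rewrite mem_tnth. Qed.

Lemma ord_fib_pt i y : ord (fib_pt i) (pull f y) = (ram f (fib_pt i))%:Z * ord P y.
Proof. by rewrite ord_pull fib_ptP. Qed.

Lemma fib_pt_inj : injective fib_pt.
Proof.
exact: (elimT (tuple_uniqP (in_tuple S)) uS).
Qed.

Lemma sum_fib_pt (V : nmodType) (G : closed_point X -> V) :
  \sum_(Q <- S) G Q = \sum_i G (fib_pt i).
Proof. by rewrite -[in LHS](in_tupleE S) big_tnth. Qed.

Lemma card_fib_idx : #|fib_idx| = (\sum_(Q <- S) ram f Q)%N.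
Proof.
rewrite sum_fib_pt card_tagged sumnE big_map big_enum /=.
by apply: eq_bigr => i _; rewrite card_ord.
Qed.

Lemma fib_idx_inj (p p0 : fib_idx) :
  tag p = tag p0 -> tagged p = tagged p0 :> nat -> p = p0.
Proof.
by case: p p0 => i j [i0 j0] /= e; case: _ / e j0 => j0 /val_inj->.
Qed.

(** Modulo a uniformizer of P, such a family is a triangular basis of the product of the truncated
    local rings O_Q / m_Q^e_Q for Q in S. *)
Definition adapted (b : fib_idx -> ratfun X) : Prop := forall p,
  [/\ b p != 0, ord (fib_pt (tag p)) (b p) = (tagged p : nat)%:Z &
      forall i, i != tag p -> (ram f (fib_pt i))%:Z <= ord (fib_pt i) (b p)].

Lemma adapted_exists : exists b, adapted b.
Proof.
suff /choice[b bP] : forall p : fib_idx, exists y : ratfun X,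
  [/\ y != 0, ord (fib_pt (tag p)) y = (tagged p : nat)%:Z &
      forall i, i != tag p -> (ram f (fib_pt i))%:Z <= ord (fib_pt i) y] by exists b.
move=> p; set Q := fib_pt (tag p).
have QS : Q \notin rem Q S by rewrite mem_rem_uniqF.
have [b [b0 bQ bS]] := @weak_approximation _ _ Q _ (tagged p : nat)%:Z
  (\sum_(R <- S) ram f R)%N%:Z QS.
exists b; split=> // i ip; apply: le_trans (bS (fib_pt i) _); last first.
  by rewrite mem_rem_uniq// inE mem_tnth andbT (inj_eq fib_pt_inj).
by rewrite lez_nat (big_rem (fib_pt i)) ?mem_tnth//= leq_addr.
Qed.

Context (b : fib_idx -> ratfun X) (bP : adapted b).

(* The term of least valuation is the one minimizing (ord_P c_(Q,j), j)
   lexicographically; at its own point Q it dominates all the others. *)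
Lemma adapted_val (c : fib_idx -> ratfun Y) p1 : c p1 != 0 ->
  let y := \sum_p pull f (c p) * b p in
  exists p0, [/\ c p0 != 0,
    forall p, c p != 0 -> ord P (c p0) <= ord P (c p) /\
      (ord P (c p) = ord P (c p0) -> (tagged p0 <= tagged p)%N),
    y != 0 & ord (fib_pt (tag p0)) y =
      (ram f (fib_pt (tag p0)))%:Z * ord P (c p0) + (tagged p0 : nat)%:Z].
Proof.
move=> c1 y; set M := (\sum_(R <- S) ram f R)%N%:Z.
have jM (p : fib_idx) : ((tagged p : nat)%:Z < M).
  apply: lt_le_trans (_ : (ram f (fib_pt (tag p)))%:Z <= M).
    by rewrite ltz_nat.
  by rewrite lez_nat (big_rem (fib_pt (tag p))) ?mem_tnth//= leq_addr.
pose w (p : fib_idx) : int := ord P (c p) * M + (tagged p : nat)%:Z.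
have [p0 c0 wmin] : exists2 p0, c p0 != 0 & forall p, c p != 0 -> w p0 <= w p.
  have [p0 c0 h] := Order.TotalTheory.arg_minP (P := fun p => c p != 0) w c1.
  by exists p0.
have omin p : c p != 0 -> ord P (c p0) <= ord P (c p).
  by move=> cp; apply: lex_min (wmin p cp) => //; rewrite jM.
exists p0; set Q := fib_pt (tag p0); have [b0 bQ bN] := bP p0.
have cb0 : pull f (c p0) * b p0 != 0 by rewrite mulf_neq0// fmorph_eq0.
have ocb : ord Q (pull f (c p0) * b p0) =
    (ram f Q)%:Z * ord P (c p0) + (tagged p0 : nat)%:Z.
  by rewrite ordM ?fmorph_eq0// ord_fib_pt bQ.
suff rest : vge Q (ord Q (pull f (c p0) * b p0) + 1)
    (\sum_(p | p != p0) pull f (c p) * b p).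
  have [] := ord_addl cb0 rest; rewrite ocb => h1 h2.
  split=> // [p cp||]; try by rewrite /y (bigD1 p0).
  split=> [|e]; first exact: omin.
  by have := wmin p cp; rewrite /w e lerD2l lez_nat.
rewrite ocb; apply: vge_sum => p pp0.
have [->|cp] := eqVneq (c p) 0; first by rewrite rmorph0 mul0r vge0.
have [bp bpQ bpN] := bP p.
rewrite vgeE ?mulf_neq0 ?fmorph_eq0// ordM ?fmorph_eq0// ord_fib_pt -/Q.
have le_v := omin p cp.
have jr : (tagged p0 : nat)%:Z < (ram f Q)%:Z by rewrite ltz_nat.
have [e|ne] := eqVneq (tag p) (tag p0); last first.
  have := bpN (tag p0); rewrite eq_sym ne -/Q => /(_ isT) rb.
  rewrite lezD1; apply: lt_le_trans (_ : (ram f Q)%:Z * ord P (c p0) + (ram f Q)%:Z <= _).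
    by rewrite ltrD2l.
  by apply: lerD => //; rewrite ler_wpM2l.
have -> : ord Q (b p) = (tagged p : nat)%:Z by rewrite /Q -e.
have : (tagged p : nat)%:Z != (tagged p0 : nat)%:Z.
  by apply: contraNneq pp0 => -[/(fib_idx_inj e)->].
move=> nej; have := wmin p cp; rewrite /w.
have [lt_v _|ge_v] := ltP (ord P (c p0)) (ord P (c p)).
  by apply: (lex_step _ _ lt_v); rewrite ?jr.
have -> : ord P (c p) = ord P (c p0) by apply/eqP; rewrite eq_le le_v ge_v.
by rewrite lerD2l -addrA lerD2l lezD1 lt_neqAle eq_sym nej.
Qed.

Lemma adapted_lfree : lfree (pull f) b.
Proof.
move=> c y0 p; apply: contrapT => /eqP cp.
by have [p0 [_ _ /eqP]] := adapted_val cp.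
Qed.

(* Coefficients of an integral element are integral, and those that do not
   vanish at P are controlled by the valuations upstairs. *)
Lemma adapted_integral (c : fib_idx -> ratfun Y) :
  (forall Q, Q \in S -> vge Q 0 (\sum_p pull f (c p) * b p)) ->
  forall p, vge P 0 (c p).
Proof.
move=> yint p; have [->|cp] := eqVneq (c p) 0; first exact: vge0.
have [p0 [c0 omin y0 oy]] := adapted_val cp.
have := yint (fib_pt (tag p0)); rewrite mem_tnth vgeE// oy => /(_ isT) h.
rewrite vgeE//; apply: le_trans (omin p cp).1.
have jr : (tagged p0 : nat)%:Z < (ram f (fib_pt (tag p0)))%:Z by rewrite ltz_nat.
by nia.
Qed.

End FibreFamily.

Section Degree.
Context (k : closedFieldType).
Implicit Types (X Y : curve k).

Lemma sum_ram_le X Y (f : morphism X Y) P (S : seq (closed_point X)) m :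
  uniq S -> (forall Q, Q \in S -> fpt f Q = P) -> has_degree f m ->
  (\sum_(Q <- S) ram f Q <= m)%N.
Proof.
move=> uS SP dm; have [b bP] := adapted_exists f uS.
rewrite -card_fib_idx; apply: has_dim_free dm (adapted_lfree SP bP) _ => i.
exact: Logic.I.
Qed.

(** Finite sets of preimages have at most m elements, as ramification indices are positive; a
    largest one is the fibre. *)
Lemma fibre_exists X Y (f : morphism X Y) P m : has_degree f m ->
  exists S : seq (closed_point X), uniq S /\ forall Q, Q \in S <-> fpt f Q = P.
Proof.
move=> dm; pose A n := `[< exists S : seq (closed_point X),
  [/\ uniq S, forall Q, Q \in S -> fpt f Q = P & size S = n] >].
have A0 : exists n, A n by exists 0%N; apply/asboolP; exists [::].
have Am n : A n -> (n <= m)%N.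
  move=> /asboolP[S [uS SP <-]]; apply: leq_trans (sum_ram_le uS SP dm).
  by rewrite -sum1_size; apply: leq_sum => Q _; exact: ram_gt0.
case: (ex_maxnP A0 Am) => n /asboolP[S [uS SP sS]] nmax.
exists S; split=> // Q; split=> [/SP//|QP]; apply/negPn/negP => QS.
have: A n.+1; last by move/nmax; rewrite ltnn.
apply/asboolP; exists (Q :: S); rewrite /= QS uS sS; split=> // R.
by rewrite inE => /orP[/eqP->|/SP].
Qed.

Definition fibre X Y (f : morphism X Y) P : seq (closed_point X) :=
  xget [::] [set S | uniq S /\ forall Q, Q \in S <-> fpt f Q = P].

Lemma fibreP X Y (f : morphism X Y) P m : has_degree f m ->
  uniq (fibre f P) /\ forall Q, (Q \in fibre f P) = (fpt f Q == P).
Proof.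
move=> dm; rewrite /fibre.
case: xgetP => [S _ [uS SP]|none]; last by case: (none _ (projT2 (cid (fibre_exists P dm)))).
by split=> // Q; apply/idP/eqP => /SP.
Qed.

Lemma sum_ram_fibre_le X Y (f : morphism X Y) P m : has_degree f m ->
  (\sum_(Q <- fibre f P) ram f Q <= m)%N.
Proof.
move=> dm; have [uS SP] := fibreP P dm.
by apply: (sum_ram_le (P := P) uS _ dm) => Q; rewrite SP => /eqP.
Qed.

Lemma pull_divE X Y (f : morphism X Y) m D Q : has_degree f m ->
  coeff Q (pull_div f D) = (ram f Q)%:Z * coeff (fpt f Q) D.
Proof.
move=> dm; rewrite /pull_div; case: xgetP => [E _ ->//|none].
have [|E EP] := @div_exists _ X (fun Q => (ram f Q)%:Z * coeff (fpt f Q) D)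
  (flatten [seq fibre f P | P <- dom D]); last by case: (none E).
move=> R; rewrite mulf_eq0 negb_or => /andP[_ RD]; apply/flatten_mapP.
exists (fpt f R); first by rewrite mem_dom.
by have [_ ->] := fibreP (fpt f R) dm.
Qed.

Lemma pull_divD X Y (f : morphism X Y) m D E : has_degree f m ->
  pull_div f (D + E) = pull_div f D + pull_div f E.
Proof.
by move=> dm; apply: div_ext => Q; rewrite coeffD !(pull_divE _ _ dm) coeffD mulrDr.
Qed.

Lemma pull_divB X Y (f : morphism X Y) m D E : has_degree f m ->
  pull_div f (D - E) = pull_div f D - pull_div f E.
Proof.
by move=> dm; apply: div_ext => Q; rewrite coeffB !(pull_divE _ _ dm) coeffB mulrBr.
Qed.

Lemma deg_pull_pt X Y (f : morphism X Y) P m : has_degree f m ->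
  deg (pull_div f << P >>) = (\sum_(Q <- fibre f P) ram f Q)%N%:Z.
Proof.
move=> dm; have [uS SP] := fibreP P dm; rewrite (deg_sum uS) => [|Q]; last first.
  rewrite (pull_divE _ _ dm) SP coeff_pt; apply: contraNT => ne.
  by rewrite [P == _]eq_sym (negPf ne) mulr0.
rewrite -[RHS]natz natr_sum big_seq [RHS]big_seq; apply: eq_bigr => Q.
by rewrite SP => /eqP QP; rewrite (pull_divE _ _ dm) coeff_pt QP eqxx mulr1 natz.
Qed.

Lemma nonconst_morphism X (y : ratfun X) : nonconst y ->
  exists (f : morphism X (P1 k)) m, pull f P1T = y /\ has_degree f m.
Proof.
move=> yn; have [phi phiy] := nonconst_emb yn.
have [|f fE] := @morphism_of _ X (P1 k) phi.
  by move=> c; rewrite P1_cstE phiy evC.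
have [m dm] := finite_degree yn phiy.
by exists f, m; rewrite /has_degree fE; split=> //; rewrite phiy evX.
Qed.

End Degree.

(** * Degrees of principal divisors and of fibres *)

Section PrincipalDivisors.
Context (k : closedFieldType).
Implicit Types (X Y : curve k).

Lemma P1T_param : P1_param (P1T : ratfun (P1 k)).
Proof. by left; exists 0; rewrite rmorph0 subr0. Qed.

Lemma P1TV_param : P1_param (P1T^-1 : ratfun (P1 k)).
Proof. by right. Qed.

Lemma P1_param_point (tau : ratfun (P1 k)) : P1_param tau ->
  exists P, [/\ ord P tau = 1 & forall Q, (0 < ord Q tau) = (Q == P)].
Proof.
move=> tp; have [P Pt] := exists_zero (P1_param_nonconst tp); exists P.
split=> [|Q]; first exact: P1_param_ord.
apply/idP/eqP => [Qt|->//]; exact: P1_param_uniq tp Qt Pt.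
Qed.

(** The zeros and poles of y lie over two points of the line for the morphism defined by y, and
    fibres are finite. *)
Lemma finite_support X (y : ratfun X) :
  exists S : seq (closed_point X), forall Q, ord Q y != 0 -> Q \in S.
Proof.
have [[c ->]|nc] := pselect (exists c, y = cst X c).
  by exists [::] => Q; rewrite ord_cst eqxx.
have [|f [m [fy dm]]] := @nonconst_morphism _ X y.
  by move=> c; apply/eqP => yc; apply: nc; exists c.
have [P [_ PE]] := P1_param_point P1T_param.
have [P' [_ PE']] := P1_param_point P1TV_param.
exists (fibre f P ++ fibre f P') => Q; rewrite mem_cat.
have [_ ->] := fibreP P dm; have [_ ->] := fibreP P' dm.
rewrite -fy ord_pull mulf_eq0 negb_or -PE -PE' ordV oppr_gt0 => /andP[_].
by rewrite neq_lt orbC.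
Qed.

Lemma is_div_exists X (y : ratfun X) : exists D, is_div y D.
Proof. by have [S SP] := finite_support y; have [D DP] := div_exists SP; exists D. Qed.

Lemma Lspace_cover X (I : finType) (u : I -> ratfun X) :
  exists C : divisor X, (forall P, 0 <= coeff P C) /\ forall i, Lspace C (u i).
Proof.
have /choice[S SP] : forall i, exists S : seq (closed_point X),
    forall Q, ord Q (u i) != 0 -> Q \in S by move=> i; exact: finite_support.
have [|C CP] := @div_exists _ X (fun P => \sum_i `|ord P (u i)|)
    (flatten [seq S i | i <- enum I]).
  move=> P; rewrite psumr_neq0 => [/hasP[i _]|i _]; last exact: normr_ge0.
  move=> /= /gt_eqF/negbT; rewrite normr_eq0 => Pi; apply/flatten_mapP.
  by exists i; rewrite ?mem_enum// SP.
exists C; split=> [P|i]; first by rewrite CP sumr_ge0.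
apply/LspaceP => P; rewrite CP (bigD1 i)//= /vge; apply/orP; right.
rewrite lerNl (le_trans (ler_norm _))// normrN lerDl sumr_ge0//.
Qed.

Lemma lfree_powers X (y : ratfun X) n :
  nonconst y -> lfree (cst X) (fun i : 'I_n => y ^+ i).
Proof.
move=> yn c; pose q := \poly_(i < n) (if insub i is Some j then c j else 0).
have qc (i : 'I_n) : q`_i = c i by rewrite coef_poly ltn_ord valK.
move=> e; have : ev y q == 0.
  rewrite evE (@horner_coef_wide _ n) ?size_map_poly ?size_poly//; apply/eqP.
  by rewrite -[RHS]e; apply: eq_bigr => i _; rewrite coef_map qc.
by rewrite ev_eq0// => /eqP q0 i; rewrite -qc q0 coef0.
Qed.

(** Adapted families give the upper bound. Conversely, the m (r + 1) functions tau^-j u_i with j <=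
    r are independent sections of C + r E, whence m (r + 1) <= deg C + r deg E + 1 for every r. *)
Lemma deg_fibre_P1 X (f : morphism X (P1 k)) P m : has_degree f m ->
  deg (pull_div f << P >>) = m%:Z.
Proof.
move=> dm; apply/eqP; rewrite eq_le; apply/andP; split.
  by rewrite (deg_pull_pt P dm) lez_nat (sum_ram_fibre_le P dm).
have [tau [tp Pt tauP]] := P1_point_param P.
have [u [uf uT]] := (has_dimE _ _ _).1 dm.
have [C [C0 uC]] := Lspace_cover u.
set E := pull_div f << P >>.
have EP Q : coeff Q E = (ram f Q)%:Z * (P == fpt f Q)%:R.
  by rewrite (pull_divE _ _ dm) coeff_pt.
have E0 Q : 0 <= coeff Q E by rewrite EP mulr_ge0// ler0n.
pose y := pull f tau^-1.
have yE : Lspace E y.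
  apply/LspaceP => Q; rewrite EP /y /vge ord_pull ordV; apply/orP; right.
  rewrite -mulrN ler_wpM2l// lerN2.
  have [<-|ne] := eqVneq P (fpt f Q); first by rewrite Pt.
  by rewrite tauP// eq_sym.
have yXE (n : nat) : Lspace (E *+ n) (y ^+ n).
  apply/LspaceP => Q; elim: n => [|n IH]; first by rewrite coeff0 oppr0 vge1.
  rewrite mulrS coeffD exprS opprD; apply: vgeM => //.
  by move/LspaceP: yE.
have cstE : pull f \o cst (P1 k) =1 cst X by move=> c; exact: pull_cst.
have bound (r : nat) : (m * r.+1)%:Z <= deg C + r%:Z * deg E + 1.
  have [M dM] : exists2 M, has_dim (cst X) (Lspace (C + E *+ r)) M &
      M%:Z <= deg (C + E *+ r) + 1.
    by apply: Lspace_dim_pos => Q; rewrite coeffD coeffMn addr_ge0// mulrn_wge0.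
  rewrite degD degMn -mulr_natl natz => Mle; apply: le_trans Mle.
  have fr := lfree_tower uf (lfree_powers (n := r.+1) (nonconstV (P1_param_nonconst tp))).
  have {}fr : lfree (cst X) (fun ij : 'I_m * 'I_r.+1 => pull f (tau^-1 ^+ ij.2) * u ij.1).
    move=> c c0; apply: fr; rewrite -[RHS]c0; apply: eq_bigr => i _.
    by rewrite -(cstE (c i)).
  have := has_dim_free dM fr; rewrite card_prod !card_ord lez_nat; apply.
  move=> [i j] /=; rewrite rmorphXn -/y mulrC.
  apply/LspaceP => Q; rewrite coeffD opprD; apply: vgeM.
    by move/LspaceP: (uC i).
  have jr : (j <= r)%N by rewrite -ltnS.
  move/LspaceP/(_ Q): (yXE j); apply: vge_le.
  by rewrite !coeffMn lerN2 ler_wpMn2l.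
rewrite leNgt; apply/negP => lt_m.
(* If deg E <= m - 1, then r = deg C + 1 already violates the bound. *)
have E1 := deg_ge0 E0; have C1 := deg_ge0 C0; have := bound `|deg C|%N.+1.
have aux (c e M : int) : 0 <= c -> 0 <= e < M ->
    M * (c + 2) <= c + (c + 1) * e + 1 -> False.
  move=> c0 /andP[e0 eM] h; have : (c + 1) * (e + 1) <= (c + 1) * M.
    by rewrite ler_wpM2l ?addr_ge0// lezD1.
  by nia.
move=> h; apply: (aux (deg C) (deg E) m) => //; first by rewrite E1.
have h2 : (`|deg C|%N.+2)%:Z = deg C + 2 by lia.
have h1 : (`|deg C|%N.+1)%:Z = deg C + 1 by lia.
by rewrite PoszM h2 h1 in h.
Qed.

(** The divisor of a nonconstant y is the difference of two fibres of the morphism it defines, both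
    of degree m. *)
Lemma deg_is_div X (y : ratfun X) D : y != 0 -> is_div y D -> deg D = 0.
Proof.
move=> y0 yD; have [[c yc]|nc] := pselect (exists c, y = cst X c).
  suff -> : D = 0 by rewrite deg0.
  by apply: div_ext => P; rewrite coeff0 yD yc ord_cst.
have [|f [m [fy dm]]] := @nonconst_morphism _ X y.
  by move=> c; apply/eqP => yc; apply: nc; exists c.
have [P [P1 PE]] := P1_param_point P1T_param.
have [P' [P1' PE']] := P1_param_point P1TV_param.
suff -> : D = pull_div f << P >> - pull_div f << P' >>.
  by rewrite degB !(deg_fibre_P1 _ dm) subrr.
apply: div_ext => Q; rewrite coeffB !(pull_divE _ _ dm) !coeff_pt yD -fy ord_pull.
rewrite -mulrBr; congr (_ * _).
have := PE (fpt f Q); have := PE' (fpt f Q); rewrite ordV oppr_gt0.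
rewrite ![_ == fpt f Q]eq_sym; have [e|_] := eqVneq (fpt f Q) P.
  by rewrite e P1 => <-.
have [e|_] := eqVneq (fpt f Q) P'; last by move=> h1 h2; lia.
by rewrite e -[ord _ _]opprK -ordV P1' sub0r.
Qed.

(** Fibre degrees N(Q) are at most m. If a function of order 1 at P defines g of degree n, a fibre
    of the composite of g and f has degree m n, and this is the sum of e_Q N(Q) over a fibre of g
    containing P, where the e_Q sum to n; so N(P) = m. *)
Lemma deg_pull_div X Y (f : morphism X Y) m D : has_degree f m ->
  deg (pull_div f D) = m%:Z * deg D.
Proof.
move=> dm; pose N P := (\sum_(Q <- fibre f P) ram f Q)%N.
have NP P : deg (pull_div f << P >>) = (N P)%:Z by exact: deg_pull_pt dm.
have Nle P : (N P <= m)%N := sum_ram_fibre_le P dm.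
have degN E : deg (pull_div f E) = \sum_(P <- dom E) coeff P E * (N P)%:Z.
  suff {1}-> : pull_div f E = \sum_(P <- dom E) pull_div f << P >> *~ coeff P E.
    rewrite raddf_sum; apply: eq_bigr => P _.
    by rewrite raddfMz /= NP -mulrzr intz mulrC.
  apply: div_ext => Q; rewrite (pull_divE _ _ dm) coeff_sum -[E in LHS]freeg_sumE.
  rewrite coeff_sum mulr_sumr; apply: eq_bigr => P _.
  rewrite raddfMz /= coeffU (pull_divE _ _ dm) coeff_pt -mulrzr intz.
  by rewrite mulrAC mulrA.
suff NE P : N P = m.
  rewrite degN (deg_sum (uniq_dom D)) => [|P]; last by rewrite mem_dom.
  by rewrite mulr_sumr; apply: eq_bigr => P _; rewrite NE mulrC.
have [s Ps] := ord_unif P.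
have [|g [n [gs dn]]] := @nonconst_morphism _ Y s.
  by apply: (@ord_nonconst _ _ P); rewrite Ps.
have dgf : has_degree (mcomp g f) (m * n) := has_dim_tower dm dn.
have [O [_ OE]] := P1_param_point P1T_param.
have gP : fpt g P = O.
  apply/eqP; rewrite -OE; have := ord_pull g P P1T; rewrite gs Ps => e.
  by have := ram_gt0 g P; nia.
pose E := pull_div g << O >>.
have EP Q : coeff Q E = (ram g Q)%:Z * (O == fpt g Q)%:R.
  by rewrite (pull_divE _ _ dn) coeff_pt.
have E0 Q : 0 <= coeff Q E by rewrite EP mulr_ge0// ler0n.
have eE : pull_div (mcomp g f) << O >> = pull_div f E.
  apply: div_ext => Q; rewrite (pull_divE _ _ dgf) (pull_divE _ _ dm) EP.
  by rewrite /= coeff_pt PoszM mulrA.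
have : deg (pull_div f E) = m%:Z * deg E.
  by rewrite -eE (deg_fibre_P1 _ dgf) (deg_fibre_P1 _ dn) PoszM.
rewrite degN (deg_sum (uniq_dom E)) => [|Q]; last by rewrite mem_dom.
rewrite mulr_sumr => /eqP; rewrite eq_sym -subr_eq0 -sumrB psumr_eq0; last first.
  by move=> Q _; rewrite mulrC -mulrBr mulr_ge0// subr_ge0 lez_nat.
have PE : coeff P E != 0.
  by rewrite EP gP eqxx mulr1; have := ram_gt0 g P; lia.
move=> /allP/(_ P); rewrite mem_dom PE mulrC -mulrBr mulf_eq0 (negPf PE) /=.
by move=> /(_ isT); rewrite subr_eq0 => /eqP[->].
Qed.

Lemma fpt_surj X Y (f : morphism X Y) m P : has_degree f m ->
  exists Q, fpt f Q = P.
Proof.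
move=> dm; apply: contrapT => none.
have m0 : (0 < m)%N := has_dim_gt0 (oner_neq0 _) Logic.I dm.
have := deg_pull_div << P >> dm; rewrite deg_pt mulr1 (deg_pull_pt P dm).
have [_ SP] := fibreP P dm; rewrite big_seq big1 => [|Q]; first by case: (m) m0.
by rewrite SP => /eqP QP; case: none; exists Q.
Qed.

Lemma Lspace_deg_ge0 X (D : divisor X) y : y != 0 -> Lspace D y -> 0 <= deg D.
Proof.
move=> y0 /LspaceP yD; have [E yE] := is_div_exists y.
suff : 0 <= deg (D + E) by rewrite degD (deg_is_div y0 yE) addr0.
apply: deg_ge0 => P.
by rewrite coeffD yE -lerBlDl sub0r -vgeE.
Qed.

End PrincipalDivisors.

Section Classes.
Context (k : closedFieldType) (X : curve k).
Implicit Types (D E : divisor X).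

Lemma clsD D E : cls (D + E) = cls D + cls E. Proof. by rewrite /cls !piE. Qed.
Lemma clsN D : cls (- D) = - cls D. Proof. by rewrite /cls !piE. Qed.
Lemma clsB D E : cls (D - E) = cls D - cls E. Proof. by rewrite clsD clsN. Qed.

Lemma cls_rep (M : Pic X) : cls (rep M) = M. Proof. exact: reprK. Qed.

Lemma cls_eqP D E : cls D = cls E <-> exists2 y, y != 0 & is_div y (D - E).
Proof.
have pE : (D - E \in @principal k X) = (cls D == cls E).
  by rewrite Quotient.idealrBE.
split=> [/eqP|h]; first by rewrite -pE => /asboolP.
by apply/eqP; rewrite -pE; apply/asboolP.
Qed.

End Classes.

(** * Divisor classes *)

Section ClassTheory.
Context (k : closedFieldType) (X : curve k).
Implicit Types (D E : divisor X) (M N : Pic X).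

Lemma deg_cls D E : cls D = cls E -> deg D = deg E.
Proof.
case/cls_eqP=> y y0 /(deg_is_div y0)/eqP.
by rewrite degB subr_eq0 => /eqP.
Qed.

Lemma PicdP r D : Picd r (cls D) <-> deg D = r.
Proof.
split=> [[E /= <- /deg_cls//]|Dr]; by exists D.
Qed.

Lemma PicdE r M : Picd r M <-> deg (rep M) = r.
Proof. by rewrite -{1}(cls_rep M) PicdP. Qed.

Lemma PicdD r s M N : Picd r M -> Picd s N -> Picd (r + s) (M + N).
Proof.
by move=> [D Dr <-] [E Es <-]; rewrite -clsD; apply/PicdP; rewrite degD Dr Es.
Qed.

Lemma PicdB r s M N : Picd r M -> Picd s N -> Picd (r - s) (M - N).
Proof.
by move=> [D Dr <-] [E Es <-]; rewrite -clsB; apply/PicdP; rewrite degB Dr Es.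
Qed.

Lemma has_dim_mulr (F L : fieldType) (phi : {rmorphism F -> L}) (V U : set L) (y : L) m :
  y != 0 -> (forall z, V z <-> U (z * y)) -> has_dim phi V m -> has_dim phi U m.
Proof.
move=> y0 VU [e [Ve ef]]; exists (fun i => e i * y).
have sE c : \sum_l phi (c l) * (e l * y) = (\sum_l phi (c l) * e l) * y.
  by rewrite mulr_suml; apply: eq_bigr => i _; rewrite mulrA.
split=> [z|c].
  rewrite -{1}(divfK y0 z) -VU Ve; split=> -[c e1]; exists c.
    by rewrite sE -e1 divfK.
  by rewrite e1 sE mulfK.
by rewrite sE => /eqP; rewrite mulf_eq0 (negPf y0) orbF => /eqP /ef.
Qed.

Lemma Lspace_cls D E : cls D = cls E -> exists2 y, y != 0 &
  forall z, Lspace D z <-> Lspace E (z * y).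
Proof.
case/cls_eqP=> y y0 yD; exists y => // z.
have e P : vge P (- coeff P E) (z * y) = vge P (- coeff P D) z.
  by rewrite vge_mulE// -yD coeffB; congr vge; ring.
by split=> /LspaceP h; apply/LspaceP => P; have := h P; rewrite e.
Qed.

Lemma h0P D : has_dim (cst X) (Lspace D) (h0 (cls D)).
Proof.
have [m dm] := Lspace_dim (rep (cls D)).
have -> : h0 (cls D) = m.
  by apply: xget_unique => // n dn; exact: has_dim_uniq dn dm.
have [|y y0 yDE] := @Lspace_cls (rep (cls D)) D; first exact: cls_rep.
exact: has_dim_mulr y0 yDE dm.
Qed.

Lemma h0_uniq D m : has_dim (cst X) (Lspace D) m -> h0 (cls D) = m.
Proof. exact/has_dim_uniq/h0P. Qed.

Lemma h0_step D (P : closed_point X) : (h0 (cls D) <= h0 (cls (D + << P >>)%R) <= (h0 (cls D)).+1)%N.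
Proof. by have [m dm] := Lspace_step P (h0P D); rewrite (h0_uniq dm). Qed.

Lemma h0_gt0 D : (0 < h0 (cls D))%N <-> exists2 y, y != 0 & Lspace D y.
Proof.
split=> [h|[y y0 yD]]; last exact: has_dim_gt0 y0 yD (h0P D).
have [e [ef eV]] := (has_dimE _ _ _).1 (h0P D).
exists (e (Ordinal h)); first exact: lfree_neq0 ef.
rewrite eV; exact: lspan_mem.
Qed.

Lemma h0_effective M : (0 < h0 M)%N <->
  exists E, cls E = M /\ forall P, 0 <= coeff P E.
Proof.
rewrite -(cls_rep M) h0_gt0; split=> [[y y0 /LspaceP yD]|[E [ED E0]]].
  have [D' yD'] := is_div_exists y; exists (rep M + D'); split.
    by apply/cls_eqP; exists y => //; rewrite addrC addKr.
  by move=> P; rewrite coeffD yD' -lerBlDl sub0r -vgeE.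
have [y y0 yDE] := Lspace_cls ED; exists y => //.
rewrite -[y]mul1r -yDE; apply/LspaceP => P.
by rewrite /vge Defs.ord1 oppr_le0 E0 orbT.
Qed.

Lemma effective_deg0 D : (forall P, 0 <= coeff P D) -> deg D = 0 -> D = 0.
Proof.
move=> D0; rewrite (deg_sum (uniq_dom D)) => [|P]; last by rewrite mem_dom.
move/eqP; rewrite psumr_eq0// => /allP h; apply: div_ext => P; rewrite coeff0.
by apply/eqP/negPn/negP => PD; have := h P; rewrite mem_dom PD (negPf PD) => /(_ isT).
Qed.

Lemma cls_sum (I : Type) (r : seq I) (G : I -> divisor X) :
  cls (\sum_(i <- r) G i) = \sum_(i <- r) cls (G i).
Proof.
elim: r => [|i r IH]; last by rewrite !big_cons clsD IH.
by rewrite !big_nil -(subrr 0) clsB subrr.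
Qed.

Lemma cls0 : cls (0 : divisor X) = 0.
Proof. by rewrite -(subrr 0) clsB subrr. Qed.

End ClassTheory.

Section PullbackClasses.
Context (k : closedFieldType) (X Y : curve k) (f : morphism X Y) (m : nat).
Context (dm : has_degree f m).

Lemma pull_is_div y D : is_div y D -> is_div (pull f y) (pull_div f D).
Proof. by move=> yD P; rewrite (pull_divE _ _ dm) ord_pull yD. Qed.

Lemma pull_Pic_cls D : pull_Pic f (cls D) = cls (pull_div f D).
Proof.
rewrite /pull_Pic; have /cls_eqP[y y0 yD] := cls_rep (cls D).
apply/cls_eqP; exists (pull f y); first by rewrite fmorph_eq0.
by rewrite -(pull_divB _ _ dm); exact: pull_is_div.
Qed.

Lemma pull_PicD M N : pull_Pic f (M + N) = pull_Pic f M + pull_Pic f N.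
Proof.
rewrite -[M]cls_rep -[N]cls_rep -clsD !pull_Pic_cls -clsD.
by rewrite (pull_divD _ _ dm).
Qed.

Lemma pull_PicB M N : pull_Pic f (M - N) = pull_Pic f M - pull_Pic f N.
Proof.
rewrite -[M]cls_rep -[N]cls_rep -clsB !pull_Pic_cls -clsB.
by rewrite (pull_divB _ _ dm).
Qed.

End PullbackClasses.

Section P1Classes.
Context (k : closedFieldType).
Local Notation P1 := (P1 k).

(** With tau a parameter at Q and c the value of 1 / tau at P, the function 1 / tau - c has a zero
    at P and only a simple pole, at Q. Its divisor minus P - Q is effective of degree zero. *)
Lemma P1_points_equiv (P Q : closed_point P1) : cls << P >> = cls << Q >>.
Proof.
have [->//|PQ] := eqVneq P Q.
have [tau [tp Qt tauQ]] := P1_point_param Q.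
have tV : nonconst tau^-1 := nonconstV (P1_param_nonconst tp).
have reg R : R != Q -> vge R 0 tau^-1.
  by move=> RQ; rewrite /vge ordV oppr_ge0 tauQ ?orbT.
have [c Pc] := residue (reg P PQ).
have yn := nonconstB c tV; have y0 := nonconst_neq0 yn.
have [D yD] := is_div_exists (tau^-1 - cst P1 c).
apply/cls_eqP; exists (tau^-1 - cst P1 c) => //.
suff : D - (<< P >> - << Q >>) = 0 by move/eqP; rewrite subr_eq0 => /eqP<-.
apply: effective_deg0; last by rewrite !degB !deg_pt (deg_is_div y0 yD) !subrr.
move=> R; rewrite !coeffB !coeff_pt yD.
have [<-|PR] := eqVneq P R.
  by rewrite [Q == P]eq_sym (negPf PQ) subr0 subr_ge0 -vgeE.
have [<-|QR] := eqVneq Q R.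
  rewrite sub0r opprK -lerBlDr sub0r -vgeE//; apply: vgeB.
    by rewrite /vge ordV Qt lexx orbT.
  by apply: vge_le (vge_cst _ _).
by rewrite !subr0 -vgeE// vgeB ?vge_cst// reg// eq_sym.
Qed.

Lemma O1_pt (P : closed_point P1) : O1 k = cls << P >>.
Proof.
apply: xget_unique; first by exists P.
by move=> _ [Q _ <-]; exact: P1_points_equiv.
Qed.

Lemma P1_principal (D : divisor P1) : deg D = 0 ->
  exists2 y, y != 0 & is_div y D.
Proof.
move=> D0; have [P _] := P1_param_point (P1T_param k).
have clsZ (n : int) Q : cls << n *g Q >> = cls << Q >> *~ n.
  elim/int_ind: n => [|n IH|n IH].
  - by rewrite freegU0 cls0.
  - by rewrite intS -freegUD clsD IH mulrzDr.
  - by rewrite intS opprD -freegUD clsD -freegUN clsN IH mulrzDr mulrNz.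
suff /cls_eqP : cls D = cls 0 by rewrite subr0.
rewrite cls0 -[D]freeg_sumE cls_sum.
transitivity (\sum_(z <- dom D) cls << P >> *~ coeff z D).
  by apply: eq_bigr => Q _; rewrite clsZ (P1_points_equiv Q P).
rewrite -mulrz_sumr -(deg_sum (uniq_dom D)) => [|Q]; last by rewrite mem_dom.
by rewrite D0 mulr0z.
Qed.

End P1Classes.

(** * The trace form *)

Section Trace.
Context (F L : fieldType) (phi : {rmorphism F -> L}).

Definition lbasis (I : finType) (e : I -> L) : Prop :=
  lfree phi e /\ forall y, lspan phi e y.

Definition lcoord (I : finType) (e : I -> L) (y : L) : I -> F :=
  if pselect (lspan phi e y) is left h then projT1 (cid h) else fun=> 0.

Section Coordinates.
Context (I : finType) (e : I -> L) (eB : lbasis e).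

Lemma lcoordE y : y = \sum_i phi (lcoord e y i) * e i.
Proof.
rewrite /lcoord; case: pselect => [h|]; last by case: eB => _ /(_ y).
exact: (projT2 (cid h)).
Qed.

Lemma lcoord_uniq y c : y = \sum_i phi (c i) * e i -> forall i, lcoord e y i = c i.
Proof.
move=> yc i; apply/eqP; rewrite -subr_eq0; apply/eqP; move: i; apply: eB.1.
under eq_bigr do rewrite rmorphB mulrBl.
by rewrite sumrB -lcoordE -yc subrr.
Qed.

Lemma lcoordD y z i : lcoord e (y + z) i = lcoord e y i + lcoord e z i.
Proof.
apply: (lcoord_uniq (c := fun i => lcoord e y i + lcoord e z i)).
under eq_bigr do rewrite rmorphD mulrDl.
by rewrite big_split -!lcoordE.
Qed.

Lemma lcoordZ a y i : lcoord e (phi a * y) i = a * lcoord e y i.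
Proof.
apply: (lcoord_uniq (c := fun i => a * lcoord e y i)).
under eq_bigr do rewrite rmorphM -mulrA.
by rewrite -mulr_sumr -lcoordE.
Qed.

Lemma lcoord_basis i j : lcoord e (e i) j = (j == i)%:R.
Proof.
apply: (lcoord_uniq (c := fun j => (j == i)%:R)).
rewrite (bigD1 i)//= eqxx rmorph1 mul1r big1 ?addr0// => l /negPf->.
by rewrite rmorph0 mul0r.
Qed.

Lemma lcoord_sum (J : finType) (G : J -> L) i :
  lcoord e (\sum_j G j) i = \sum_j lcoord e (G j) i.
Proof.
have l0 : lcoord e 0 i = 0 by rewrite -(mul0r 0) -(rmorph0 phi) lcoordZ mul0r.
exact: (big_morph (fun y => lcoord e y i) (fun y z => lcoordD y z i) l0).
Qed.

(** The trace of multiplication by w, computed in the basis e; [ltrace_basis] gives its independence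
    of the basis. *)
Definition ltrace (w : L) : F := \sum_i lcoord e (w * e i) i.

Lemma ltraceD y z : ltrace (y + z) = ltrace y + ltrace z.
Proof. by rewrite -big_split; apply: eq_bigr => i _; rewrite mulrDl lcoordD. Qed.

Lemma ltraceZ a y : ltrace (phi a * y) = a * ltrace y.
Proof.
by rewrite /ltrace mulr_sumr; apply: eq_bigr => i _; rewrite -mulrA lcoordZ.
Qed.

Lemma ltrace_sum (J : finType) (G : J -> L) :
  ltrace (\sum_j G j) = \sum_j ltrace (G j).
Proof.
have t0 : ltrace 0 = 0 by rewrite -(mul0r 0) -(rmorph0 phi) ltraceZ mul0r.
exact: (big_morph ltrace ltraceD t0).
Qed.

Lemma ltrace1 : ltrace 1 = #|I|%:R.
Proof.
rewrite /ltrace; under eq_bigr do rewrite mul1r lcoord_basis eqxx.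
by rewrite sumr_const.
Qed.

End Coordinates.

Lemma ltrace_basis (I J : finType) (e : I -> L) (b : J -> L) w :
  lbasis e -> lbasis b -> ltrace e w = ltrace b w.
Proof.
move=> eB bB; pose A i j := lcoord b (e i) j; pose B j i := lcoord e (b j) i.
pose M i l := lcoord e (w * e i) l.
have BA j j' : \sum_i B j i * A i j' = (j' == j)%:R.
  rewrite -(lcoord_basis bB) (lcoordE eB (b j)) (lcoord_sum bB).
  by apply: eq_bigr => i _; rewrite (lcoordZ bB).
have AB i i' : \sum_j A i j * B j i' = (i' == i)%:R.
  rewrite -(lcoord_basis eB) (lcoordE bB (e i)) (lcoord_sum eB).
  by apply: eq_bigr => j _; rewrite (lcoordZ eB).
have tb j : lcoord b (w * b j) j = \sum_i \sum_l B j i * M i l * A l j.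
  rewrite {1}(lcoordE eB (b j)) mulr_sumr (lcoord_sum bB).
  apply: eq_bigr => i _; rewrite mulrCA (lcoordZ bB) {1}(lcoordE eB (w * e i)).
  rewrite (lcoord_sum bB) mulr_sumr; apply: eq_bigr => l _.
  by rewrite (lcoordZ bB) mulrA.
rewrite /ltrace; under [RHS]eq_bigr do rewrite tb.
rewrite exchange_big /=; apply: eq_bigr => i _.
rewrite exchange_big /= (bigD1 i)//= [X in _ = X + _](_ : _ = M i i).
  rewrite big1 ?addr0// => l li; transitivity (M i l * \sum_j A l j * B j i).
    by rewrite mulr_sumr; apply: eq_bigr => j _; ring.
  by rewrite AB eq_sym (negPf li) mulr0.
transitivity (M i i * \sum_j A i j * B j i); last by rewrite AB eqxx mulr1.
by rewrite mulr_sumr; apply: eq_bigr => j _; ring.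
Qed.

Section DualBasis.
Context (m : nat) (e : 'I_m -> L) (eB : lbasis e) (m0 : m%:R != 0 :> F).
Local Notation tr := (ltrace e).

(** For y nonzero, m = tr(y * y^-1) would be a combination of the vanishing tr(y e_i). *)
Lemma ltrace_nondeg y : (forall i, tr (y * e i) = 0) -> y = 0.
Proof.
move=> y0; apply/eqP/negPn/negP => yn0; case/eqP: m0.
rewrite -[m]card_ord -(ltrace1 eB) -(mulfV yn0) (lcoordE eB y^-1) mulr_sumr.
rewrite (ltrace_sum eB) big1// => i _.
by rewrite mulrCA (ltraceZ eB) y0 mulr0.
Qed.

Lemma dual_basis_exists : exists b : 'I_m -> L, lbasis b /\
  forall i j, tr (b i * e j) = (i == j)%:R.
Proof.
pose G : 'M[F]_m := \matrix_(i, j) tr (e i * e j).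
have Gu : G \in unitmx.
  rewrite -row_free_unit -kermx_eq0; apply/eqP/row_matrixP => i.
  rewrite row0; set v := row i _.
  have vG : v *m G = 0 by apply/sub_kermxP; exact: row_sub.
  have y0 : \sum_l phi (v 0 l) * e l = 0.
    apply: ltrace_nondeg => j; rewrite mulr_suml (ltrace_sum eB).
    have := congr1 (fun B : 'rV_ _ => B 0 j) vG; rewrite mxE [X in _ = X]mxE => vGj; rewrite -[RHS]vGj.
    by apply: eq_bigr => l _; rewrite -mulrA (ltraceZ eB) [G _ _]mxE.
  by apply/rowP => l; rewrite (eB.1 _ y0) [X in _ = X]mxE.
pose b i := \sum_l phi (invmx G i l) * e l.
have bE i j : tr (b i * e j) = (i == j)%:R.
  rewrite mulr_suml (ltrace_sum eB).
  have := congr1 (fun B : 'M_m => B i j) (mulVmx Gu); rewrite mxE [X in _ = X]mxE => <-.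
  by apply: eq_bigr => l _; rewrite -mulrA (ltraceZ eB) [G _ _]mxE.
have bf : lfree phi b.
  move=> c c0 j; have : tr ((\sum_i phi (c i) * b i) * e j) = 0.
    by rewrite c0 mul0r -(mul0r 0) -(rmorph0 phi) (ltraceZ eB) mul0r.
  rewrite mulr_suml (ltrace_sum eB) (bigD1 j)//= -mulrA (ltraceZ eB) bE eqxx mulr1.
  rewrite big1 ?addr0// => i ij.
  by rewrite -mulrA (ltraceZ eB) bE (negPf ij) mulr0.
have dT : has_dim phi setT m.
  by apply/has_dimE; exists e; split; [exact: eB.1|apply/seteqP; split=> // y _; exact: eB.2].
exists b; split=> //; split=> // y.
by apply: (lfree_span dT bf) => //; rewrite card_ord.
Qed.

Lemma lcoord_dual (b : 'I_m -> L) y i : (forall i j, tr (b i * e j) = (i == j)%:R) ->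
  lbasis b -> lcoord b y i = tr (y * e i).
Proof.
move=> be bB; rewrite {2}(lcoordE bB y) mulr_suml (ltrace_sum eB) (bigD1 i)//=.
rewrite -mulrA (ltraceZ eB) be eqxx mulr1 big1 ?addr0// => j ji.
by rewrite -mulrA (ltraceZ eB) be (negPf ji) mulr0.
Qed.

End DualBasis.

End Trace.

(** * The trace form over a point *)

Section LocalTrace.
Context (k : closedFieldType) (char0 : [pchar k] =i pred0).
Context (X Y : curve k) (f : morphism X Y) (m : nat) (dm : has_degree f m).
Context (I : finType) (e : I -> ratfun X) (eB : lbasis (pull f) e).
Local Notation tr := (ltrace (pull f) e).
Implicit Types (P : closed_point Y) (Q : closed_point X).

Lemma curve_char0 (Z : curve k) n : (0 < n)%N -> n%:R != 0 :> ratfun Z.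
Proof.
rewrite -(rmorph_nat (cst Z)) fmorph_eq0 lt0n.
by rewrite (pcharf0P k).1.
Qed.

(** On the whole fibre an adapted family has as many members as the sum of the ramification indices,
    which is m. *)
Lemma adapted_basis P : exists b : fib_idx f (fibre f P) -> ratfun X,
  adapted b /\ lbasis (pull f) b.
Proof.
have [uS SP] := fibreP P dm.
have SP' Q : Q \in fibre f P -> fpt f Q = P by rewrite SP => /eqP.
have [b bA] := adapted_exists f uS; exists b; split=> //.
have bf := adapted_lfree SP' bA.
split=> // y; apply: (lfree_span dm bf) => //; rewrite card_fib_idx.
by have := deg_pull_div << P >> dm; rewrite (deg_pull_pt P dm) deg_pt mulr1 => -[].
Qed.

(* In an adapted basis at P, multiplication by w is triangular modulo P, with
   the value of w at Q on the diagonal entries indexed by Q. *)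
Lemma trace_residue P w (a : closed_point X -> k) :
  (forall Q, fpt f Q = P -> vge Q 1 (w - cst X (a Q))) ->
  vge P 1 (tr w - cst Y (\sum_(Q <- fibre f P) a Q *+ ram f Q)).
Proof.
move=> wa; have [b [bA bB]] := adapted_basis P.
have [uS SP] := fibreP P dm; set S := fibre f P in b bA bB uS SP *.
have SP' Q : Q \in S -> fpt f Q = P by rewrite SP => /eqP.
rewrite (ltrace_basis w eB bB) (sum_fib_pt S).
have -> : \sum_(i : 'I_(size S)) a (fib_pt i) *+ ram f (fib_pt i) =
    \sum_(p : fib_idx f S) a (fib_pt (tag p)).
  rewrite -(sig_big_dep xpredT (fun _ _ => true)
    (fun i (j : 'I_(ram f (fib_pt i))) => a (fib_pt i))).
  by apply: eq_big => // i _; rewrite sumr_const card_ord.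
rewrite rmorph_sum -sumrB; apply: vge_sum => p _.
have Qp (i : 'I_(size S)) : fpt f (fib_pt i) = P by rewrite (fib_ptP SP').
set A := a (fib_pt (tag p)).
pose c l := lcoord (pull f) b (w * b p) l - cst Y A * (l == p)%:R.
have cE : \sum_l pull f (c l) * b l = (w - cst X A) * b p.
  rewrite mulrBl {1}(lcoordE bB (w * b p)) /c.
  under eq_bigr do rewrite rmorphB mulrBl.
  rewrite sumrB; congr (_ - _); rewrite (bigD1 p)//= eqxx mulr1 pull_cst.
  by rewrite big1 ?addr0// => l /negPf->; rewrite mulr0 rmorph0 mul0r.
have <- : c p = lcoord (pull f) b (w * b p) p - cst Y A by rewrite /c eqxx mulr1.
have [bp bpQ bpN] := bA p.
have w0 Q : fpt f Q = P -> vge Q 0 (w - cst X A).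
  move=> /wa h; rewrite -(subrKA (cst X (a Q))) -rmorphB; apply: vgeD.
    by apply: vge_le h.
  exact: vge_cst.
have yQ : vge (fib_pt (tag p)) ((tagged p : nat)%:Z + 1) ((w - cst X A) * b p).
  by rewrite vge_mulE// bpQ addrC addKr; exact: wa.
have yN (i : 'I_(size S)) : i != tag p -> vge (fib_pt i) (ram f (fib_pt i))%:Z ((w - cst X A) * b p).
  by move=> ip; apply: vgeMl; [exact: w0|rewrite vgeE//; exact: bpN].
have cint l : vge P 0 (c l).
  apply: (adapted_integral uS SP' bA) => Q; rewrite cE => QS; have QP := SP' _ QS.
  rewrite -(addr0 0); apply: vgeM; first exact: w0.
  have /tnthP[i ->] : Q \in in_tuple S by [].
  rewrite -/(fib_pt i) vgeE//; have [->|ip] := eqVneq i (tag p); first by rewrite bpQ.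
  by apply: le_trans (bpN _ ip).
(* Were c_p a unit at P, the dominant term p0 of (w - A) b_p would have a unit coefficient as well,
   and its order at its own point would be too small: less than the ramification index at a point
   other than that of p, at most j at the point of p. *)
apply: contrapT => /negP cp1.
have cp : c p != 0 by apply: contraNneq cp1 => ->; exact: vge0.
have ocp := unit_ord cp (cint p) cp1.
have [p0 [c0 omin y0 oy]] := adapted_val SP' bA cp.
have [le0 lexp] := omin p cp.
have o0 : ord P (c p0) = 0.
  by apply/eqP; rewrite eq_le -{1}ocp le0 -vgeE// cint.
rewrite cE o0 mulr0 add0r in y0 oy.
have [e0|ne] := eqVneq (tag p0) (tag p); last first.
  by have := yN _ ne; rewrite vgeE// oy lez_nat leqNgt ltn_ord.
have oy' : ord (fib_pt (tag p)) ((w - cst X A) * b p) = (tagged p0 : nat)%:Z.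
  by rewrite -e0.
have := yQ; rewrite vgeE// oy' lezD1 ltz_nat.
by rewrite ltnNge lexp// ocp o0.
Qed.

Lemma trace_vanish P w : (forall Q, fpt f Q = P -> vge Q 1 w) -> vge P 1 (tr w).
Proof.
move=> w1; have := @trace_residue P w (fun=> 0).
rewrite (_ : \sum_(Q <- _) _ = 0) ?rmorph0 ?subr0.
  by apply=> Q QP; rewrite /= ?rmorph0 ?subr0; exact: w1.
by rewrite big1// => Q _; rewrite mul0rn.
Qed.

(** At P the trace is congruent to c times the ramification index of Q0, which is nonzero in
    characteristic zero. *)
Lemma trace_single P Q0 w c : fpt f Q0 = P -> c != 0 ->
  vge Q0 1 (w - cst X c) -> (forall Q, fpt f Q = P -> Q != Q0 -> vge Q 1 w) ->
  ~~ vge P 1 (tr w).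
Proof.
move=> Q0P c0 wc w1; have [uS SP] := fibreP P dm.
have := @trace_residue P w (fun Q => if Q == Q0 then c else 0).
rewrite (bigD1_seq Q0) ?SP ?Q0P ?eqxx//= big1 ?addr0 => [h|Q /negPf->]; last first.
  by rewrite mul0rn.
apply/negP => t1; have : vge P 1 (cst Y (c *+ ram f Q0)).
  rewrite -[cst Y _](subKr (tr w)); apply: vgeB => //; apply: h => Q QP.
  by case: eqVneq => [->//|QQ]; rewrite rmorph0 subr0; exact: w1.
rewrite vgeE ?ord_cst// fmorph_eq0 -mulr_natr mulf_neq0//.
by rewrite -(fmorph_eq0 (cst Y)) rmorph_nat curve_char0// ram_gt0.
Qed.

(* Sections of O(D) over the local ring of P. *)
Definition local_sections (D : divisor X) P : set (ratfun X) :=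
  [set y | forall Q, fpt f Q = P -> vge Q (- coeff Q D) y].

(** Local duality: R is the different, tame in characteristic zero, so the dual of O(D) for the
    trace form is O(R - D). *)
Lemma local_sections_trace D R P y :
  (forall Q, coeff Q R = (ram f Q)%:Z - 1) -> local_sections (R - D) P y <->
  forall z, local_sections D P z -> vge P 0 (tr (y * z)).
Proof.
move=> RE; have [s Ps] := ord_unif P.
have s0 : s != 0 by apply: (@ord_neq0 _ _ P); rewrite Ps.
have vtr w : vge P 0 (tr w) = vge P 1 (tr (pull f s * w)).
  by rewrite (ltraceZ eB) mulrC vge_mulE// Ps subrr.
have os Q : fpt f Q = P -> ord Q (pull f s) = (ram f Q)%:Z.
  by move=> QP; rewrite ord_pull QP Ps mulr1.
have ps0 : pull f s != 0 by rewrite fmorph_eq0.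
split=> [yD z zD|yt Q0 Q0P].
  rewrite vtr; apply: trace_vanish => Q QP.
  rewrite mulrC vge_mulE// os//.
  have -> : 1 - (ram f Q)%:Z = - coeff Q (R - D) - coeff Q D.
    by rewrite coeffB RE; ring.
  by apply: vgeM; [exact: yD|exact: zD].
apply: contrapT => /negP yn.
have y0 : y != 0 by apply: contraNneq yn => ->; exact: vge0.
move: yn; rewrite vgeE// coeffB RE -ltNge => yQ0.
have [uS SP] := fibreP P dm; set S := fibre f P in uS SP.
have Q0S : Q0 \notin rem Q0 S by rewrite mem_rem_uniqF.
(* N makes z a section of O(D) and s y z vanish at the other points of the fibre. The order
   prescribed at Q0 makes s y z a unit there, so that its trace does not vanish at P. *)
pose N : int := \sum_(Q <- S) (`|coeff Q D| + `|ord Q y| + 1).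
have [z [z0 zQ0 zS]] := weak_approximation (- (ram f Q0)%:Z - ord Q0 y) N Q0S.
have NS Q : Q \in S -> `|coeff Q D| + `|ord Q y| + 1 <= N.
  move=> QS; rewrite /N (big_rem Q)//= lerDl sumr_ge0//.
have zD : local_sections D P z.
  move=> Q QP; rewrite vgeE//; have [->|QQ] := eqVneq Q Q0; first by rewrite zQ0; lia.
  have QS : Q \in S by rewrite SP QP.
  have := zS Q; rewrite mem_rem_uniq// inE QQ QS => /(_ isT).
  have := NS Q QS; clear.
  by move: (ord Q z) (coeff Q D) (ord Q y) N => a b c n; lia.
have := yt z zD; rewrite vtr; apply/negP.
set w := pull f s * (y * z).
have w0 : w != 0 by rewrite !mulf_neq0.
have ow : ord Q0 w = 0 by rewrite !ordM ?mulf_neq0// os// zQ0; ring.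
have [|c wc] := @residue _ _ Q0 w; first by rewrite vgeE// ow.
have c0 : c != 0.
  by apply: contraTneq wc => ->; rewrite rmorph0 subr0 vgeE// ow.
apply: (trace_single Q0P c0 wc) => Q QP QQ.
have QS : Q \in S by rewrite SP QP.
rewrite vgeE// !ordM ?mulf_neq0// os//.
have := zS Q; rewrite mem_rem_uniq// inE QQ QS => /(_ isT).
have := NS Q QS; clear.
by move: (ord Q z) (coeff Q D) (ord Q y) N (ram f Q) => a b c n r; lia.
Qed.

End LocalTrace.

(** * Riemann-Roch on a cover of the line *)

Section LocalSections.
Context (k : closedFieldType) (X Y : curve k) (f : morphism X Y).
Context (D : divisor X) (P : closed_point Y).
Local Notation M := (local_sections f D P).

Lemma local_sectionsD y z : M y -> M z -> M (y + z).
Proof. by move=> My Mz Q QP; apply: vgeD; [exact: My|exact: Mz]. Qed.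

Lemma local_sectionsZ c y : vge P 0 c -> M y -> M (pull f c * y).
Proof.
move=> c0 My Q QP; apply: vgeMl; last exact: My.
have [->|cn0] := eqVneq c 0; first by rewrite rmorph0 vge0.
move: c0; rewrite !vgeE ?fmorph_eq0// ord_pull QP => c0.
by rewrite mulr_ge0.
Qed.

Lemma local_sections_sum (I : finType) (G : I -> ratfun X) :
  (forall i, M (G i)) -> M (\sum_i G i).
Proof.
by move=> H Q QP; apply: vge_sum => i _; exact: H.
Qed.

Lemma local_sectionsN y : M y -> M (- y).
Proof. by move=> My Q QP; rewrite vgeN; exact: My. Qed.

End LocalSections.

Lemma Lspace_local (k : closedFieldType) (X Y : curve k) (f : morphism X Y) D y :
  Lspace D y <-> forall P, local_sections f D P y.
Proof.
rewrite LspaceP; split=> h; first by move=> P Q _; exact: h.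
by move=> Q; exact: (h (fpt f Q) Q).
Qed.

Lemma divisor_ind (k : closedFieldType) (X : curve k) (Pr : divisor X -> Prop) :
  Pr 0 -> (forall D Q, (forall P, 0 <= coeff P D) -> Pr D -> Pr (D + << Q >>)) ->
  forall D, (forall P, 0 <= coeff P D) -> Pr D.
Proof.
move=> Pr0 PrS D; have [n] := ubnP `|deg D|%N.
elim: n D => // n IH D /ltnSE Dn D0.
have [->//|Dneq] := eqVneq D 0.
have [P PD] : exists P, 0 < coeff P D.
  apply: contrapT => none; case/eqP: Dneq; apply: div_ext => P; rewrite coeff0.
  apply/eqP; rewrite eq_le D0 andbT leNgt; apply/negP => h; apply: none.
  by exists P.
have D0' Q : 0 <= coeff Q (D - << P >>).
  rewrite coeffB coeff_pt; case: eqP => [<-|_]; last by rewrite subr0.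
  by rewrite subr_ge0 -gtz0_ge1.
have dD : deg (D - << P >>) = deg D - 1 by rewrite degB deg_pt.
have d1 := deg_ge0 D0'.
rewrite -(subrK << P >> D); apply: PrS => //; apply: IH => //.
by rewrite dD in d1 *; lia.
Qed.

Lemma vge_mulz (k : closedFieldType) (X : curve k) (P : closed_point X) tau n (r : int) y :
  ord P tau = 1 -> vge P n (tau ^ r * y) = vge P (n - r) y.
Proof.
move=> Pt; have t0 : tau != 0 by apply: (@ord_neq0 _ _ P); rewrite Pt.
by rewrite mulrC vge_mulE ?expfz_neq0// ordZ Pt mul1r.
Qed.

(* Keeping the projective line abstract prevents conversion from unfolding the
   field of fractions. *)
Record line_coordinate (k : closedFieldType) (Y : curve k) (T : ratfun Y) : Prop :=
LineCoordinate {
  line_nonconst : nonconst T;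
  line_param : forall P : closed_point Y, exists tau,
    [/\ (exists c, tau = T - cst Y c) \/ tau = T^-1, ord P tau = 1 &
        forall Q, Q != P -> ord Q tau <= 0];
  line_equiv : forall P Q : closed_point Y, cls << P >> = cls << Q >>;
  line_poly : forall (oo : closed_point Y) z, ord oo T < 0 ->
    (forall P, P != oo -> vge P 0 z) -> exists p, z = ev T p }.

(** * The direct image of O(D) on the line as a sum of line bundles *)

Section Reduction.
Context (k : closedFieldType) (char0 : [pchar k] =i pred0).
Context (X Y : curve k) (h : morphism X Y) (m : nat) (dm : has_degree h m).
Context (T : ratfun Y) (TY : line_coordinate T).
Context (oo : closed_point Y) (ooT : ord oo (T^-1) = 1).
Context (ooP : forall Q : closed_point Y, (0 < ord Q (T^-1)) = (Q == oo)).
Local Notation L := (ratfun X).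
Let H := pull_div h << oo >>.

Lemma H_coeff Q : coeff Q H = (ram h Q)%:Z * (oo == fpt h Q)%:R.
Proof. by rewrite /H (pull_divE _ _ dm) coeff_pt. Qed.

(** The function 1 / T is a local equation of [oo], so a twist by r H acts over [oo] only, through
    T^-r. *)
Lemma H_local D r P y : local_sections h (D + H *~ r) P y <->
  local_sections h D P (if P == oo then pull h ((T^-1) ^ r) * y else y).
Proof.
have T0 : T^-1 != 0 by apply: (@ord_neq0 _ _ oo); rewrite ooT.
suff e Q : fpt h Q = P -> vge Q (- coeff Q (D + H *~ r)) y =
    vge Q (- coeff Q D) (if P == oo then pull h ((T^-1) ^ r) * y else y).
  by split=> hy Q QP; have := hy Q QP; rewrite (e Q QP).
move=> QP; rewrite coeffD raddfMz /= H_coeff QP [oo == _]eq_sym.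
case: eqP => [Poo|_]; last by rewrite mulr0 mul0rz addr0.
rewrite [pull h _ * y]mulrC vge_mulE ?fmorph_eq0 ?expfz_neq0// ord_pull QP Poo ordZ ooT.
by rewrite mulr1 mul1r opprD -mulrzr intz.
Qed.

Lemma finite_regular P : P != oo -> vge P 0 T.
Proof.
rewrite -ooP -leNgt ordV oppr_le0 => PT.
by rewrite /vge PT orbT.
Qed.

Lemma poly_regular p Q : fpt h Q != oo -> vge Q 0 (pull h (ev T p)).
Proof.
move=> Qoo; have := @local_sectionsZ _ _ _ h 0 (fpt h Q) (ev T p) 1.
rewrite mulr1 => /(_ _ _ Q erefl); rewrite coeff0 oppr0; apply.
  by rewrite evE; apply/vge_horner/finite_regular.
by move=> Q' _; rewrite coeff0 oppr0 vge1.
Qed.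

Lemma vanishing_poly (S : seq (closed_point X)) (N : nat) :
  exists2 p : {poly k}, p != 0 & forall Q, Q \in S -> fpt h Q != oo ->
    vge Q N%:Z (pull h (ev T p)).
Proof.
elim: S => [|Q S [p p0 pS]]; first by exists 1 => //; exact: oner_neq0.
have [Qoo|Qoo] := eqVneq (fpt h Q) oo.
  exists p => // R; rewrite inE => /orP[/eqP->|/pS//]; by rewrite Qoo eqxx.
have [c Qc] := residue (finite_regular Qoo).
have Xc0 : 'X - c%:P != 0 :> {poly k} by rewrite polyXsubC_eq0.
exists (p * ('X - c%:P) ^+ N); first by rewrite mulf_neq0// expf_neq0.
move=> R RS Roo; rewrite !rmorphM.
have [->|RQ] := eqVneq R Q.
  rewrite mulrC -(addr0 N%:Z) vgeM// ?poly_regular//.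
  rewrite !rmorphXn rmorphB evX evC.
  have y0 : T - cst Y c != 0 := nonconst_neq0 (nonconstB c (line_nonconst TY)).
  rewrite vgeE ?expf_neq0 ?fmorph_eq0// ordX -mulr_natl natz ord_pull.
  rewrite ler_peMr//; rewrite vgeE// in Qc; have := ram_gt0 h Q; move: Qc.
  by move: (ord _ _) (ram h Q) => a b; clear; nia.
rewrite mulrC vgeMl ?poly_regular//; apply: pS => //.
by move: RS; rewrite inE (negPf RQ).
Qed.

(** A polynomial in T removes the excess poles over finite points, and a large twist r those over
    [oo]. *)
Lemma clear_poles (D : divisor X) (y : L) : exists (p : {poly k}) (r : nat), p != 0 /\
  Lspace (D + H *~ r%:Z) (pull h (ev T p) * y).
Proof.
have [S SP] := finite_support y.
pose N : nat := \sum_(Q <- S ++ dom D) (`|ord Q y| + `|coeff Q D|)%N.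
have [p p0 pS] := vanishing_poly (S ++ dom D) N.
pose w := pull h (ev T p) * y.
pose r : nat := \sum_(Q <- fibre h oo) (`|ord Q w| + `|coeff Q D|)%N.
exists p, r; split=> //; apply/LspaceP => Q.
have [w0|w0] := eqVneq w 0; first by rewrite -/w w0 vge0.
rewrite coeffD raddfMz /= H_coeff -mulrzr intz.
have [Qoo|Qoo] := eqVneq (fpt h Q) oo.
  rewrite mulr1 vgeE//.
  have : (`|ord Q w| + `|coeff Q D| <= r)%N.
    by rewrite /r (big_rem Q) ?(fibreP _ dm).2 ?Qoo//= leq_addr.
  have := ram_gt0 h Q; rewrite -/w; clear.
  by move: (ord Q w) (coeff Q D) (ram h Q) r => a b c r; nia.
rewrite mulr0 mul0r addr0.
have reg := poly_regular p Qoo.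
have [QS|QS] := boolP (Q \in S ++ dom D).
  have := vgeM (pS Q QS Qoo) (vge_ord Q y); apply: vge_le.
  have : (`|ord Q y| + `|coeff Q D| <= N)%N by rewrite /N (big_rem Q)//= leq_addr.
  by clear; move: (ord Q y) (coeff Q D) N => a b N; lia.
move: QS; rewrite mem_cat negb_or mem_dom negbK => /andP[QS /eqP->].
rewrite oppr0 vgeMl//; have -> : 0 = ord Q y; last exact: vge_ord.
by apply/esym/eqP; apply: contraNT QS => /SP.
Qed.

(** Each e_l is a map from O(- d_l) to h_* O(D); together they are an isomorphism at the generic
    point. *)
Definition graded_basis (D : divisor X) (e : 'I_m -> L) (d : 'I_m -> int) : Prop :=
  lbasis (pull h) e /\ forall l, Lspace (D + H *~ d l) (e l).

Lemma degree_gt0 : (0 < m)%N.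
Proof. exact: has_dim_gt0 (oner_neq0 _) Logic.I dm. Qed.

Lemma deg_H : deg H = m%:Z.
Proof. by rewrite /H (deg_pull_div _ dm) deg_pt mulr1. Qed.

Lemma graded_basis_exists D : exists e d, graded_basis D e d.
Proof.
have [u [uf _]] := (has_dimE _ _ _).1 dm.
have /choice[p /choice[r pr]] := fun l => clear_poles D (u l).
exists (fun l => pull h (ev T (p l)) * u l), (fun l => (r l)%:Z).
split=> [|l]; last by case: (pr l).
have ef : lfree (pull h) (fun l => pull h (ev T (p l)) * u l).
  move=> c; under eq_bigr do rewrite mulrA -rmorphM.
  move=> /uf c0 l; have /eqP := c0 l; rewrite mulf_eq0 ev_eq0; last exact: (line_nonconst TY).
  by have [/negPf-> _] := pr l; rewrite orbF => /eqP.
split=> // y; apply: (lfree_span dm ef) => //.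
by rewrite card_ord.
Qed.

Lemma graded_basis_bound D e d l : graded_basis D e d -> - `|deg D| <= d l.
Proof.
move=> [eB eD]; have := Lspace_deg_ge0 (lfree_neq0 l eB.1) (eD l).
rewrite degD raddfMz /= deg_H -mulrzr intz; have := degree_gt0.
by clear; move: (deg D) (d l) => a b; nia.
Qed.

(** The sum of the O(- d_l) has the largest possible degree, which forces its map to h_* O(D) to be
    an isomorphism. *)
Definition minimal_basis D e d : Prop := graded_basis D e d /\
  forall e' d', graded_basis D e' d' -> \sum_l d l <= \sum_l d' l.

Lemma minimal_basis_exists D : exists e d, minimal_basis D e d.
Proof.
pose sh (d : 'I_m -> int) := \sum_l (d l + `|deg D|).
have shE d : sh d = \sum_l d l + `|deg D| *+ m.
  by rewrite /sh big_split sumr_const card_ord.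
have sh0 e d : graded_basis D e d -> 0 <= sh d.
  move=> g; apply: sumr_ge0 => l _; have := graded_basis_bound l g; lia.
have exn : exists n, `[< exists e d, graded_basis D e d /\ sh d = n%:Z >].
  have [e [d g]] := graded_basis_exists D; exists `|sh d|%N; apply/asboolP.
  by exists e, d; split=> //; rewrite gez0_abs// (sh0 e).
case: (ex_minnP exn) => n /asboolP[e [d [g dn]]] nmin.
exists e, d; split=> // e' d' g'.
have := nmin `|sh d'|%N (asboolT _); rewrite -(lerD2r (`|deg D| *+ m)) -!shE dn.
have := sh0 _ _ g' => s0 /(_ _) hn.
have : (n <= `|sh d'|%N)%N by apply: hn; exists e', d'; split=> //; rewrite gez0_abs.
by lia.
Qed.

(** Otherwise the combination could replace e_l0 in the basis with a twist smaller by one. *)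
Lemma minimal_no_exchange D e d c l0 : minimal_basis D e d -> c l0 != 0 ->
  ~ Lspace (D + H *~ (d l0 - 1)) (\sum_l pull h (c l) * e l).
Proof.
move=> [[eB eD] dmin] c0 yD; set y := \sum_l _ in yD.
pose e' l := if l == l0 then y else e l.
pose d' l := if l == l0 then d l0 - 1 else d l.
have ef : lfree (pull h) e'.
  move=> a; rewrite (bigD1 l0)//= {1}/e' eqxx => a0.
  pose b l := a l0 * c l + (if l == l0 then 0 else a l).
  have h1 : forall l, b l = 0.
    apply: eB.1; rewrite -[RHS]a0 /b.
    under [LHS]eq_bigr do rewrite rmorphD mulrDl rmorphM -mulrA.
    rewrite big_split /= -mulr_sumr; congr (_ + _).
    rewrite (bigD1 l0)//= eqxx rmorph0 mul0r add0r; apply: eq_bigr => i /negPf il.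
    by rewrite /e' il.
  have al0 : a l0 = 0.
    by have /eqP := h1 l0; rewrite /b eqxx addr0 mulf_eq0 (negPf c0) orbF => /eqP.
  move=> l; have := h1 l; rewrite /b al0 mul0r add0r.
  by case: eqP => [->|].
have eB' : lbasis (pull h) e'.
  by split=> // z; apply: (lfree_span dm ef) => //; rewrite card_ord.
have gb : graded_basis D e' d'.
  by split=> // l; rewrite /e' /d'; case: eqP.
have := dmin _ _ gb; rewrite (bigD1 l0)//= [X in _ <= X](bigD1 l0)//=.
have -> : d' l0 = d l0 - 1 by rewrite /d' eqxx.
have -> : \sum_(l | l != l0) d' l = \sum_(l | l != l0) d l.
  by apply: eq_bigr => l /negPf ll; rewrite /d' ll.
by rewrite lerD2r lerDl.
Qed.

Definition shift (d : 'I_m -> int) (P : closed_point Y) (l : 'I_m) : int :=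
  if P == oo then d l else 0.

(* The basis e splits h_* O(D) as a sum of line bundles O(- d_l). *)
Definition reduced_basis (D : divisor X) (e : 'I_m -> L) (d : 'I_m -> int) : Prop :=
  lbasis (pull h) e /\ forall P y, local_sections h D P y <->
    forall l, vge P (shift d P l) (lcoord (pull h) e y l).

Lemma graded_local D e d P tau l : graded_basis D e d -> ord P tau = 1 ->
  local_sections h D P (pull h (tau ^ shift d P l) * e l).
Proof.
move=> [_ eD] Pt; have /(Lspace_local h)/(_ P)/H_local := eD l; rewrite /shift.
case: eqP => [Poo|_]; last by rewrite expr0z rmorph1 mul1r.
have T0 : T^-1 != 0 by apply: (@ord_neq0 _ _ oo); rewrite ooT.
have t0 : tau != 0 by apply: (@ord_neq0 _ _ P); rewrite Pt.
move=> h1; have -> : tau ^ d l = (tau ^ d l / (T^-1) ^ d l) * (T^-1) ^ d l.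
  by rewrite divfK// expfz_neq0.
rewrite rmorphM -mulrA; apply: local_sectionsZ => //.
rewrite vgeE ?mulf_neq0 ?invr_eq0 ?expfz_neq0// ord_div ?expfz_neq0// !ordZ.
by rewrite Pt Poo ooT subrr.
Qed.

(** A power of tau brings the worst coefficient to one order below the bound. The a_l are the
    residues at that order; what is discarded is a local section, because each scaled e_l is one. *)
Lemma leading_terms D e d P tau (c : 'I_m -> ratfun Y) :
  graded_basis D e d -> ord P tau = 1 ->
  local_sections h D P (\sum_l pull h (c l) * e l) ->
  (exists l, ~~ vge P (shift d P l) (c l)) ->
  exists a : 'I_m -> k, (exists l, a l != 0) /\
    local_sections h D P
      (\sum_l pull h (cst Y (a l) * tau ^ (shift d P l - 1)) * e l).
Proof.
move=> gb Pt yD [l1 cl1].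
have t0 : tau != 0 by apply: (@ord_neq0 _ _ P); rewrite Pt.
have c1 : c l1 != 0 by apply: contraNneq cl1 => ->; exact: vge0.
pose n l := ord P (c l) - shift d P l.
have [l2 c2 nmin] : exists2 l, c l != 0 & forall l', c l' != 0 -> n l <= n l'.
  have [l c0 hl] := Order.TotalTheory.arg_minP (P := fun l => c l != 0) n c1.
  by exists l.
set mu := n l2.
have mu0 : mu <= - 1.
  have := nmin l1 c1; move: cl1; rewrite vgeE// /n -/mu -ltNge /mu /n.
  by clear; lia.
pose b l := c l * tau ^ (- mu - shift d P l).
have b0 l : vge P 0 (b l).
  have [c0|cn0] := eqVneq (c l) 0; first by rewrite /b c0 mul0r vge0.
  rewrite vgeE ?mulf_neq0 ?expfz_neq0// ordM ?expfz_neq0// ordZ Pt.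
  by have := nmin l cn0; rewrite -/mu /n; clear; lia.
have /choice[a ba] := fun l => residue (b0 l).
exists a; split.
  exists l2; apply: contraTneq (ba l2) => ->; rewrite rmorph0 subr0.
  rewrite vgeE ?mulf_neq0 ?expfz_neq0// ordM ?expfz_neq0// ordZ Pt /mu /n.
  by clear; lia.
have -> : \sum_l pull h (cst Y (a l) * tau ^ (shift d P l - 1)) * e l =
    pull h (tau ^ (- mu - 1)) * (\sum_l pull h (c l) * e l) -
    \sum_l pull h (b l - cst Y (a l)) * (pull h tau^-1 * (pull h (tau ^ shift d P l) * e l)).
  rewrite mulr_sumr -sumrB; apply: eq_bigr => l _.
  rewrite !mulrA -!rmorphM -mulrBl -rmorphB; congr (pull h _ * _).
  rewrite !mulrBl /b.
  have -> : c l * tau ^ (- mu - shift d P l) * tau^-1 * tau ^ shift d P l =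
      tau ^ (- mu - 1) * c l.
    rewrite -!mulrA mulrC -exprN1 -!expfzDr//; congr (tau ^ _ * _).
    by clear; lia.
  by rewrite subKr -mulrA -exprN1 -expfzDr// [-1 + _]addrC.
apply: local_sectionsD.
  apply: local_sectionsZ => //.
  by rewrite vgeE ?expfz_neq0// ordZ Pt; move: mu0; clear; lia.
apply: local_sectionsN; apply: local_sections_sum => l.
rewrite mulrA -rmorphM; apply: local_sectionsZ.
  by rewrite vge_mulE ?invr_eq0// ordV Pt opprK add0r.
exact: graded_local.
Qed.

(** A local section with a bad coordinate has leading terms that extend to a global section.
    Choosing l2 with d_l2 largest among the nonzero a_l, this section has twist d_l2 - 1 and could
    replace e_l2. *)
Lemma minimal_reduced D e d : minimal_basis D e d -> reduced_basis D e d.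
Proof.
move=> mb; have [gb _] := mb; have [eB eD] := gb; split=> // P y.
have [tau [tp Pt tauP]] := line_param TY P.
split; last first.
  move=> cP; rewrite (lcoordE eB y); apply: local_sections_sum => l.
  have t0 : tau != 0 by apply: (@ord_neq0 _ _ P); rewrite Pt.
  rewrite -(divfK (expfz_neq0 (shift d P l) t0) (lcoord _ _ _ _)) rmorphM -mulrA.
  apply: local_sectionsZ; last exact: graded_local.
  by rewrite vge_mulE ?invr_eq0 ?expfz_neq0// ordV ordZ Pt opprK mul1r add0r.
rewrite {1}(lcoordE eB y) => yD l0; apply: contrapT => /negP nl.
have T0 : T^-1 != 0 by apply: (@ord_neq0 _ _ oo); rewrite ooT.
have eP P' l : P' != oo -> local_sections h D P' (e l).
  move=> Poo; have [tau' [_ Pt' _]] := line_param TY P'.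
  have := graded_local l gb Pt'; rewrite /shift (negPf Poo) expr0z rmorph1.
  by rewrite mul1r.
have dmax (a : 'I_m -> k) : (exists l, a l != 0) ->
    exists2 l, a l != 0 & forall l', a l' != 0 -> d l' <= d l.
  move=> [l1 al1].
  have [l al hl] := Order.TotalTheory.arg_minP (P := fun l => a l != 0) (fun l => - d l) al1.
  by exists l => // l' /hl; rewrite lerN2.
have [Poo|Poo] := eqVneq P oo.
  subst P; have [a [al1 aD]] := leading_terms gb ooT yD (ex_intro _ l0 nl).
  have [l2 al2 dm2] := dmax a al1.
  rewrite /shift eqxx in aD.
  (* Powers of T bring the leading terms at [oo] to the common twist d_l2 - 1; as d_l2 is largest,
     these powers are nonnegative and add no pole at finite points. *)
  apply: (@minimal_no_exchange D e d
    (fun l => cst Y (a l) * (T^-1) ^ (d l - d l2)) l2 mb).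
    by rewrite mulf_neq0 ?fmorph_eq0// expfz_neq0.
  apply/(Lspace_local h) => P; apply/H_local; case: eqP => [->|/eqP Pn].
    suff <- : \sum_l pull h (cst Y (a l) * T^-1 ^ (d l - 1)) * e l =
      pull h (T^-1 ^ (d l2 - 1)) * (\sum_l pull h (cst Y (a l) * T^-1 ^ (d l - d l2)) * e l) by [].
    rewrite mulr_sumr; apply: eq_bigr => l _; rewrite mulrA -rmorphM mulrCA.
    congr (pull h (_ * _) * _); rewrite -expfzDr//; congr (_ ^ _).
    by clear; lia.
  apply: local_sections_sum => l.
  have [->|al] := eqVneq (a l) 0.
    by rewrite rmorph0 mul0r rmorph0 mul0r => Q _; exact: vge0.
  apply: local_sectionsZ; last exact: eP.
  apply: vgeMl; first exact: vge_cst.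
  rewrite vgeE ?expfz_neq0// ordZ; have := dm2 l al; move: Pn; rewrite -ooP -leNgt.
  by clear; move: (ord _ _) (d l) (d l2) => u v w; nia.
have [c tauE] : exists c, tau = T - cst Y c.
  case: tp => // tauE; exfalso; move: Poo; rewrite -ooP -tauE Pt.
  by [].
have t0 : tau != 0 by apply: (@ord_neq0 _ _ P); rewrite Pt.
have ot : ord oo tau = -1.
  have oT : ord oo T = -1 by rewrite -[T]invrK ordV ooT.
  have Tn0 : T != 0 by apply: (@ord_neq0 _ _ oo); rewrite oT.
  rewrite tauE; have [|_ ->//] := @ord_addl _ _ oo T (- cst Y c) Tn0.
  by rewrite oT vgeN; exact: vge_cst.
have [a [al1 aD]] := leading_terms gb Pt yD (ex_intro _ l0 nl).
have [l2 al2 dm2] := dmax a al1.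
rewrite /shift (negPf Poo) sub0r in aD.
(* Division by T - c adds a pole over P only, where the leading terms allow it, and gains a zero
   over [oo], which lowers the twist by one. *)
apply: (@minimal_no_exchange D e d (fun l => cst Y (a l) * tau ^ (- 1)) l2 mb).
  by rewrite mulf_neq0 ?fmorph_eq0// expfz_neq0.
apply/(Lspace_local h) => P'; apply/H_local; case: eqP => [->|/eqP Pn].
  rewrite mulr_sumr; apply: local_sections_sum => l.
  have [->|al] := eqVneq (a l) 0.
    by rewrite rmorph0 mul0r rmorph0 mul0r mulr0 => Q _; exact: vge0.
  have gl := graded_local l gb ooT; rewrite /shift eqxx in gl.
  have -> : pull h (T^-1 ^ (d l2 - 1)) * (pull h (cst Y (a l) * tau ^ (- 1)) * e l) =
      pull h (cst Y (a l) * (tau ^ (- 1) * T^-1 ^ (d l2 - 1 - d l))) * (pull h (T^-1 ^ d l) * e l).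
    rewrite !mulrA -!rmorphM; congr (pull h _ * _).
    have -> : T^-1 ^ (d l2 - 1) = T^-1 ^ (d l2 - 1 - d l) * T^-1 ^ d l.
      by rewrite -expfzDr//; congr (_ ^ _); clear; lia.
    by move: (T^-1 ^ (d l2 - 1 - d l)) (T^-1 ^ d l) (tau ^ (- 1)) => u v w; ring.
  apply: local_sectionsZ => //; apply: vgeMl; first exact: vge_cst.
  rewrite vgeE ?mulf_neq0 ?expfz_neq0// ordM ?expfz_neq0// !ordZ ot ooT.
  by have := dm2 l al; clear; lia.
have [->//|PP] := eqVneq P' P.
apply: local_sections_sum => l; apply: local_sectionsZ; last exact: eP.
apply: vgeMl; first exact: vge_cst.
rewrite vgeE ?expfz_neq0// ordZ; have := tauP P' PP.
by clear; lia.
Qed.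

End Reduction.

(** * Duality, Euler characteristic and Riemann-Roch for K = R - 2H *)

Section RiemannRoch.
Context (k : closedFieldType) (char0 : [pchar k] =i pred0).
Context (X Y : curve k) (h : morphism X Y) (m : nat) (dm : has_degree h m).
Context (T : ratfun Y) (TY : line_coordinate T).
Context (oo : closed_point Y) (ooT : ord oo (T^-1) = 1).
Context (ooP : forall Q : closed_point Y, (0 < ord Q (T^-1)) = (Q == oo)).
Local Notation L := (ratfun X).
Local Notation H := (pull_div h << oo >>).
Local Notation reduced := (@reduced_basis k X Y h m oo).

Lemma reduced_exists D : exists e d, reduced D e d.
Proof.
have [e [d mb]] := minimal_basis_exists dm TY ooT ooP D.
by exists e, d; exact: (minimal_reduced dm TY ooT ooP mb).
Qed.

Lemma reduced_shift D e d (r : int) :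
  reduced D e d -> reduced (D + H *~ r) e (fun l => d l - r).
Proof.
move=> [eB eD]; split=> // P y; rewrite (H_local dm ooT) eD /shift.
case: eqP => [->|_]; last by [].
by split=> hl l; have := hl l; rewrite (lcoordZ eB) (vge_mulz _ _ _ ooT).
Qed.

(** By local duality h_* O(R - D) is the dual of h_* O(D), so the dual basis splits it with opposite
    twists. *)
Lemma reduced_dual D R e d : (forall Q, coeff Q R = (ram h Q)%:Z - 1) ->
  reduced D e d -> exists e', reduced (R - D) e' (fun l => - d l).
Proof.
move=> RE [eB eD]; have m0 : m%:R != 0 :> ratfun Y.
  exact: (curve_char0 char0 _ (degree_gt0 dm)).
have [b [bB be]] := dual_basis_exists eB m0.
exists b; split=> // P y.
rewrite (local_sections_trace char0 dm eB D P y RE).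
have cE l : lcoord (pull h) b y l = ltrace (pull h) e (y * e l).
  exact: lcoord_dual.
have [s Ps] := ord_unif P.
have sN l : shift oo (fun l => - d l) P l = - shift oo d P l.
  by rewrite /shift; case: eqP; rewrite ?oppr0.
split=> [yt l|yl z /eD zD].
  rewrite cE sN -sub0r -(vge_mulz _ _ _ Ps) -(ltraceZ eB) mulrCA.
  apply: yt; apply/eD => l'; rewrite (lcoordZ eB) (vge_mulz _ _ _ Ps).
  rewrite (lcoord_basis eB); case: eqP => [->|_]; last exact: vge0.
  by rewrite subrr vge1.
rewrite (lcoordE eB z) mulr_sumr (ltrace_sum eB); apply: vge_sum => l _.
rewrite mulrCA (ltraceZ eB) -(subrr (shift oo d P l)).
apply: vgeM; first exact: zD.
by have := yl l; rewrite cE sN.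
Qed.

(** This is h^0 of O(- x) on the line: the number of coefficients of a polynomial of degree at most
    - x. *)
Definition poly_bound (x : int) : nat := absz (Num.max 0 (1 - x)).

Lemma poly_sections (x : int) z :
  (forall P, vge P (if P == oo then x else 0) z) <->
  exists2 p : {poly k}, (size p <= poly_bound x)%N & z = ev T p.
Proof.
have oT : ord oo T = -1 by rewrite -[T]invrK ordV ooT.
have oT0 : ord oo T < 0 by rewrite oT.
split=> [zP|[p sp ->] P].
  have [|p zp] := @line_poly _ _ _ TY oo z oT0.
    by move=> P Poo; have := zP P; rewrite (negPf Poo).
  exists p => //; have [->|p0] := eqVneq p 0; first by rewrite size_poly0.
  have := zP oo; rewrite eqxx zp vgeE ?ev_eq0//; last exact: (line_nonconst TY).
  rewrite ord_ev_pole// oT; have : (0 < size p)%N by rewrite size_poly_gt0.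
  by rewrite /poly_bound; clear; move: (size p) => n; lia.
case: eqP => [->|/eqP Poo]; last first.
  by rewrite evE; apply: vge_horner; exact: finite_regular ooP _ Poo.
have [->|p0] := eqVneq p 0; first by rewrite rmorph0 vge0.
rewrite vgeE ?ev_eq0//; last exact: (line_nonconst TY).
rewrite ord_ev_pole// oT; have : (0 < size p)%N by rewrite size_poly_gt0.
by move: sp; rewrite /poly_bound; clear; move: (size p) => n; lia.
Qed.

Lemma reduced_dim D e d : reduced D e d ->
  h0 (cls D) = (\sum_l poly_bound (d l))%N.
Proof.
move=> [eB eD]; pose I : finType := {l : 'I_m & 'I_(poly_bound (d l))}.
pose E (p : I) := pull h (T ^+ tagged p) * e (tag p).
pose q (c : I -> k) l : {poly k} := \sum_(j < poly_bound (d l)) c (existT _ l j) *: 'X^j.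
have qc c l (j : 'I_(poly_bound (d l))) : (q c l)`_j = c (existT _ l j).
  rewrite coef_sum (bigD1 j)//= coefZ coefXn eqxx mulr1 big1 ?addr0// => i ij.
  by rewrite coefZ coefXn eq_sym (inj_eq val_inj) (negPf ij) mulr0.
have sq c l : (size (q c l) <= poly_bound (d l))%N.
  apply: (leq_trans (size_sum _ _ _)); apply/bigmax_leqP => j _.
  by apply: (leq_trans (size_scale_leq _ _)); rewrite size_polyXn.
have sumE c : \sum_p cst X (c p) * E p = \sum_l pull h (ev T (q c l)) * e l.
  transitivity (\sum_l \sum_(j < poly_bound (d l))
      cst X (c (existT _ l j)) * (pull h (T ^+ j) * e l)).
    rewrite (sig_big_dep xpredT (fun _ _ => true)
      (fun (l : 'I_m) (j : 'I_(poly_bound (d l))) =>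
        cst X (c (existT _ l j)) * (pull h (T ^+ j) * e l))).
    by apply: eq_big => // -[l j] _.
  apply: eq_big => // l _; rewrite rmorph_sum rmorph_sum mulr_suml.
  apply: eq_big => // j _; rewrite -mul_polyC !rmorphM !rmorphXn evC evX pull_cst.
  by rewrite mulrA.
have secE y : Lspace D y <-> forall l, exists2 p : {poly k},
    (size p <= poly_bound (d l))%N & lcoord (pull h) e y l = ev T p.
  rewrite (Lspace_local h); split=> hy.
    by move=> l; apply/poly_sections => P; have /eD := hy P; exact.
  by move=> P; apply/eD => l; move: (poly_sections (d l) (lcoord (pull h) e y l)) => -[_ /(_ (hy l) P)].
have cI : #|I| = (\sum_l poly_bound (d l))%N.
  rewrite card_tagged sumnE big_map big_enum /=.
  by apply: eq_bigr => i _; rewrite card_ord.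
rewrite -cI; apply: h0_uniq; apply: (has_dim_fin (e := E)) => [c|y].
  rewrite sumE => /eB.1 q0 [l j].
  have /eqP := q0 l; rewrite ev_eq0; last exact: (line_nonconst TY).
  by move=> /eqP ql; rewrite -qc ql coef0.
rewrite secE; split=> [hl|[c ->] l].
  have /choice[p pP] : forall l, exists p : {poly k},
      (size p <= poly_bound (d l))%N /\ lcoord (pull h) e y l = ev T p.
    by move=> l; have [p p1 p2] := hl l; exists p.
  exists (fun i : I => (p (tag i))`_(nat_of_ord (tagged i))); rewrite sumE (lcoordE eB y).
  apply: eq_bigr => l _; congr (pull h _ * _); have [sp ->] := pP l.
  congr (ev T _); apply/polyP => j; have [lt_j|le_j] := ltnP j (poly_bound (d l)).
    by rewrite (qc _ l (Ordinal lt_j)).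
  by rewrite !nth_default// (leq_trans _ le_j).
exists (q c l) => //; rewrite sumE.
exact: (lcoord_uniq eB (c := fun l => ev T (q c l))).
Qed.

(** Serre duality on the line, summand by summand: the twist by - 2H turns - d_l into 2 - d_l, and
    h^0(O(- x)) - h^0(O(x - 2)) = 1 - x. *)
Lemma reduced_chi D R e d : (forall Q, coeff Q R = (ram h Q)%:Z - 1) ->
  reduced D e d ->
  (h0 (cls D))%:Z - (h0 (cls (R - H *~ 2 - D)))%:Z = \sum_l (1 - d l).
Proof.
move=> RE De; have [e' De'] := reduced_dual RE De.
have := reduced_shift (-2) De'; rewrite mulrNz addrAC => De2.
rewrite (reduced_dim De) (reduced_dim De2) !(big_morph Posz PoszD (erefl : Posz 0 = 0)) -sumrB.
by apply: eq_bigr => l _; rewrite /poly_bound; lia.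
Qed.

(** For r beyond all twists no summand is truncated, so h^0(D + r H) is linear in r with constant
    term the Euler characteristic of D. This transfers bounds on h^0 to the Euler characteristic. *)
Lemma chi_asymptotic D R : (forall Q, coeff Q R = (ram h Q)%:Z - 1) ->
  exists r0 : int, forall r, r0 <= r -> (h0 (cls (D + H *~ r)))%:Z =
    (h0 (cls D))%:Z - (h0 (cls (R - H *~ 2 - D)))%:Z + m%:Z * r.
Proof.
move=> RE; have [e [d De]] := reduced_exists D.
exists (\sum_l `|d l|) => r hr; rewrite (reduced_chi RE De).
rewrite (reduced_dim (reduced_shift r De)) (big_morph Posz PoszD (erefl : Posz 0 = 0)).
have -> : m%:Z * r = \sum_(l < m) r by rewrite sumr_const card_ord -mulr_natl natz.
rewrite -big_split; apply: eq_bigr => l _ /=.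
have : `|d l| <= r.
  by apply: le_trans hr; rewrite (bigD1 l)//= lerDl sumr_ge0.
by rewrite /poly_bound; clear; move: (d l) => x; lia.
Qed.

Context (R : divisor X) (RE : forall Q, coeff Q R = (ram h Q)%:Z - 1).
Local Notation K := (R - H *~ 2).

Definition euler_char (M : Pic X) : int := (h0 M)%:Z - (h0 (cls K - M))%:Z.

Lemma euler_charE D : euler_char (cls D) = (h0 (cls D))%:Z - (h0 (cls (K - D)))%:Z.
Proof. by rewrite /euler_char clsB. Qed.

Lemma euler_char_step D Q :
  euler_char (cls D) <= euler_char (cls (D + << Q >>)) <= euler_char (cls D) + 1.
Proof.
have [r0 h1] := chi_asymptotic D RE; have [r1 h2] := chi_asymptotic (D + << Q >>) RE.
pose r := Num.max r0 r1; have := h1 r; have := h2 r; rewrite !le_max !lexx orbT.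
rewrite -!euler_charE => /(_ isT) e2 /(_ isT) e1.
have := h0_step (D + H *~ r) Q; rewrite addrAC.
by move: e1 e2; move: (m%:Z * r) (h0 _) (h0 _) (euler_char _) (euler_char _); clear; lia.
Qed.

Lemma euler_charH D : euler_char (cls (D + H)) = euler_char (cls D) + m%:Z.
Proof.
have [r0 h1] := chi_asymptotic D RE; have [r1 h2] := chi_asymptotic (D + H) RE.
pose r := Num.max r0 r1.
have := h1 (r + 1); have := h2 r; rewrite -!euler_charE.
rewrite le_max lexx orbT => /(_ isT) e2.
have -> : r0 <= r + 1 by rewrite (@le_trans _ _ r)// ?lerDl// le_max lexx.
move=> /(_ isT) e1.
have e : D + H *~ (r + 1) = D + H + H *~ r by rewrite mulrzDr mulr1z addrA addrAC.
rewrite e e2 mulrDr mulr1 in e1.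
by move: e1; clear; lia.
Qed.

Lemma euler_char_effective D F : (forall P, 0 <= coeff P F) ->
  euler_char (cls D) <= euler_char (cls (D + F)) <= euler_char (cls D) + deg F.
Proof.
move: F; apply: divisor_ind => [|F Q _ IH]; first by rewrite addr0 deg0 addr0 lexx.
rewrite addrA degD deg_pt; have := euler_char_step (D + F) Q.
move: IH; move: (euler_char _) (euler_char _) (deg F) (euler_char _); clear.
by lia.
Qed.

(** A point adds 0 or 1, and the m points of the fibre through Q, counted with multiplicity, add m
    together; so each adds exactly 1. *)
Lemma euler_char_pt D Q : euler_char (cls (D + << Q >>)) = euler_char (cls D) + 1.
Proof.
pose E := pull_div h << fpt h Q >>.
have EH : cls E = cls H.
  by rewrite -!(pull_Pic_cls dm) (line_equiv TY _ oo).
have F0 P : 0 <= coeff P (E - << Q >>).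
  rewrite coeffB (pull_divE _ _ dm) !coeff_pt.
  have [->|_] := eqVneq Q P; last by rewrite subr0 mulr_ge0// ler0n.
  by rewrite eqxx mulr1 subr_ge0 lez_nat ram_gt0.
have := euler_char_effective (D + << Q >>) F0.
have -> : D + << Q >> + (E - << Q >>) = D + E 
  by rewrite -addrA (addrCA << Q >> E) subrr addr0.
have -> : cls (D + E) = cls (D + H) by rewrite !clsD EH.
rewrite euler_charH degB deg_pt (deg_pull_div _ dm) deg_pt mulr1.
by have := euler_char_step D Q; move: (euler_char _) (euler_char _); clear; lia.
Qed.

Lemma euler_char_deg D : euler_char (cls D) = deg D + euler_char (cls 0).
Proof.
have eff E F : (forall P, 0 <= coeff P F) ->
    euler_char (cls (E + F)) = euler_char (cls E) + deg F.
  move: F; apply: divisor_ind => [|F Q _ IH]; first by rewrite addr0 deg0 addr0.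
  by rewrite addrA euler_char_pt IH degD deg_pt addrA.
have [|N NE] := @div_exists _ X (fun P => Num.max 0 (- coeff P D)) (dom D).
  by move=> P; rewrite mem_dom; apply: contra_neq => ->; rewrite oppr0 maxxx.
have N0 P : 0 <= coeff P N by rewrite NE le_max lexx.
have DN P : 0 <= coeff P (D + N) by rewrite coeffD NE; clear; lia.
have := eff D N N0; have := eff 0 (D + N) DN; rewrite add0r degD => -> e.
by move: e; move: (euler_char (cls D)) (euler_char _) (deg D) (deg N); clear; lia.
Qed.

Theorem riemann_roch_line D :
  (h0 (cls D))%:Z - (h0 (cls (K - D)))%:Z = deg D + 1 - (h0 (cls K))%:Z.
Proof.
rewrite -euler_charE euler_char_deg euler_charE subr0 (h0_uniq (Lspace0_dim X)).
by rewrite addrA.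
Qed.

End RiemannRoch.

(** * Derivations and the canonical class *)

Section LineInstance.
Context (k : closedFieldType).

(** A root c of the denominator is a root of the numerator too, z being regular at a point where T =
    c; cancelling ends with a constant denominator. *)
Lemma regular_poly (Y : curve k) (T : ratfun Y) (oo : closed_point Y) z :
  nonconst T -> (forall c, exists2 P, P != oo & 0 < ord P (T - cst Y c)) ->
  (forall z, exists p q, q != 0 /\ z * ev T q = ev T p) ->
  (forall P, P != oo -> vge P 0 z) -> exists p, z = ev T p.
Proof.
move=> Tn Tpt Tfrac zreg; have [p [q [q0 zq]]] := Tfrac z.
have [n] := ubnP (size q); elim: n p q q0 zq => // n IH p q q0 zq /ltnSE qn.
have [sq|/closed_rootP[c rc]] := eqVneq (size q) 1%N.
  have /size_poly1P[c c0 qc] : size q == 1%N by rewrite sq.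
  exists (p * c^-1%:P); rewrite rmorphM -zq qc !evC -mulrA -rmorphM mulfV//.
  by rewrite rmorph1 mulr1.
have /factor_theorem[q' qq'] := rc.
have [P Poo Pc] := Tpt c.
have Tc0 : T - cst Y c != 0 by apply: (@ord_neq0 _ _ P); rewrite gt_eqF.
have Tc1 : vge P 1 (T - cst Y c) by rewrite vgeE.
have Tr : vge P 0 T.
  by rewrite -[T](subrK (cst Y c)) vgeD ?vge_cst// (vge_le _ Tc1).
have p1 : vge P 1 (ev T p).
  rewrite -zq qq' rmorphM rmorphB evX evC mulrA; apply: vgeMl => //.
  by apply: vgeMl; [exact: zreg|rewrite evE vge_horner].
have /factor_theorem[p' pp'] : root p c.
  apply: contraTT p1 => pc; have [h1 h2] := ord_ev_unit Pc pc.
  by rewrite vgeE// h2.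
have q'0 : q' != 0 by apply: contra_neq q0 => q'0; rewrite qq' q'0 mul0r.
apply: (IH p' q') => //.
  apply: (mulIf Tc0); move: zq; rewrite qq' pp' !rmorphM rmorphB evX evC.
  by rewrite mulrA.
move: qn; rewrite qq' size_Mmonic ?monicXsubC// size_XsubC addn2 /=.
by [].
Qed.

Lemma P1_line : line_coordinate (P1T : ratfun (P1 k)).
Proof.
split.
- exact: P1T_nonconst.
- exact: P1_point_param.
- exact: P1_points_equiv.
move=> oo z ooT zreg; apply: (regular_poly (@P1T_nonconst k) _ _ zreg) => [c|w].
  have tp : P1_param (P1T - cst (P1 k) c) by left; exists c.
  have [P [Pc _]] := P1_param_point tp; exists P; last by rewrite Pc.
  apply: contraTneq ooT => <-; rewrite -leNgt -[P1T](subrK (cst (P1 k) c)).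
  rewrite -vgeE; last by rewrite subrK; exact: nonconst_neq0 (@P1T_nonconst k).
  apply: vgeD; last exact: vge_cst.
  by rewrite /vge Pc orbT.
have [p [q [q0 wE]]] := fracE w; exists p, q; split; first exact: q0.
rewrite !P1_ev wE divfK; first by [].
by rewrite tofrac_eq0.
Qed.

End LineInstance.

Section FractionDerivation.
Context (k : fieldType) (K : fieldType) (f : {rmorphism {poly k} -> K}).
Context (finj : injective f).
Context (fsurj : forall z, exists p q, q != 0 /\ z = f p / f q).

Lemma fraction_derivation : exists d : K -> K,
  [/\ forall y z, d (y + z) = d y + d z, forall y z, d (y * z) = d y * z + y * d z
    & forall p, d (f p) = f p^`()].
Proof.
have f0 r : r != 0 -> f r != 0 by rewrite -(rmorph0 f) (inj_eq finj).
have /choice[d dE] : forall z, exists y, forall p q, q != 0 -> z = f p / f q ->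
    y = (f p^`() * f q - f p * f q^`()) / f q ^+ 2.
  move=> z; have [p [q [q0 ->]]] := fsurj z.
  exists ((f p^`() * f q - f p * f q^`()) / f q ^+ 2) => p2 q2 q20.
  have fq := f0 q q0; have fq2 := f0 q2 q20.
  move/eqP; rewrite eqr_div// -!rmorphM (inj_eq finj) => /eqP e.
  have /(congr1 f) := congr1 (@deriv k) e; rewrite !derivM !rmorphD !rmorphM.
  have := congr1 f e; rewrite !rmorphM => e1 e2.
  apply/eqP; rewrite eqr_div ?expf_neq0//; apply/eqP.
  transitivity (f q * f q2 * (f p^`() * f q2 - f p2 * f q^`())).
    transitivity (f p^`() * f q * f q2 ^+ 2 - (f p * f q2) * f q2 * f q^`()); first by ring.
    by rewrite e1; ring.
  have -> : f p^`() * f q2 - f p2 * f q^`() = f p2^`() * f q - f p * f q2^`().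
    by apply/eqP; rewrite subr_eq addrAC eq_sym subr_eq eq_sym e2.
  transitivity (f p2^`() * f q2 * f q ^+ 2 - (f p * f q2) * f q * f q2^`()); first by ring.
  by rewrite e1; ring.
have dfrac p q : q != 0 -> d (f p / f q) = (f p^`() * f q - f p * f q^`()) / f q ^+ 2.
  by move=> q0; exact: dE.
exists d; split.
- move=> y z; have [p [q [q0 ->]]] := fsurj y; have [r [s [s0 ->]]] := fsurj z.
  have fq := f0 q q0; have fs := f0 s s0.
  rewrite addf_div// -!rmorphM -rmorphD !dfrac ?mulf_neq0//.
  rewrite derivD !derivM !rmorphD !rmorphM; field.
  by rewrite fs fq.
- move=> y z; have [p [q [q0 ->]]] := fsurj y; have [r [s [s0 ->]]] := fsurj z.
  have fq := f0 q q0; have fs := f0 s s0.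
  rewrite mulf_div -!rmorphM !dfrac ?mulf_neq0//.
  rewrite !derivM !rmorphD !rmorphM; field.
  by rewrite fs fq.
move=> p; have := @dfrac p 1 (oner_neq0 _).
by rewrite rmorph1 divr1 -polyC1 derivC rmorph0 mulr0 subr0 mulr1 expr1n divr1.
Qed.

End FractionDerivation.

Section DerivationExtension.
Context (F L : fieldType) (phi : {rmorphism F -> L}) (m : nat).
Context (dm : has_dim phi setT m) (m0 : m%:R != 0 :> F).
Context (d : F -> F) (dD : forall y z, d (y + z) = d y + d z).
Context (dM : forall y z, d (y * z) = d y * z + y * d z).

(* With dual bases e, b for the trace form, sum e_l (x) b_l is the separability
   idempotent; contracting with it turns the commutator of y with the
   coordinatewise derivation, an F-linear operator, into an element of L. *)
Lemma derivation_extension : exists D : L -> L,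
  [/\ forall y z, D (y + z) = D y + D z, forall y z, D (y * z) = D y * z + y * D z
    & forall c, D (phi c) = phi (d c)].
Proof.
have [e [ef eT]] := (has_dimE _ _ _).1 dm.
have eB : lbasis phi e by split=> // y; rewrite -eT.
have [b [bB be]] := dual_basis_exists eB m0.
pose tr := ltrace phi e.
have cb y i : lcoord phi b y i = tr (y * e i) by exact: lcoord_dual.
have ce y i : lcoord phi e y i = tr (y * b i).
  rewrite {2}(lcoordE eB y) mulr_suml /tr (ltrace_sum eB) (bigD1 i)//=.
  rewrite -mulrA (ltraceZ eB) [e i * _]mulrC be eqxx mulr1 big1 ?addr0// => j ji.
  by rewrite -mulrA (ltraceZ eB) [e j * _]mulrC be eq_sym (negPf ji) mulr0.
have sum1 : \sum_l e l * b l = 1.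
  apply/eqP; rewrite eq_sym -subr_eq0; apply/eqP.
  apply: (ltrace_nondeg eB m0) => i; rewrite mulrBl mul1r mulr_suml.
  have trB y z : ltrace phi e (y - z) = ltrace phi e y - ltrace phi e z.
    by rewrite (ltraceD eB) -[- z]mulN1r -(rmorphN1 phi) (ltraceZ eB) mulN1r.
  rewrite trB (ltrace_sum eB) {1}/ltrace -sumrB big1// => l _.
  rewrite ce /tr; apply/eqP; rewrite subr_eq0; apply/eqP.
  by congr (ltrace phi e _); ring.
pose de y := \sum_l phi (d (lcoord phi e y l)) * e l.
have deD y z : de (y + z) = de y + de z.
  rewrite -big_split; apply: eq_bigr => l _.
  by rewrite (lcoordD eB) dD rmorphD mulrDl.
have deZ c y : de (phi c * y) = phi (d c) * y + phi c * de y.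
  rewrite {2}(lcoordE eB y) !mulr_sumr -big_split; apply: eq_bigr => l _ /=.
  by rewrite (lcoordZ eB) dM rmorphD !rmorphM mulrDl !mulrA.
pose A y w := de (y * w) - y * de w.
have AD y w w' : A y (w + w') = A y w + A y w'.
  by rewrite /A mulrDr !deD; ring.
have AZ y c w : A y (phi c * w) = phi c * A y w.
  by rewrite /A mulrCA !deZ; ring.
have A0 y : A y 0 = 0 by apply: (addrI (A y 0)); rewrite -AD !addr0.
have Asum y (G : 'I_m -> L) : A y (\sum_l G l) = \sum_l A y (G l).
  exact: (big_morph (A y) (AD y) (A0 y)).
have key y z : \sum_l e l * A y (z * b l) = z * \sum_l e l * A y (b l).
  transitivity (\sum_l \sum_i phi (tr (z * e i * b l)) * e l * A y (b i)).
    apply: eq_bigr => l _; rewrite {1}(lcoordE bB (z * b l)) Asum mulr_sumr.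
    apply: eq_bigr => i _; rewrite AZ cb mulrA [e l * _]mulrC.
    by rewrite [z * b l * _]mulrAC.
  rewrite exchange_big mulr_sumr; apply: eq_bigr => i _ /=.
  rewrite -mulr_suml mulrA {2}(lcoordE eB (z * e i)).
  by under [X in _ = X * _]eq_bigr do rewrite ce.
pose D y := \sum_l e l * A y (b l).
exists D; split.
- move=> y z; rewrite /D -big_split; apply: eq_bigr => l _ /=.
  by rewrite /A !mulrDl deD; ring.
- move=> y z; rewrite -[D y * z]mulrC -key mulr_sumr -big_split.
  by apply: eq_bigr => l _ /=; rewrite /A mulrA; ring.
move=> c; rewrite /D -[RHS]mulr1 -sum1 mulr_sumr; apply: eq_bigr => l _.
by rewrite /A deZ; ring.
Qed.

End DerivationExtension.

(** * Derivations at a point and their effect on orders *)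

Section CurveDerivations.
Context (k : closedFieldType) (char0 : [pchar k] =i pred0) (X : curve k).
Local Notation L := (ratfun X).
Implicit Types (D : L -> L) (P : closed_point X).

Section Rules.
Context (D : L -> L) (der : derivation D).

Lemma derD y z : D (y + z) = D y + D z. Proof. by case: der. Qed.
Lemma derM y z : D (y * z) = D y * z + y * D z. Proof. by case: der. Qed.
Lemma derC c : D (cst X c) = 0. Proof. by case: der. Qed.
Lemma der0 : D 0 = 0. Proof. by have := derC 0; rewrite rmorph0. Qed.
Lemma der1 : D 1 = 0. Proof. by have := derC 1; rewrite rmorph1. Qed.

Lemma derN y : D (- y) = - D y.
Proof. by apply/eqP; rewrite -addr_eq0 -derD addrC subrr der0. Qed.

Lemma derB y z : D (y - z) = D y - D z. Proof. by rewrite derD derN. Qed.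

Lemma derX y n : D (y ^+ n) = n%:R * y ^+ n.-1 * D y.
Proof.
elim: n => [|n IH]; first by rewrite der1 !mul0r.
rewrite exprS derM IH; case: n IH => [|n] _ /=; first by rewrite expr0; ring.
by rewrite -[n.+2]addn1 natrD exprS; ring.
Qed.

Lemma derV y : y != 0 -> D y^-1 = - D y / y ^+ 2.
Proof.
move=> y0; have : D (y * y^-1) = 0 by rewrite mulfV// der1.
rewrite derM => /eqP; rewrite addrC addr_eq0 => /eqP e.
by apply: (mulfI y0); rewrite e; field.
Qed.

Lemma der_ev y p : D (ev y p) = ev y p^`() * D y.
Proof.
elim/poly_ind: p => [|p c IH]; first by rewrite deriv0 !rmorph0 mul0r der0.
rewrite derivD derivC addr0 derivM derivX mulr1 !rmorphD !rmorphM.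
by rewrite evX evC derD derC derM IH; ring.
Qed.

End Rules.

Lemma der_horner D (p : {poly L}) y : derivation D -> (forall i, D p`_i = 0) ->
  D p.[y] = p^`().[y] * D y.
Proof.
move=> der; elim/poly_ind: p => [|p c IH] pc.
  by rewrite deriv0 !horner0 mul0r (der0 der).
have pc' i : D p`_i = 0 by have := pc i.+1; rewrite coefD coefMX coefC addr0.
have c0 : D c = 0 by have := pc 0%N; rewrite coefD coefMX coefC add0r.
rewrite derivD derivC addr0 derivM derivX mulr1 !hornerE (derD der) (derM der) c0.
by rewrite IH//; ring.
Qed.

(** Take p of least degree with p(y) = 0 and coefficients killed by D; D t = 0 provides one. Then
    p'(y) D y = 0, while p' is nonzero in characteristic zero and of smaller degree. *)
Lemma der_eq0 D t : derivation D -> nonconst t -> D t = 0 -> forall y, D y = 0.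
Proof.
move=> der tn Dt y.
have exn : exists n, `[< exists p : {poly L},
    [/\ p != 0, forall i, D p`_i = 0, p.[y] = 0 & size p = n] >].
  have [phi phit] := nonconst_emb tn; have [N dN] := finite_degree tn phit.
  have /(poly_dep phit)[p [[i0 pi0] sp]] : ~ lfree phi (fun j : 'I_N.+1 => y ^+ j).
    by move=> /(has_dim_free dN)/(_ (fun=> Logic.I)); rewrite card_ord ltnn.
  pose g := \poly_(j < N.+1) ev t (p (inord j)).
  exists (size g); apply/asboolP; exists g; split=> //.
  - apply: contra_neq pi0 => /polyP/(_ i0); rewrite coef_poly ltn_ord coef0 inord_val.
    by move/eqP; rewrite ev_eq0// => /eqP.
  - move=> i; rewrite coef_poly; case: ifP => _; last exact: der0.
    by rewrite (der_ev der) Dt mulr0.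
  rewrite (@horner_coef_wide _ N.+1) ?size_poly// -[RHS]sp.
  by apply: eq_bigr => j _; rewrite coef_poly ltn_ord inord_val.
case: (ex_minnP exn) => n /asboolP[p [p0 Dp py sp]] pmin.
apply/eqP; apply: contraT => Dy.
have := der_horner y der Dp; rewrite py (der0 der) => /esym/eqP.
rewrite mulf_eq0 (negPf Dy) orbF => /eqP p'y.
have Dp' i : D p^`()`_i = 0.
  by rewrite coef_deriv -mulr_natl (derM der) Dp mulr0 addr0
     -(rmorph_nat (cst X)) (derC der) mul0r.
case: n sp pmin => [|[|n]] sp pmin.
- by move/eqP: sp; rewrite size_poly_eq0 (negPf p0).
- have /size_poly1P[c c0 pc] : size p == 1%N by rewrite sp.
  by move/eqP: py; rewrite pc hornerC (negPf c0).
have p'n : p^`()`_n != 0.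
  rewrite coef_deriv -mulr_natl mulf_neq0 ?curve_char0//.
  by have := p0; rewrite -lead_coef_eq0 lead_coefE sp.
have : (n.+2 <= size p^`())%N.
  apply: pmin; apply/asboolP; exists p^`(); split=> //.
  by apply: contraNneq p'n => ->; rewrite coef0.
rewrite leqNgt; apply: contraNT => _.
by have := lt_size_deriv p0; rewrite sp.
Qed.

Lemma local_expansion P s y (N : nat) : ord P s = 1 -> vge P 0 y ->
  exists r, vge P N%:Z (y - ev s r).
Proof.
move=> Ps y0; have s0 : s != 0 by apply: (@ord_neq0 _ _ P); rewrite Ps.
elim: N => [|N [r yr]]; first by exists 0; rewrite rmorph0 subr0.
have sN : s ^+ N != 0 by rewrite expf_neq0.
have oN : ord P (s ^+ N) = N%:Z by rewrite ordX Ps natz.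
have [|c yc] := @residue _ _ P ((y - ev s r) / s ^+ N).
  by rewrite vge_mulE ?invr_eq0// ordV oN opprK add0r.
exists (r + c%:P * 'X^N); rewrite rmorphD rmorphM rmorphXn evX evC opprD addrA.
have -> : y - ev s r - cst X c * s ^+ N = ((y - ev s r) / s ^+ N - cst X c) * s ^+ N.
  by rewrite mulrBl divfK.
by rewrite vge_mulE// oN -addn1 PoszD addrC addKr.
Qed.

Lemma vge_ev_deriv P s g (N : nat) : ord P s = 1 -> vge P N.+1%:Z (ev s g) ->
  vge P N%:Z (ev s g^`()).
Proof.
move=> Ps; have s0 : s != 0 by apply: (@ord_neq0 _ _ P); rewrite Ps.
have sr : vge P 0 s by rewrite vgeE// Ps.
elim: N g => [|N IH] g gN; first by rewrite evE vge_horner.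
have [q gq] : exists q, g = q * 'X.
  exists (drop_poly 1 g); rewrite -{1}[g](poly_take_drop 1).
  suff -> : take_poly 1 g = 0 by rewrite add0r.
  apply/polyP=> -[|l]; rewrite coef_take_poly coef0//=.
  apply/eqP; apply: contraT => g0; move: gN.
  have rg : ~~ root g 0 by rewrite /root horner_coef0.
  have [||h1 h2] := @ord_ev_unit _ _ P s 0 g; rewrite ?rmorph0 ?subr0 ?Ps//.
  by rewrite vgeE// h2.
have qN : vge P N.+1%:Z (ev s q).
  move: gN; rewrite gq rmorphM evX vge_mulE// Ps.
  by rewrite -addn1 PoszD addrK.
rewrite gq derivM derivX mulr1 rmorphD rmorphM evX; apply: vgeD => //.
by rewrite vge_mulE// Ps -addn1 PoszD addrK IH.
Qed.

Lemma vge_horner_sub P (p : {poly L}) y z N : (forall i, vge P 0 p`_i) ->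
  vge P 0 y -> vge P 0 z -> vge P N (y - z) -> vge P N (p.[y] - p.[z]).
Proof.
elim/poly_ind: p => [|p c IH] pc y0 z0 yz; first by rewrite !horner0 subrr vge0.
have pc' i : vge P 0 p`_i by have := pc i.+1; rewrite coefD coefMX coefC addr0.
have pz : vge P 0 p.[z].
  rewrite horner_coef; apply: vge_sum => i _; apply: vgeMl => //.
  exact: vgeX.
rewrite !hornerMXaddC.
have -> : p.[y] * y + c - (p.[z] * z + c) = y * (p.[y] - p.[z]) + p.[z] * (y - z).
  by ring.
by apply: vgeD; apply: vgeMl => //; exact: IH.
Qed.

(* If p(y) = 0 with p over k[s], then comparing D (p(y)) with D (p(r)) for a
   polynomial r in s close to y bounds D y - r'(s). *)
Lemma derivation_regular D P s y : derivation D -> ord P s = 1 -> D s = 1 ->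
  vge P 0 y -> vge P 0 (D y).
Proof.
move=> der Ps Ds y0; have s0 : s != 0 by apply: (@ord_neq0 _ _ P); rewrite Ps.
have sn : nonconst s by apply: (@ord_nonconst _ _ P); rewrite Ps.
have sr : vge P 0 s by rewrite vgeE// Ps.
have evr g : vge P 0 (ev s g) by rewrite evE vge_horner.
pose over n (G : nat -> {poly k}) := \poly_(j < n) ev s (G j).
have exn : exists n, `[< exists G, over n G != 0 /\ (over n G).[y] = 0 >].
  have [phi phis] := nonconst_emb sn; have [N dN] := finite_degree sn phis.
  have /(poly_dep phis)[p [[i0 pi0] sp]] : ~ lfree phi (fun j : 'I_N.+1 => y ^+ j).
    by move=> /(has_dim_free dN)/(_ (fun=> Logic.I)); rewrite card_ord ltnn.
  exists N.+1; apply/asboolP; exists (fun j => p (inord j)); split.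
    apply: contra_neq pi0 => /polyP/(_ i0); rewrite coef_poly ltn_ord coef0 inord_val.
    by move/eqP; rewrite ev_eq0// => /eqP.
  rewrite (@horner_coef_wide _ N.+1) ?size_poly// -[RHS]sp.
  by apply: eq_bigr => j _; rewrite coef_poly ltn_ord inord_val.
case: (ex_minnP exn) => n /asboolP[G [p0 py]] pmin; set p := over n G in p0 py.
(* The coefficients of p are differentiated, so that D (p(z)) = q(z) + p'(z) D z. *)
pose q := over n (fun j => (G j)^`()).
have pD z : D p.[z] = q.[z] + p^`().[z] * D z.
  have pE : p.[z] = \sum_(j < n) ev s (G j) * z ^+ j.
    rewrite (@horner_coef_wide _ n) ?size_poly//; apply: eq_bigr => j _.
    by rewrite coef_poly ltn_ord.
  have qE : q.[z] = \sum_(j < n) ev s (G j)^`() * z ^+ j.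
    rewrite (@horner_coef_wide _ n) ?size_poly//; apply: eq_bigr => j _.
    by rewrite coef_poly ltn_ord.
  have p'E : p^`().[z] = \sum_(j < n) ev s (G j) * (j%:R * z ^+ j.-1).
    have -> : p = \sum_(j < n) ev s (G j) *: 'X^j by exact: poly_def.
    rewrite raddf_sum horner_sum; apply: eq_bigr => j _.
    by rewrite /= derivZ derivXn hornerZ hornerMn hornerXn -mulr_natl.
  rewrite pE qE p'E (big_morph D (derD der) (der0 der)) mulr_suml -big_split.
  apply: eq_bigr => j _ /=.
  by rewrite (derM der) (der_ev der) Ds mulr1 (derX der); ring.
have p'y : p^`().[y] != 0.
  apply/negP => /eqP p'y; case: n => [|n] in G p p0 py pmin q pD p'y *.
    by case/eqP: p0; rewrite /p /over poly_def big_ord0.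
  have : (n < n)%N; last by rewrite ltnn.
  apply: pmin; apply/asboolP; exists (fun j => (G j.+1) *+ j.+1).
  suff -> : over n (fun j => G j.+1 *+ j.+1) = p^`().
    split=> //; have sp : (1 < size p)%N.
      rewrite ltnNge; apply/negP => /size1_polyC pc.
      by move: py p0; rewrite pc hornerC => ->; rewrite eqxx.
    have := sp; rewrite -(ltn_predK sp) => sp2.
    apply/negP => /eqP /polyP/(_ (size p).-2); rewrite coef0 coef_deriv => /eqP.
    rewrite -mulr_natl mulf_eq0 (negPf (curve_char0 char0 X (ltn0Sn _))) /=.
    have -> : (size p).-2.+1 = (size p).-1 by case: (size p) sp => [|[|]].
    by rewrite -lead_coefE lead_coef_eq0 (negPf p0).
  apply/polyP => i; rewrite coef_deriv !coef_poly ltnS.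
  by case: ifP => _; rewrite ?rmorphMn ?mul0rn.
(* N is the precision lost in the final division by p'(y); y is approximated to order N + 1 because
   differentiation costs one more. *)
pose N := `|ord P p^`().[y]|%N.
have [r yr] := local_expansion N.+1 Ps y0.
suff : vge P 0 (D y - ev s r^`()).
  by move=> h; rewrite -[D y](subrK (ev s r^`())) vgeD.
have pint i : vge P 0 p`_i.
  by rewrite coef_poly; case: ifP => _; [exact: evr|exact: vge0].
have qint i : vge P 0 q`_i.
  by rewrite coef_poly; case: ifP => _; [exact: evr|exact: vge0].
have p'int i : vge P 0 p^`()`_i.
  rewrite coef_deriv -mulr_natl -(rmorph_nat (cst X)).
  by apply: vgeMl => //; exact: vge_cst.
have yr' : vge P N%:Z (y - ev s r) by apply: vge_le yr; rewrite lez_nat.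
have e1 : vge P N%:Z (q.[y] - q.[ev s r]) by exact: vge_horner_sub.
have e2 : vge P N%:Z (p^`().[y] - p^`().[ev s r]) by exact: vge_horner_sub.
have [g ge] : exists g, p.[ev s r] = ev s g.
  exists (\sum_(j < n) G j * r ^+ j).
  rewrite (@horner_coef_wide _ n) ?size_poly// rmorph_sum; apply: eq_bigr => j _.
  by rewrite coef_poly ltn_ord rmorphM rmorphXn.
have e3 : vge P N%:Z (D p.[ev s r]).
  rewrite ge (der_ev der) Ds mulr1; apply: (vge_ev_deriv Ps); rewrite -ge.
  rewrite -[p.[_]]opprK vgeN -sub0r -py.
  exact: vge_horner_sub.
have : vge P N%:Z (p^`().[y] * (D y - ev s r^`())).
  have -> : p^`().[y] * (D y - ev s r^`()) = D p.[y] - D p.[ev s r]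
      - (q.[y] - q.[ev s r]) - ev s r^`() * (p^`().[y] - p^`().[ev s r]).
    by rewrite !pD (der_ev der) Ds; ring.
  rewrite py (der0 der) sub0r; apply: vgeB; last by apply: vgeMl.
  by apply: vgeB => //; rewrite vgeN.
rewrite mulrC vge_mulE//; apply: vge_le.
by rewrite /N; clear; lia.
Qed.

(** For u = s^n w with n > 0 and w a unit, D u = n s^(n-1) w + s^n D w, where D w is regular and n
    invertible, so the first term dominates. Poles are handled through 1 / u. *)
Lemma derivation_ord D P s u : derivation D -> ord P s = 1 -> D s = 1 ->
  ord P u != 0 -> D u != 0 /\ ord P (D u) = ord P u - 1.
Proof.
move=> der Ps Ds; have s0 : s != 0 by apply: (@ord_neq0 _ _ P); rewrite Ps.
have pos u' (n : nat) : u' != 0 -> ord P u' = n.+1%:Z ->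
    D u' != 0 /\ ord P (D u') = ord P u' - 1.
  move=> u0 Pu; pose w := u' / s ^+ n.+1.
  have oX i : ord P (s ^+ i) = i%:Z by rewrite ordX Ps natz.
  have w0 : w != 0 by rewrite mulf_neq0 ?invr_eq0 ?expf_neq0.
  have ow : ord P w = 0 by rewrite ord_div ?expf_neq0// oX Pu subrr.
  have uE : u' = s ^+ n.+1 * w by rewrite mulrC divfK ?expf_neq0.
  have n0 := curve_char0 char0 X (ltn0Sn n).
  have nC : n.+1%:R = cst X n.+1%:R by rewrite rmorph_nat.
  have ns0 : n.+1%:R * s ^+ n != 0 := mulf_neq0 n0 (expf_neq0 n s0).
  have lead0 : n.+1%:R * s ^+ n * w != 0 := mulf_neq0 ns0 w0.
  have leado : ord P (n.+1%:R * s ^+ n * w) = n%:Z.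
    rewrite (ordM _ ns0 w0) (ordM _ n0 (expf_neq0 n s0)) ow oX nC ord_cst.
    by rewrite add0r addr0.
  have DE : D u' = n.+1%:R * s ^+ n * w + s ^+ n.+1 * D w.
    by rewrite {1}uE (derM der) (derX der) Ds mulr1.
  have [|h1 h2] := @ord_addl _ _ P _ (s ^+ n.+1 * D w) lead0.
    rewrite leado mulrC vge_mulE ?expf_neq0// oX -addn1 PoszD subrr.
    by apply: (derivation_regular der Ps Ds); rewrite vgeE// ow.
  rewrite DE; split=> //; rewrite h2 leado Pu.
  by rewrite -addn1 PoszD addrK.
move=> Pu; have u0 : u != 0 by exact: ord_neq0 Pu.
have [[n un]|[n un]] : (exists n : nat, ord P u = n.+1%:Z) \/ (exists n : nat, ord P u^-1 = n.+1%:Z).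
  rewrite ordV; case: (ord P u) Pu => [[|n]|n] // _; first by left; exists n.
  by right; exists n.
  exact: pos un.
have [h1 h2] := pos _ _ (invr_neq0 u0) un; move: h1 h2.
rewrite (derV der u0) mulNr oppr_eq0 ordN mulf_eq0 negb_or => /andP[Du _].
rewrite ord_div ?expf_neq0// ordX ordV; split=> //.
by move: h2; clear; move: (ord _ _) (ord _ _) => a b; lia.
Qed.

End CurveDerivations.

Section CanonicalClass.
Context (k : closedFieldType) (char0 : [pchar k] =i pred0).

(* At a point P over which a basis and its dual basis are regular, the local
   sections of O are self-dual for the trace form, so f is unramified over P. *)
Lemma ramification_divisor (X Y : curve k) (f : morphism X Y) m : has_degree f m ->
  exists R : divisor X, forall Q, coeff Q R = (ram f Q)%:Z - 1.
Proof.
move=> dm; have m0 : m%:R != 0 :> ratfun Y.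
  exact: (curve_char0 char0 _ (has_dim_gt0 (oner_neq0 _) Logic.I dm)).
have [e [ef eT]] := (has_dimE _ _ _).1 dm.
have eB : lbasis (pull f) e by split=> // y; rewrite -eT.
have [b [bB be]] := dual_basis_exists eB m0.
have /choice[Se SeP] : forall l, exists S : seq (closed_point X),
    forall Q, ord Q (e l) != 0 -> Q \in S by move=> l; exact: finite_support.
have /choice[Sb SbP] : forall l, exists S : seq (closed_point X),
    forall Q, ord Q (b l) != 0 -> Q \in S by move=> l; exact: finite_support.
pose S := flatten [seq Se l ++ Sb l | l <- enum 'I_m].
have good Q l : Q \notin S -> vge Q 0 (e l) /\ vge Q 0 (b l).
  move=> /flatten_mapP QS.
  have Ql : Q \notin Se l ++ Sb l by apply/negP => h; apply: QS; exists l; rewrite ?mem_enum.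
  move: Ql; rewrite mem_cat negb_or => /andP[he hb].
  by split; rewrite /vge; apply/orP; right; rewrite ?(contraNeq (SeP l Q) he)// (contraNeq (SbP l Q) hb).
apply: (@div_exists _ X (fun Q => (ram f Q)%:Z - 1)
  (flatten [seq fibre f P | P <- [seq fpt f Q | Q <- S]])) => Q.
apply: contraNT => /flatten_mapP Qbad; set P := fpt f Q in Qbad.
have fibS Q' : fpt f Q' = P -> Q' \notin S.
  move=> QP; apply/negP => QS; apply: Qbad; exists P; last first.
    by rewrite (fibreP P dm).2.
  by apply/mapP; exists Q'.
have Qrem : Q \notin rem Q (fibre f P) by rewrite mem_rem_uniqF ?(fibreP P dm).1.
(* At Q, z has the largest pole that the trace form tolerates, of order e - 1. Its coordinates being
   integral, z is regular at Q, which forces e = 1. *)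
have [z [z0 zQ zS]] := weak_approximation (1 - (ram f Q)%:Z) 0 Qrem.
have [s Ps] := ord_unif P.
have s0 : s != 0 by apply: (@ord_neq0 _ _ P); rewrite Ps.
have zint Q' : fpt f Q' = P -> vge Q' (1 - (ram f Q')%:Z) z.
  move=> QP; rewrite vgeE//; have [->|QQ] := eqVneq Q' Q; first by rewrite zQ.
  apply: le_trans (zS Q' _); first by rewrite subr_le0 lez_nat ram_gt0.
  by rewrite mem_rem_uniq ?(fibreP P dm).1// inE QQ (fibreP P dm).2 QP /=.
have trz l : vge P 0 (ltrace (pull f) e (z * e l)).
  have : vge P 1 (ltrace (pull f) e (pull f s * (z * e l))).
    apply: (trace_vanish dm eB) => Q' QP.
    rewrite mulrC vge_mulE ?fmorph_eq0// ord_pull QP Ps mulr1 mulrC.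
    by apply: vgeMl; [have [] := good Q' l (fibS Q' QP)|exact: zint].
  by rewrite (ltraceZ eB) mulrC vge_mulE// Ps subrr.
have : vge Q 0 z.
  rewrite (lcoordE bB z); apply: vge_sum => l _; rewrite (lcoord_dual eB _ _ be bB).
  have [_ bl] := good Q l (fibS Q erefl); apply: vgeMl => //.
  have := @local_sectionsZ _ _ _ f 0 P _ 1 (trz l); rewrite mulr1 => h.
  have := h _ Q erefl; rewrite coeff0 oppr0; apply => Q' _.
  by rewrite coeff0 oppr0 vge1.
rewrite vgeE// zQ subr_eq0 => le_e; have := ram_gt0 f Q; move: le_e; clear.
by move: (ram f Q) => e; lia.
Qed.

Lemma P1_derivation : exists d : ratfun (P1 k) -> ratfun (P1 k),
  [/\ forall y z, d (y + z) = d y + d z, forall y z, d (y * z) = d y * z + y * d z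
    & forall p, d (tofrac p) = tofrac p^`()].
Proof.
apply: (@fraction_derivation k {fraction {poly k}} (@tofrac {poly k})).
  by move=> p q /eqP; rewrite tofrac_eq => /eqP.
exact: fracE.
Qed.

Context (X : curve k) (h : morphism X (P1 k)) (m : nat) (dm : has_degree h m).
Local Notation t := (pull h P1T).

Lemma exists_derivation : exists D, derivation D /\ D t = 1.
Proof.
have [d [dD dM dp]] := P1_derivation.
have m0 : m%:R != 0 :> ratfun (P1 k).
  exact: (curve_char0 char0 _ (has_dim_gt0 (oner_neq0 _) Logic.I dm)).
have [D [DD DM Dphi]] := derivation_extension dm m0 dD dM.
exists D; split; last by rewrite Dphi dp derivX tofrac1 rmorph1.
split=> // c; rewrite -(pull_cst h) Dphi P1_cstE dp derivC.
by rewrite tofrac0 rmorph0.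
Qed.

Lemma pull_nonconst (Y : curve k) (f : morphism X Y) y : nonconst y -> nonconst (pull f y).
Proof. by move=> yn c; rewrite -(pull_cst f) (inj_eq (fmorph_inj _)). Qed.

Context (oo : closed_point (P1 k)) (ooT : ord oo (P1T^-1) = 1).
Context (ooP : forall Q : closed_point (P1 k), (0 < ord Q (P1T^-1)) = (Q == oo)).
Context (R : divisor X) (RE : forall Q, coeff Q R = (ram h Q)%:Z - 1).
Local Notation K := (R - pull_div h << oo >> *~ 2).

(** Over a finite point t - c has order e and dt order e - 1; over [oo] t has order - e and dt order
    - e - 1 = (e - 1) - 2e. Hence K = R - 2H. *)
Lemma ord_dt (P : closed_point X) s D : derivation D -> ord P s = 1 -> D s = 1 ->
  ord P (D t) = coeff P K.
Proof.
move=> der Ps Ds.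
rewrite coeffB raddfMz /= RE (pull_divE _ _ dm) coeff_pt -mulrzr intz.
have e0 := ram_gt0 h P.
have [tau [tp Pt _]] := P1_point_param (fpt h P).
have [Poo|Poo] := eqVneq oo (fpt h P).
  have ot : ord P t = - (ram h P)%:Z.
    by rewrite ord_pull -Poo -[P1T]invrK ordV ooT mulrN1.
  have [|_ ->] := derivation_ord char0 der Ps Ds (u := t); rewrite ot.
    by move: e0; clear; lia.
  by rewrite mulr1; clear; lia.
have [c tauE] : exists c, tau = P1T - cst (P1 k) c.
  case: tp => // tauE; case/eqP: Poo; apply/esym/eqP; rewrite -ooP -tauE Pt.
  by [].
have ot : ord P (t - cst X c) = (ram h P)%:Z.
  by rewrite -(pull_cst h) -rmorphB -tauE ord_pull Pt mulr1.
have Dtc : D t = D (t - cst X c) by rewrite (derB der) (derC der) subr0.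
rewrite Dtc; have [|_ ->] := derivation_ord char0 der Ps Ds (u := t - cst X c); rewrite ot.
  by move: e0; clear; lia.
by rewrite mulr0 mul0r subr0.
Qed.

Lemma canonical_classE : canonical_class X = cls K.
Proof.
have tn : nonconst t by apply/pull_nonconst/P1T_nonconst.
have [D0 [der0 D0t]] := exists_derivation.
have D0n y : nonconst y -> D0 y != 0.
  move=> yn; apply/negP => /eqP D0y; have := der_eq0 char0 der0 yn D0y t.
  by rewrite D0t => /eqP; rewrite oner_eq0.
(* Dividing D0 by D0 s gives d/ds for any uniformizer s. *)
have unif (P : closed_point X) : exists s D, [/\ ord P s = 1, derivation D & D s = 1].
  have [s Ps] := ord_unif P; have sn : nonconst s by apply: (@ord_nonconst _ _ P); rewrite Ps.
  exists s, (fun y => D0 y / D0 s); split=> //; last by rewrite divff ?D0n.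
  split=> [y z|y z|c].
  - by rewrite (derD der0) mulrDl.
  - by rewrite (derM der0); ring.
  - by rewrite (derC der0) mul0r.
apply: xget_unique.
  exists K => //; exists 1, t; split=> //; first exact: oner_neq0.
  move=> P; have [s [D [Ps der Ds]]] := unif P; exists s, D; split=> //.
  by rewrite mul1r (ord_dt der Ps Ds).
move=> _ [E [y [t' [y0 t'n yE]]] <-].
apply/cls_eqP; exists (y * D0 t'); first by rewrite mulf_neq0 ?D0n.
move=> P; have [s [D [Ps der Ds EP]]] := yE P.
(* Derivations form a line over the function field: D - D(t) D0 kills t, hence everything. *)
have DE z : D z = D t * D0 z.
  pose D' z := D z - D t * D0 z.
  have der' : derivation D'.
    split=> [u v|u v|c]; rewrite /D'.
    - by rewrite (derD der) (derD der0); ring.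
    - by rewrite (derM der) (derM der0); ring.
    - by rewrite (derC der) (derC der0) mulr0 subr0.
  have := der_eq0 char0 der' tn _ z; rewrite /D' D0t mulr1 subrr => /(_ erefl)/eqP.
  by rewrite subr_eq0 => /eqP.
have Dt0 : D t != 0.
  apply/negP => /eqP Dt; have := der_eq0 char0 der tn Dt s.
  by rewrite Ds => /eqP; rewrite oner_eq0.
rewrite coeffB EP (DE t') mulrCA.
rewrite (ordM _ Dt0 (mulf_neq0 y0 (D0n _ t'n))) (ord_dt der Ps Ds).
by rewrite addrC addKr.
Qed.

End CanonicalClass.

Section RiemannRochTheorem.
Context (k : closedFieldType) (char0 : [pchar k] =i pred0).
Context (X : curve k) (h : morphism X (P1 k)) (m : nat) (dm : has_degree h m).

Theorem riemann_roch (M : Pic X) :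
  (h0 M)%:Z - (h0 (canonical_class X - M))%:Z = deg (rep M) + 1 - (genus X)%:Z.
Proof.
have [oo [ooT ooP]] := P1_param_point (P1TV_param k).
have [R RE] := ramification_divisor char0 dm.
rewrite -{1 2}(cls_rep M) /genus (canonical_classE char0 dm ooT ooP RE) -clsB.
exact: (riemann_roch_line char0 dm (P1_line k) ooT ooP RE).
Qed.

Lemma deg_canonical : Picd (2 * (genus X)%:Z - 2) (canonical_class X).
Proof.
apply/PicdE; have h00 : h0 (0 : Pic X) = 1%N.
  by rewrite -cls0 (h0_uniq (Lspace0_dim X)).
have := riemann_roch (canonical_class X); rewrite subrr h00 -/(genus X).
by move: (deg _) (genus X) => a b; clear; lia.
Qed.

End RiemannRochTheorem.

(** * Automorphisms of curves *)

Lemma rmorphism_factor (K F L : fieldType) (phi : {rmorphism K -> L})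
    (psi : {rmorphism F -> L}) :
  (forall z, exists c, phi z = psi c) ->
  exists g : {rmorphism K -> F}, forall z, psi (g z) = phi z.
Proof.
move=> /choice[g gE]; have gB : zmod_morphism g.
  by move=> y z; apply: (fmorph_inj psi); rewrite rmorphB -!gE rmorphB.
have gM : monoid_morphism g.
  split=> [|y z]; apply: (fmorph_inj psi); first by rewrite -gE !rmorph1.
  by rewrite rmorphM -!gE rmorphM.
pose Z := GRing.isZmodMorphism.Build _ _ g gB.
pose M := GRing.isMonoidMorphism.Build _ _ g gM.
pose G : {rmorphism K -> F} := HB.pack g Z M.
by exists G => z /=.
Qed.

Lemma iter_fix (T : Type) (s : T -> T) v n m :
  iter n s v = v -> iter (m * n) s v = v.
Proof.
by move=> sn; elim: m => [|m IH]; rewrite ?mul0n// mulSn iterD IH.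
Qed.

Lemma iter_coprime (T : Type) (s : T -> T) v n p : (0 < n)%N ->
  iter n s v = v -> iter p s v = v -> coprime n p -> s v = v.
Proof.
move=> n0 sn sp; rewrite /coprime => /eqP g1.
case: (egcdnP p n0) => km kn e _; rewrite g1 addn1 in e.
by have := iter_fix km sn; rewrite e iterS (iter_fix kn sp).
Qed.

Section PrimeDegree.
Context (F L : fieldType) (phi : {rmorphism F -> L}) (s : {rmorphism L -> L}).
Context (p : nat) (pP : prime p) (dp : has_dim phi setT p).
Context (sphi : forall c, s (phi c) = phi c) (sp : iter p s =1 id).

Lemma iter_rmorph_root (q : {poly L}) v n : (forall i, s q`_i = q`_i) ->
  q.[v] = 0 -> q.[iter n s v] = 0.
Proof.
move=> sq qv; elim: n => [//|n IH]; rewrite iterS.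
suff -> : q.[s (iter n s v)] = s q.[iter n s v] by rewrite IH rmorph0.
rewrite !horner_coef rmorph_sum; apply: eq_bigr => i _.
by rewrite rmorphM rmorphXn sq.
Qed.

(* The p conjugates of a non-fixed element are distinct, so that it is not a
   root of a polynomial of degree < p over the fixed field; hence the degree
   over the fixed field is at least p. *)
Lemma fixed_field_prime y : ~ s =1 id -> s y = y -> exists c, y = phi c.
Proof.
move=> /existsNP[v sv] sy.
have p1 := prime_gt0 pP.
have noroot (q : {poly L}) : (size q <= p)%N -> (forall i, s q`_i = q`_i) ->
    q.[v] = 0 -> q = 0.
  move=> szq sq qv; apply/eqP; apply: contraT => q0.
  have := max_poly_roots (rs := [seq iter i s v | i <- iota 0 p]) q0.
  rewrite size_map size_iota ltnNge szq => H; apply: H.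
    by apply/allP => _ /mapP[i _ ->]; rewrite /root iter_rmorph_root.
  rewrite map_inj_in_uniq ?iota_uniq// => i j.
  rewrite !mem_iota !add0n /= => ip jp.
  wlog ij : i j ip jp / (i <= j)%N.
    by move=> H; case: (leqP i j) => [/H|/ltnW/H h e]; [exact|exact/esym/h].
  move=> e; apply/eqP; rewrite eqn_leq ij -subn_eq0.
  apply: contraT; rewrite -lt0n => ji0; exfalso; apply: sv.
  have fixv : iter (j - i) s v = v.
    have inj : injective (iter i s).
      by elim: (i) => [//|n IH] a b; rewrite !iterS => /fmorph_inj/IH.
    by apply: inj; rewrite -iterD subnKC.
  apply: (iter_coprime ji0 fixv); first exact: sp.
  rewrite coprime_sym prime_coprime//; apply/negP => /(dvdn_leq ji0).
  by rewrite leqNgt (leq_ltn_trans (leq_subr i j) jp).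
have vf : lfree phi (fun i : 'I_p => v ^+ i).
  move=> c c0; pose q := \poly_(i < p) phi (if insub i is Some j then c j else 0).
  have q0 : q = 0.
    apply: noroot; first exact: size_poly.
      by move=> i; rewrite coef_poly; case: ifP => _; rewrite ?sphi ?rmorph0.
    rewrite (@horner_coef_wide _ p) ?size_poly// -[RHS]c0.
    by apply: eq_bigr => i _; rewrite coef_poly ltn_ord valK.
  move=> i; apply/eqP; rewrite -(fmorph_eq0 phi).
  by have /polyP/(_ i) := q0; rewrite coef_poly ltn_ord valK coef0 => ->.
apply: contrapT => ny; have nspan : ~ lspan phi (fun i : 'I_p => v ^+ i) y.
  case=> c yc; pose q := \poly_(i < p) phi (if insub i is Some j then c j else 0) - y%:P.
  have q0 : q = 0.
    apply: noroot.
    - rewrite (leq_trans (size_polyD _ _))// geq_max size_poly size_polyN.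
      by rewrite (leq_trans (size_polyC_leq1 _)).
    - move=> i; rewrite coefB coefC coef_poly rmorphB.
      by case: ifP => _; case: eqP => _; rewrite ?sphi ?rmorph0 ?sy.
    rewrite hornerD hornerN hornerC (@horner_coef_wide _ p) ?size_poly//.
    apply/eqP; rewrite subr_eq0 yc; apply/eqP; apply: eq_bigr => i _.
    by rewrite coef_poly ltn_ord valK.
  apply: ny; exists (if insub 0%N is Some j then c j else 0).
  have /polyP/(_ 0%N) := q0; rewrite coefB coefC coef_poly p1 eqxx coef0.
  by move/eqP; rewrite subr_eq0 => /eqP <-.
have := has_dim_free dp (lfree_ocons vf nspan) (fun=> Logic.I).
by rewrite card_option card_ord ltnn.
Qed.

End PrimeDegree.

(** A basis is 1 and the anti-invariant v = u - s u, as y = (y + s y)/2 + ((y - s y)/(2v)) v has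
    invariant coefficients. *)
Lemma involution_degree (F L : fieldType) (phi : {rmorphism F -> L})
    (s : {rmorphism L -> L}) : 2%:R != 0 :> L ->
  (forall y, s (s y) = y) -> ~ s =1 id ->
  (forall y, (exists c, phi c = y) <-> s y = y) -> has_dim phi setT 2.
Proof.
move=> two ss /existsNP[u su] fixE; pose v := u - s u.
have v0 : v != 0 by rewrite subr_eq0; apply/eqP => e; apply: su; rewrite -e.
have sv : s v = - v by rewrite rmorphB ss opprB.
have sphi c : s (phi c) = phi c by apply/fixE; exists c.
exists (fun i : 'I_2 => if i == ord0 then 1 else v); split=> [y|c].
  split=> // _; have [a ay] : exists a, phi a = (y + s y) / 2%:R.
    by apply/fixE; rewrite fmorph_div rmorphD ss rmorph_nat addrC.
  have [b bE] : exists b, phi b = (y - s y) / (2%:R * v).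
    apply/fixE; rewrite fmorph_div rmorphB ss rmorphM rmorph_nat sv.
    by rewrite mulrN invrN mulrN -mulNr opprB.
  exists (fun i => if i == ord0 then a else b).
  by rewrite big_ord_recl big_ord1 /= ay bE; field; rewrite v0 two.
rewrite big_ord_recl big_ord1 /= mulr1 => e1.
have e2 : phi (c ord0) - phi (c (fintype.lift ord0 ord0)) * v = 0.
  by rewrite -[RHS](rmorph0 s) -e1 rmorphD rmorphM !sphi sv mulrN.
have c0 : phi (c ord0) = 0.
  apply: (mulfI two); rewrite mulr0 -[RHS](addr0 0) -{1}e1 -e2.
  by ring.
have c1 : phi (c (fintype.lift ord0 ord0)) = 0.
  by move/eqP: e1; rewrite c0 add0r mulf_eq0 (negPf v0) orbF => /eqP.
move=> l; apply/eqP; rewrite -(fmorph_eq0 phi); apply/eqP.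
by case: (unliftP ord0 l) => [j ->|->//]; rewrite (fintype.ord1 j).
Qed.

Lemma odd_involution_fixpoint (T : eqType) (g : T -> T) (S : seq T) :
  uniq S -> (forall x, g (g x) = x) -> (forall x, x \in S -> g x \in S) ->
  odd (size S) -> exists2 x, x \in S & g x = x.
Proof.
move=> uS gg; have [n] := ubnP (size S); elim: n S uS => // n IH [//|x S] /andP[xS uS].
move=> /ltnSE /= szS gS; have [gx|gx] := eqVneq (g x) x.
  by exists x => //; rewrite mem_head.
have gxS : g x \in S by have := gS x (mem_head _ _); rewrite inE (negPf gx).
have szr : (size (rem (g x) S)).+1 = size S.
  by rewrite size_rem// prednK//; case: (S) gxS.
have gr y : y \in rem (g x) S -> g y \in rem (g x) S.
  rewrite !mem_rem_uniq// !inE => /andP[ygx yS].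
  have : g y \in x :: S by apply: gS; rewrite inE yS orbT.
  rewrite inE => /orP[/eqP e|->]; first by rewrite -e gg eqxx in ygx.
  rewrite andbT; apply: contraNneq xS => e.
  by rewrite -(gg x) -e gg.
move=> oS; have szn : (size (rem (g x) S) < n)%N by rewrite szr ltnW.
have or : odd (size (rem (g x) S)) by move: oS; rewrite /= -szr /= negbK.
have [y yS gy] := IH _ (rem_uniq _ uS) szn gr or.
by exists y => //; rewrite inE (mem_rem yS) orbT.
Qed.

Section Morphisms.
Context (k : closedFieldType) (X Y : curve k).

Lemma morphism_ext (a b : morphism X Y) P : pull a =1 pull b ->
  fpt a P = fpt b P /\ ram a P = ram b P.
Proof.
move=> ab; have e y : (ram a P)%:Z * ord (fpt a P) y = (ram b P)%:Z * ord (fpt b P) y.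
  by rewrite -!ord_pull ab.
have [s Ps] := ord_unif (fpt a P); have [u Pu] := ord_unif (fpt b P).
have a0 := ram_gt0 a P; have b0 := ram_gt0 b P.
have ra : ram a P = ram b P.
  apply/eqP; rewrite eqn_dvd; apply/andP; split.
    have := e u; rewrite Pu mulr1 => eu.
    have : (`|(ram a P)%:Z| %| `|(ram b P)%:Z|)%N by rewrite -eu abszM dvdn_mulr.
    by [].
  have := e s; rewrite Ps mulr1 => es.
  have : (`|(ram b P)%:Z| %| `|(ram a P)%:Z|)%N by rewrite es abszM dvdn_mulr.
  by [].
split=> //; apply: closed_point_ext => y; have := e y; rewrite ra.
by apply: mulfI; rewrite eqz_nat -lt0n.
Qed.

(* An automorphism fixing a point and a uniformizer there acts trivially on
   Taylor expansions. *)
Lemma fix_uniformizer (s : {rmorphism ratfun X -> ratfun X}) (Q : closed_point X) u :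
  (forall c, s (cst X c) = cst X c) -> (forall y, ord Q (s y) = ord Q y) ->
  ord Q u = 1 -> s u = u -> s =1 id.
Proof.
move=> sC so Qu su.
have vs n y : vge Q n (s y) = vge Q n y by rewrite /vge so fmorph_eq0.
have sev p : s (ev u p) = ev u p.
  rewrite !ev_coef rmorph_sum; apply: eq_bigr => i _.
  by rewrite rmorphM rmorphXn sC su.
have int y : vge Q 0 y -> s y = y.
  move=> y0; apply/eqP; rewrite -subr_eq0; apply/eqP; apply: (vge_eq0 (P := Q)) => n.
  have [r yr] := local_expansion `|n|%N Qu y0.
  apply: (@vge_le _ _ _ _ `|n|%N%:Z); first by lia.
  rewrite -(subrKA (ev u r)) vgeD//; last by rewrite -opprB vgeN.
  by rewrite -(sev r) -rmorphB vs.
move=> y /=; have [y0|y0] := boolP (vge Q 0 y); first exact: int.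
have yn0 : y != 0 by apply: contraNneq y0 => ->; exact: vge0.
apply: invr_inj; rewrite -fmorphV; apply: int.
rewrite vgeE ?invr_eq0// ordV oppr_ge0 ltW// ltNge.
by rewrite vgeE in y0.
Qed.

End Morphisms.

Section Automorphisms.
Context (k : closedFieldType) (X : curve k) (s : morphism X X) (n : nat).
Context (sn : has_order s n).

Lemma aut_surj y : exists z, pull s z = y.
Proof.
have [n0 [it _]] := sn; exists (iter n.-1 (pull s) y).
by rewrite -iterS prednK.
Qed.

Lemma aut_ram P : ram s P = 1%N.
Proof.
have [u Pu] := ord_unif P; have [z zu] := aut_surj u.
have := congr1 absz (ord_pull s P z); rewrite zu Pu abszM => /esym/eqP.
by rewrite muln_eq1 => /andP[/eqP].
Qed.

Lemma aut_ord P y : ord P (pull s y) = ord (fpt s P) y.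
Proof. by rewrite ord_pull aut_ram mul1r. Qed.

Lemma aut_iter_ord l P y : ord P (iter l (pull s) y) = ord (iter l (fpt s) P) y.
Proof. by elim: l P => [//|l IH] P; rewrite iterS aut_ord IH -iterSr. Qed.

Lemma aut_iter_id P : iter n (fpt s) P = P.
Proof.
apply: closed_point_ext => y; rewrite -aut_iter_ord.
by have [_ [-> _]] := sn.
Qed.

Lemma aut_inj : injective (fpt s).
Proof.
move=> P Q e; have [n0 _] := sn.
rewrite -(aut_iter_id P) -(aut_iter_id Q) -(prednK n0) !iterSr.
by rewrite e.
Qed.

Lemma aut_degree : has_degree s 1.
Proof.
exists (fun=> 1); split=> [y|c].
  by split=> // _; have [z <-] := aut_surj y; exists (fun=> z); rewrite big_ord1 mulr1.
rewrite big_ord1 mulr1 => /eqP; rewrite fmorph_eq0 => /eqP c0 l.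
by rewrite ord1.
Qed.

Lemma aut_pull_pt P : pull_Pic s (cls << fpt s P >>) = cls << P >>.
Proof.
rewrite (pull_Pic_cls aut_degree); congr cls; apply: div_ext => Q.
by rewrite (pull_divE _ _ aut_degree) aut_ram mul1r !coeff_pt (inj_eq aut_inj).
Qed.

Lemma aut_iter_pull_pt l P :
  iter l (pull_Pic s) (cls << iter l (fpt s) P >>) = cls << P >>.
Proof. by elim: l => [//|l IH]; rewrite iterSr iterS aut_pull_pt. Qed.

End Automorphisms.

(** The power s^(l + 1): the recursion starts from s, so no identity morphism is involved. *)
Fixpoint mpow (k : closedFieldType) (X : curve k) (s : morphism X X) (l : nat) :
  morphism X X := if l is l'.+1 then mcomp s (mpow s l') else s.

Lemma mpow_pull (k : closedFieldType) (X : curve k) (s : morphism X X) l y :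
  pull (mpow s l) y = iter l.+1 (pull s) y.
Proof. by elim: l y => [//|l IH] y; rewrite /= IH -iterSr. Qed.

(** * Dihedral covers *)

(** If all orders are even, half the divisor has degree zero and is the divisor of some w; then z /
    w^2 is a constant, a square in k. *)
Lemma odd_order_or_square (k : closedFieldType) (X : curve k) (z : ratfun X) :
  (forall D : divisor X, deg D = 0 -> exists2 y, y != 0 & is_div y D) -> z != 0 ->
  (exists P, odd `|ord P z|) \/ exists w, z = w ^+ 2.
Proof.
move=> princ z0; have [?|no] := pselect (exists P, odd `|ord P z|); first by left.
right; have [D zD] := is_div_exists z.
have ev2 P : ord P z = 2 * (ord P z %/ 2)%Z.
  rewrite mulrC divzK//; rewrite dvdzE /= dvdn2; apply/negP => odP.
  by apply: no; exists P.
have [S SP] := finite_support z.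
have [E EP] : exists E : divisor (X), forall P, coeff P E = (ord P z %/ 2)%Z.
  apply: (@div_exists _ _ _ S) => P e; apply: SP; apply: contra_neq e => ->.
  by [].
have DE : D = E + E by apply: div_ext => P; rewrite coeffD zD EP {1}ev2 mulr2n mulrDl !mul1r.
have degE : deg E = 0.
  have := deg_is_div z0 zD; rewrite DE degD => /eqP.
  by rewrite -mulr2n mulrn_eq0 => /eqP.
have [w w0 wE] := princ _ degE.
have [c zc] : exists c, z / w ^+ 2 = cst (X) c.
  apply: regular_const => P; rewrite vgeE ?mulf_neq0 ?invr_eq0 ?expf_neq0//.
  rewrite ord_div ?expf_neq0// ordX -wE EP {1}ev2.
  by rewrite mulr2n mulrDl !mul1r mulr2n subrr.
have [a ac] := @solve_monicpoly k 2 (fun i => if i == 0%N then c else 0) isT.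
have a2 : a ^+ 2 = c by rewrite ac big_ord_recl big_ord1 /= mul0r addr0 expr0 mulr1.
by exists (cst X a * w); rewrite exprMn -rmorphXn a2 -[LHS](divfK (expf_neq0 2 w0)) zc.
Qed.

(** For c different from the values of t at the points of S, a zero of t - c lies outside S. *)
Lemma curve_infinite (k : closedFieldType) (X : curve k) (S : seq (closed_point X)) :
  exists P, P \notin S.
Proof.
have [t [tn _]] := curve_axiom X.
have /choice[r rP] P : exists c, vge P 0 t -> vge P 1 (t - cst X c).
  by have [/residue[c]|_] := boolP (vge P 0 t); [exists c|exists 0].
have p0 : \prod_(P <- S) ('X - (r P)%:P) != 0.
  by rewrite prodf_seq_neq0; apply/allP => P _; rewrite polyXsubC_eq0.
have [c cS] := closed_nonrootP _ p0.
have tc : nonconst (t - cst X c).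
  by move=> a; rewrite subr_eq -rmorphD; exact: tn.
have [P Pt] := exists_zero tc; exists P; apply: contra cS => PS.
have t0 : vge P 0 t.
  by rewrite -(subrK (cst X c) t) vgeD ?vge_cst// /vge (ltW Pt) orbT.
have : vge P 1 (cst X (c - r P)).
  rewrite rmorphB; have -> : cst X c - cst X (r P) = (t - cst X (r P)) - (t - cst X c).
    by ring.
  by rewrite vgeB ?rP// /vge -gtz0_ge1 Pt orbT.
rewrite /vge ord_cst orbF fmorph_eq0 subr_eq0 => /eqP cr.
rewrite /root horner_prod prodf_seq_eq0; apply/hasP; exists P => //=.
by rewrite hornerXsubC cr subrr.
Qed.

(** For r < 0 both sides are empty, as effective divisors have nonnegative degree. *)
Lemma W_E (k : closedFieldType) (X : curve k) (r : int) (M : Pic X) :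
  W r M <-> Picd r M /\ (0 < h0 M)%N.
Proof.
rewrite /W; case: ltP => // r0; split=> // -[Mr /h0_effective[E [EM E0]]].
move: Mr; rewrite -EM => /PicdP Er; have := deg_ge0 E0.
by rewrite Er leNgt r0.
Qed.

Section Dihedral.
Context (k : closedFieldType) (char0 : has_char0 k).
Context (Ct C C0 : curve k) (f : morphism Ct C) (sigma : morphism Ct Ct).
Context (iota : morphism C C) (j : morphism Ct Ct).
Context (q : morphism Ct C0) (h : morphism C0 (P1 k)) (d : nat).
Hypotheses (d_prime : prime d) (d_odd : odd d).
Hypothesis cover : etale_cyclic_cover f sigma d.
Hypothesis hyper : hyperelliptic_involution iota.
Hypothesis j2 : has_order j 2.
Hypothesis fj : pull (mcomp f j) =1 pull (mcomp iota f).
Hypothesis dihedral : pull (mcomp (mcomp (mcomp j sigma) j) sigma) =1 id.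
Hypothesis q_quotient : is_quotient q [set j].
Hypothesis hq_quotient : is_quotient (mcomp h q) [set sigma; j].

Lemma order2_inv (X : curve k) (s : morphism X X) : has_order s 2 ->
  (forall y, pull s (pull s y) = y) /\ ~ pull s =1 id.
Proof. by case=> _ [ss /(_ 1%N isT)]. Qed.

Let two (X : curve k) : 2%:R != 0 :> ratfun X.
Proof. exact: (curve_char0 char0). Qed.

Let f_degree : has_degree f d. Proof. by case: cover. Qed.
Let sigma_order : has_order sigma d. Proof. by case: cover. Qed.
Let f_etale P : ram f P = 1%N. Proof. by case: cover. Qed.

Let sigma_f c : pull sigma (pull f c) = pull f c.
Proof. by case: cover => _ _ _; exact. Qed.

Lemma iota_order : has_order iota 2. Proof. by case: hyper. Qed.

Lemma sigma_nontrivial : ~ pull sigma =1 id.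
Proof. by case: sigma_order => _ [_ /(_ 1%N)]; rewrite prime_gt1 //; exact. Qed.

Lemma j_nontrivial : ~ pull j =1 id. Proof. by have [] := order2_inv j2. Qed.

Lemma pull_jj y : pull j (pull j y) = y. Proof. by have [->] := order2_inv j2. Qed.

Lemma sigma_fixed y : pull sigma y = y -> exists c, y = pull f c.
Proof.
move=> sy; have [_ [sd _]] := sigma_order.
exact: (fixed_field_prime d_prime f_degree sigma_f sd sigma_nontrivial sy).
Qed.

Lemma pull_j_fixed y : (exists c, pull q c = y) <-> pull j y = y.
Proof.
rewrite q_quotient; split=> [|jy s -> //]; exact.
Qed.

Lemma q_degree : has_degree q 2.
Proof. exact: (involution_degree (two Ct) pull_jj j_nontrivial pull_j_fixed). Qed.

Lemma pull_hq_fixed y :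
  (exists z, pull q (pull h z) = y) <-> pull sigma y = y /\ pull j y = y.
Proof.
have := hq_quotient y => /= ->; split=> [H|[sy jy] s [->|->]//].
by split; apply: H; [left|right].
Qed.

(** Functions from the line are sigma-invariant, so they come from C, as the fixed field of iota
    there. The degree of Ct over the line is thus 2 d, and through C0 it is 2 deg h. *)
Lemma h_degree : has_degree h d.
Proof.
have hqf z : exists c, (pull q \o pull h) z = pull f c.
  have /pull_hq_fixed[sz _] : exists z', pull q (pull h z') = pull q (pull h z) by exists z.
  exact: sigma_fixed.
have [g gE] := rmorphism_factor hqf.
have [ii ni] := order2_inv iota_order.
have g2 : has_dim g setT 2.
  apply: (involution_degree (two C) ii ni) => y; split=> [[c <-]|iy].
    apply: (fmorph_inj (pull f)); have /= <- := fj (g c); rewrite gE /=.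
    by have /pull_hq_fixed[] : exists z, pull q (pull h z) = pull q (pull h c) by exists c.
  have /pull_hq_fixed[z zy] : pull sigma (pull f y) = pull f y /\ pull j (pull f y) = pull f y.
    by split; [exact: sigma_f|have /= -> := fj y; rewrite iy].
  by exists z; apply: (fmorph_inj (pull f)); rewrite gE.
have dq : has_dim (pull q \o pull h) setT (d * 2).
  apply: (has_dim_eq (phi := pull f \o g)); first by move=> z; exact: gE.
  exact: has_dim_tower.
have [n dn hn] := has_dim_tower_base q_degree dq.
suff -> : d = n by [].
by apply/eqP; rewrite -(@eqn_pmul2l 2)// -dn mulnC.
Qed.

(** An anti-invariant v has v^2 = z on the line. Were all orders of z even, z would be a square and
    v invariant. Over a point P where the order is odd, the double cover ramifies, so a single point
    lies over P. *)
Lemma iota_fixed_point : exists P, fpt iota P = P.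
Proof.
have [ii ni] := order2_inv iota_order.
have [_ [pi [pi2 pii]]] := hyper.
have /existsNP[u iu] := ni; pose v := u - pull iota u.
have v0 : v != 0 by rewrite subr_eq0; apply/eqP => e; apply: iu; rewrite -e.
have iv : pull iota v = - v by rewrite rmorphB ii opprB.
have [_ [iid _]] := iota_order.
have [z vz] : exists z, v ^+ 2 = pull pi z.
  by apply: (fixed_field_prime _ pi2 pii iid ni); rewrite // rmorphXn iv sqrrN.
have z0 : z != 0 by rewrite -(fmorph_eq0 (pull pi)) -vz expf_neq0.
have [[P oP]|[w zw]] := odd_order_or_square (@P1_principal k) z0; last first.
  exfalso; move: vz; rewrite zw rmorphXn => /eqP; rewrite eqf_sqr => ww.
  have iv' : pull iota v = v.
    by case/orP: ww => /eqP ->; rewrite ?rmorphN; have /= -> := pii w.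
  have : 2%:R * v == 0 by rewrite mulr_natl mulr2n -{1}iv' iv addNr.
  by rewrite mulf_eq0 (negPf v0) orbF (negPf (two C)).
have [Q QP] := fpt_surj P pi2.
have r1 : (1 < ram pi Q)%N.
  have := ord_pull pi Q z; rewrite -vz ordX QP => e.
  rewrite ltn_neqAle ram_gt0 andbT; apply/eqP => r1.
  by move: e oP; rewrite -r1 mul1r => <-; rewrite mulr2n; lia.
exists Q; apply/eqP; apply: contraT => iQ.
have [iP _] := morphism_ext Q pii.
have uS : uniq [:: Q; fpt iota Q] by rewrite /= inE eq_sym iQ.
have fS R : R \in [:: Q; fpt iota Q] -> fpt pi R = P.
  by rewrite !inE => /orP[]/eqP->//; rewrite -QP -iP.
have := sum_ram_le uS fS pi2; rewrite big_cons big_seq1.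
by have := ram_gt0 pi (fpt iota Q); lia.
Qed.

Lemma j_points P : fpt j (fpt j P) = P. Proof. exact: (aut_iter_id j2). Qed.

Lemma f_j P : fpt f (fpt j P) = fpt iota (fpt f P).
Proof. by have [] := morphism_ext P fj. Qed.

(** As f is etale, its fibre over a fixed point of iota has d points, and an involution of a set of
    odd size has a fixed point. *)
Lemma j_fixed_point : exists Q, fpt j Q = Q.
Proof.
have [P iP] := iota_fixed_point; have [uS fS] := fibreP P f_degree.
have jS R : R \in fibre f P -> fpt j R \in fibre f P.
  by rewrite !fS f_j => /eqP ->; rewrite iP.
suff oS : odd (size (fibre f P)).
  by have [Q _ Qj] := odd_involution_fixpoint uS j_points jS oS; exists Q.
suff -> : size (fibre f P) = d by [].
have := deg_pull_div << P >> f_degree; rewrite (deg_pull_pt _ f_degree) deg_pt mulr1.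
under eq_bigr => R _ do rewrite f_etale.
by rewrite big_const_seq count_predT iter_addn addn0 mul1n => - [].
Qed.

Lemma pull_jq y : pull j (pull q y) = pull q y.
Proof. by apply/pull_j_fixed; exists y. Qed.

Lemma q_j P : fpt q (fpt j P) = fpt q P /\ ram q (fpt j P) = ram q P.
Proof.
have qj : pull (mcomp q j) =1 pull q by move=> y /=; exact: pull_jq.
by have [e] := morphism_ext P qj; rewrite /= (aut_ram j2) mul1n.
Qed.

(** Otherwise a uniformizer at P would come from C0; it would be fixed by j, which would then be
    trivial. *)
Lemma ram_q_fixed P : fpt j P = P -> (1 < ram q P)%N.
Proof.
move=> jP; rewrite ltn_neqAle ram_gt0 andbT; apply/eqP => r1.
have [u Pu] := ord_unif (fpt q P); apply: j_nontrivial.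
apply: (@fix_uniformizer _ _ _ P (pull q u)); last exact: pull_jq.
- exact: pull_cst.
- by move=> y; rewrite (aut_ord j2) jP.
- by rewrite ord_pull -r1 Pu.
Qed.

Lemma pull_div_q P : pull_div q << fpt q P >> = << P >> + << fpt j P >>.
Proof.
apply/eqP; rewrite -subr_eq0; apply/eqP; apply: effective_deg0 => [Q|]; last first.
  by rewrite degB degD (deg_pull_div _ q_degree) !deg_pt mulr1.
rewrite coeffB coeffD (pull_divE _ _ q_degree) !coeff_pt subr_ge0.
have [<-|PQ] := eqVneq P Q.
  rewrite eqxx mulr1; have [/ram_q_fixed|_] := eqVneq (fpt j P) P; first by lia.
  by have := ram_gt0 q P; lia.
rewrite add0r; have [<-|_] := eqVneq (fpt j P) Q; last by case: eqP => _; lia.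
by have [-> _] := q_j P; rewrite eqxx mulr1; have := ram_gt0 q (fpt j P); lia.
Qed.

Lemma q_fibre P Q : fpt q P = fpt q Q -> Q = P \/ Q = fpt j P.
Proof.
move=> PQ; have := congr1 (coeff Q) (pull_div_q P).
rewrite coeffD (pull_divE _ _ q_degree) !coeff_pt PQ eqxx mulr1.
have [->|_] := eqVneq P Q; first by left.
have [->|_] := eqVneq (fpt j P) Q; first by right.
by have := ram_gt0 q Q; lia.
Qed.

(* An anti-invariant function with divisor in q^* Div would, divided by a power
   of a local parameter from below, have a nonzero value at a fixed point of j. *)
Lemma pull_Pic_q_inj : injective (pull_Pic q).
Proof.
move=> M N /eqP; rewrite -subr_eq0 -(pull_PicB q_degree) => /eqP MN.
apply/eqP; rewrite -subr_eq0; apply/eqP; move: (M - N) MN => {M N}M.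
rewrite -(cls_rep M) (pull_Pic_cls q_degree) -!cls0 => /cls_eqP[y y0].
move: (rep M) => D; rewrite subr0 => yD.
have yE P : ord P y = (ram q P)%:Z * coeff (fpt q P) D.
  by rewrite -yD (pull_divE _ _ q_degree).
have jy0 : pull j y != 0 by rewrite fmorph_eq0.
have [c yc] : exists c, pull j y / y = cst Ct c.
  apply: regular_const => P; rewrite vgeE ?mulf_neq0 ?invr_eq0//.
  rewrite ord_div// (aut_ord j2) !yE; have [-> ->] := q_j P.
  by rewrite subrr.
have jy : pull j y = cst Ct c * y by rewrite -yc divfK.
have : (cst Ct c) ^+ 2 == 1.
  apply/eqP; apply: (mulIf y0); rewrite mul1r -[RHS]pull_jj jy rmorphM pull_cst jy.
  by rewrite mulrA expr2.
rewrite sqrf_eq1 => /orP[]/eqP cE; rewrite cE in jy.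
  have [z zy] : exists z, pull q z = y by apply/pull_j_fixed; rewrite jy mul1r.
  apply/cls_eqP; exists z; first by rewrite -(fmorph_eq0 (pull q)) zy.
  move=> R; have [P PR] := fpt_surj R q_degree; rewrite subr0.
  have := yE P; rewrite -zy ord_pull PR => /mulfI/esym; apply.
  by rewrite eqz_nat -lt0n ram_gt0.
have [Q jQ] := j_fixed_point; exfalso.
have [u Qu] := ord_unif (fpt q Q); pose m := coeff (fpt q Q) D.
have u0 : u != 0 by apply: (ord_neq0 (P := fpt q Q)); rewrite Qu.
have um : pull q (u ^ m) != 0 by rewrite fmorph_eq0 expfz_neq0.
pose w := y / pull q (u ^ m).
have w0 : w != 0 by rewrite mulf_neq0 ?invr_eq0.
have jw : pull j w = - w by rewrite /w fmorph_div pull_jq jy mulN1r mulNr.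
have Qw : ord Q w = 0 by rewrite ord_div// yE ord_pull ordZ Qu mul1r subrr.
have [a wa] : exists a, vge Q 1 (w - cst Ct a) by apply: residue; rewrite vgeE// Qw.
have wa' : vge Q 1 (- w - cst Ct a).
  by rewrite -jw -(pull_cst j a) -rmorphB /vge fmorph_eq0 (aut_ord j2) jQ.
have : vge Q 1 (2%:R * w).
  have -> : 2%:R * w = (w - cst Ct a) - (- w - cst Ct a) by ring.
  by rewrite vgeB.
rewrite vgeE; last exact: mulf_neq0 (two Ct) w0.
rewrite (ordM _ (two Ct) w0) Qw addr0.
by have := ord_cst Q (2%:R : k); rewrite rmorph_nat => ->.
Qed.

Local Notation s := (fpt sigma).

Lemma sigma_j_sigma P : s (fpt j (s P)) = fpt j P.
Proof.
rewrite -[LHS]j_points; congr (fpt j _); apply: closed_point_ext => y.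
rewrite -(aut_ord j2) -(aut_ord sigma_order) -(aut_ord j2) -(aut_ord sigma_order).
by have /= -> := dihedral y.
Qed.

Lemma j_iter l P : (l <= d)%N -> fpt j (iter l s P) = iter (d - l) s (fpt j P).
Proof.
move=> ld; have <- : iter l s (fpt j (iter l s P)) = fpt j P.
  elim: l {ld} P => [//|l IH] P.
  by rewrite iterSr iterS sigma_j_sigma IH.
by rewrite -iterD subnK// (aut_iter_id sigma_order).
Qed.

Lemma sigma_no_fixed_point P : s P <> P.
Proof.
move=> sP; have [u Pu] := ord_unif (fpt f P); apply: sigma_nontrivial.
apply: (@fix_uniformizer _ _ _ P (pull f u)); last exact: sigma_f.
- exact: pull_cst.
- by move=> y; rewrite (aut_ord sigma_order) sP.
- by rewrite ord_pull f_etale Pu.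
Qed.

(** Pullback moves points by the inverse of sigma, and the inverse of sigma^l is sigma^(d - l). *)
Lemma iter_pull_pt l P : (l <= d)%N ->
  iter l (pull_Pic sigma) (cls << P >>) = cls << iter (d - l) s P >>.
Proof.
move=> ld; rewrite -[X in << X >>](aut_iter_id sigma_order) -(subnKC ld) iterD.
by rewrite (aut_iter_pull_pt sigma_order) subnKC.
Qed.

Lemma iter_pull_PicD l M N : iter l (pull_Pic sigma) (M + N) =
  iter l (pull_Pic sigma) M + iter l (pull_Pic sigma) N.
Proof.
by elim: l => [//|l IH]; rewrite !iterS IH (pull_PicD (aut_degree sigma_order)).
Qed.

Lemma iter_pull_PicB l M N : iter l (pull_Pic sigma) (M - N) =
  iter l (pull_Pic sigma) M - iter l (pull_Pic sigma) N.
Proof.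
by elim: l => [//|l IH]; rewrite !iterS IH (pull_PicB (aut_degree sigma_order)).
Qed.

Lemma pull_Pic_q_pt P : pull_Pic q (cls << fpt q P >>) = cls << P >> + cls << fpt j P >>.
Proof. by rewrite (pull_Pic_cls q_degree) pull_div_q clsD. Qed.

(** Since q^* of q P is P + j P and j exchanges sigma^i and sigma^-i, both sides are the sum of the
    two translates of P and the two translates of j P. *)
Lemma pull_Dcls i P : (i <= d)%N ->
  iter i (pull_Pic sigma) (pull_Pic q (cls << fpt q P >>)) +
  iter (d - i) (pull_Pic sigma) (pull_Pic q (cls << fpt q P >>)) =
  pull_Pic q (Dcls q sigma d i P).
Proof.
move=> id; have id' : (d - i <= d)%N by rewrite leq_subr.
rewrite /Dcls clsD (pull_PicD q_degree) !pull_Pic_q_pt !iter_pull_PicD.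
rewrite !iter_pull_pt// !j_iter// subKn//.
by rewrite addrACA [RHS]addrACA [X in X + _ = _]addrC.
Qed.

(** The difference of the two [Dcls] solves the equation defining [beta]; injectivity of q^* makes
    it the only solution, so the default value does not occur. *)
Lemma beta_pt i P P' : (i <= d)%N ->
  beta q sigma d i (cls (<< fpt q P >> - << fpt q P' >>)) =
  Dcls q sigma d i P - Dcls q sigma d i P'.
Proof.
move=> id; apply: xget_unique => [|M [_ Mq]]; last first.
  apply: pull_Pic_q_inj; rewrite Mq clsB !(pull_PicB q_degree) !iter_pull_PicB.
  by rewrite -!pull_Dcls// opprD addrACA.
split; first by rewrite /Dcls -clsB; apply/PicdP; rewrite degB !degD !deg_pt.
by rewrite clsB !(pull_PicB q_degree) !iter_pull_PicB -!pull_Dcls// opprD addrACA.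
Qed.

Lemma sigma_iter_fixed l P : coprime l d -> (0 < l)%N -> iter l s P <> P.
Proof.
move=> ld l0 lP; apply: (sigma_no_fixed_point (P := P)).
exact: (iter_coprime l0 lP (aut_iter_id sigma_order P) ld).
Qed.

Lemma coprime_double l : (0 < l < d)%N -> coprime (2 * l) d.
Proof.
move=> /andP[l0 ld]; rewrite coprimeMl coprime2n d_odd /= coprime_sym.
by rewrite prime_coprime//; apply/negP => /(dvdn_leq l0); rewrite leqNgt ld.
Qed.

(** The two translates differ by sigma^(2(d - i)), whose exponent is prime to d when 0 < i < d. *)
Lemma iter_opposite i P : (i <= d)%N ->
  iter (d - i) s P = iter (2 * (d - i)) s (iter i s P).
Proof.
move=> id; rewrite -iterD mul2n -addnn -addnA subnK// iterD.
by rewrite (aut_iter_id sigma_order).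
Qed.

Lemma hq_sigma P : fpt h (fpt q (s P)) = fpt h (fpt q P).
Proof.
have e : pull (mcomp (mcomp h q) sigma) =1 pull (mcomp h q).
  move=> y /=; have [] : pull sigma (pull q (pull h y)) = pull q (pull h y) /\
      pull j (pull q (pull h y)) = pull q (pull h y) by apply/pull_hq_fixed; exists y.
  by [].
by have [] := morphism_ext P e.
Qed.

Lemma hq_iter l P : fpt h (fpt q (iter l s P)) = fpt h (fpt q P).
Proof. by elim: l => [//|l IH]; rewrite iterS hq_sigma. Qed.

(* If h were unramified at q Q, then j sigma^l would fix Q and a local parameter
   coming from the projective line. *)
Lemma ram_h_gt1 l Q : (0 < l)%N -> iter l s Q = fpt j Q -> fpt j Q != Q ->
  (1 < ram h (fpt q Q))%N.
Proof.
move=> l0 lQ jQ; rewrite ltn_neqAle ram_gt0 andbT; apply/eqP => rh.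
have rq : ram q Q = 1%N.
  have uS : uniq [:: Q; fpt j Q] by rewrite /= inE eq_sym jQ.
  have fS R : R \in [:: Q; fpt j Q] -> fpt q R = fpt q Q.
    by rewrite !inE => /orP[]/eqP->//; have [] := q_j Q.
  have := sum_ram_le uS fS q_degree; rewrite big_cons big_seq1.
  by have := ram_gt0 q Q; have := ram_gt0 q (fpt j Q); lia.
have [u Pu] := ord_unif (fpt h (fpt q Q)); pose U := pull q (pull h u).
have [sU jU] : pull sigma U = U /\ pull j U = U by apply/pull_hq_fixed; exists u.
pose t : {rmorphism ratfun Ct -> ratfun Ct} := pull (mpow sigma l.-1) \o pull j.
have tE y : t y = iter l (pull sigma) (pull j y) by rewrite /t /= mpow_pull prednK.
(* On functions coming from C, t acts as iota; so t = id would make iota trivial. *)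
have [ii ni] := order2_inv iota_order; apply: ni => y.
apply: (fmorph_inj (pull f)); have /= <- := fj y.
have it z : pull sigma z = z -> iter l (pull sigma) z = z.
  by move=> sz; elim: (l) => [//|m IH]; rewrite iterS IH.
rewrite -[LHS]it; last by have /= -> := fj y; exact: sigma_f.
rewrite -tE; apply: (@fix_uniformizer _ _ t Q U).
- by move=> c; rewrite tE pull_cst it// pull_cst.
- by move=> z; rewrite tE (aut_iter_ord sigma_order) (aut_ord j2) lQ j_points.
- by rewrite !ord_pull rq -rh Pu.
- by rewrite tE jU it.
Qed.

(** Both points lie in the fibre, which suffices if they differ. If they coincide, then sigma^l Q =
    j Q because sigma^l has no fixed point, and h ramifies there, which accounts for the
    multiplicity two. *)
Lemma pair_le_fibre i P R : (0 < i < d)%N ->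
  coeff R (<< fpt q (iter i s P) >> + << fpt q (iter (d - i) s P) >>) <=
  coeff R (pull_div h << fpt h (fpt q P) >>).
Proof.
move=> id; have /andP[i0 /ltnW id'] := id.
have idd : (0 < d - i < d)%N by lia.
rewrite coeffD (pull_divE _ _ h_degree) !coeff_pt iter_opposite//.
set Q := iter i s P; set l := (2 * (d - i))%N.
have hQ : fpt h (fpt q Q) = fpt h (fpt q P) by exact: hq_iter.
have hQ' : fpt h (fpt q (iter l s Q)) = fpt h (fpt q P) by rewrite hq_iter.
have r0 := ram_gt0 h R; have [QR|_] := eqVneq (fpt q Q) R; last first.
  rewrite add0r; have [<-|_] := eqVneq (fpt q (iter l s Q)) R; last by lia.
  by rewrite hQ' eqxx mulr1; have := ram_gt0 h (fpt q (iter l s Q)); lia.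
rewrite -QR hQ eqxx mulr1; have [e|_] := eqVneq; last by rewrite addr0; rewrite QR; lia.
have l0 : (0 < l)%N by rewrite /l; lia.
have lQ : iter l s Q <> Q by apply: sigma_iter_fixed l0; exact: coprime_double.
have [//|jQ] := q_fibre (esym e).
have jQQ : fpt j Q != Q by rewrite -jQ; apply/eqP.
by have := ram_h_gt1 l0 jQ jQQ; lia.
Qed.

Lemma pencil (i : nat) (E : divisor C0) : (0 < i < d)%N ->
  h0 (cls E) = 2 ->
  (forall P, (0 < h0 (cls E - Dcls q sigma d i P)%R)%N) ->
  exists2 B, (0 < h0 B)%N & cls E = pull_Pic h (O1 k) + B.
Proof.
move=> id E2 HP; have /andP[i0 /ltnW id'] := id.
have := h0P E; rewrite E2 => -[e [eE ef]].
pose e0 := e ord0; pose e1 := e (fintype.lift ord0 ord0).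
have spanE y : Lspace E y <-> exists a b, y = cst C0 a * e0 + cst C0 b * e1.
  rewrite eE; split=> [[c ->]|[a [b ->]]].
    exists (c ord0), (c (fintype.lift ord0 ord0)).
    by rewrite big_ord_recl big_ord1.
  exists (fun l => if l == ord0 then a else b).
  by rewrite big_ord_recl big_ord1.
have free a b : cst C0 a * e0 + cst C0 b * e1 = 0 -> a = 0 /\ b = 0.
  move=> ab; have fr := ef (fun l => if l == ord0 then a else b).
  by split; [apply: (fr _ ord0)|apply: (fr _ (fintype.lift ord0 ord0))];
     rewrite big_ord_recl big_ord1.
have e00 : e0 != 0.
  apply/eqP => e00; have [] := free 1 0; last by move/eqP; rewrite oner_eq0.
  by rewrite e00 rmorph0 mul0r mulr0 addr0.
pose y := e1 / e0; have ye : e1 = y * e0 by rewrite divfK.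
have yn : nonconst y.
  move=> c; apply/eqP => yc; have [] := free (- c) 1; last first.
    by move=> _ /eqP; rewrite oner_eq0.
  by rewrite ye yc rmorphN rmorph1 mul1r mulNr addNr.
have [S1 S1P] := finite_support e0.
(* Away from these points, vanishing of the section a e0 + b e1 is vanishing of the function a + b
   y. *)
pose bad := S1 ++ dom E.
have badN R : R \notin bad -> ord R e0 = 0 /\ coeff R E = 0.
  rewrite mem_cat negb_or mem_dom => /andP[R1 /negPn/eqP//]; split=> //; apply/eqP.
  by apply: contraNT R1 => /S1P.
(* The section through both points is a e0 + b e1 with b nonzero, so y takes the value - a / b at
   each of them. *)
have common P R R' : R = fpt q (iter i s P) -> R' = fpt q (iter (d - i) s P) ->
    R \notin bad -> R' \notin bad ->
    exists c, vge R 1 (y - cst C0 c) /\ vge R' 1 (y - cst C0 c).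
  move=> RE R'E Rb R'b; have := HP P; rewrite /Dcls -RE -R'E -clsB.
  move=> /h0_gt0[w w0 /LspaceP wL].
  have wv T : T = R \/ T = R' -> vge T 1 w.
    move=> TR; apply: vge_le (wL T); rewrite coeffB coeffD !coeff_pt.
    have -> : coeff T E = 0 by case: TR => ->; [have [] := badN _ Rb|have [] := badN _ R'b].
    by case: TR => ->; rewrite eqxx; case: eqP => _; lia.
  have /spanE[a [b wab]] : Lspace E w.
    apply: (@Lspace_le _ _ (E - (<< R >> + << R' >>))) => [T|]; last exact/LspaceP.
    by rewrite coeffB coeffD !coeff_pt; case: eqP => _; case: eqP => _; lia.
  have ab T : T = R \/ T = R' -> vge T 1 (cst C0 a + cst C0 b * y).
    move=> TR; have -> : cst C0 a + cst C0 b * y = w / e0.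
      by rewrite wab ye mulrA -mulrDl mulfK.
    have := wv _ TR; rewrite !vgeE ?mulf_neq0 ?invr_eq0// ord_div//.
    have -> : ord T e0 = 0 by case: TR => ->; [have [] := badN _ Rb|have [] := badN _ R'b].
    by rewrite subr0.
  have b0 : b != 0.
    apply: contra_neq w0 => b0; have := ab R (or_introl erefl).
    rewrite wab b0 rmorph0 !mul0r !addr0 /vge ord_cst orbF.
    by move=> /eqP ->; rewrite mul0r.
  exists (- (a / b)); suff v T : T = R \/ T = R' -> vge T 1 (y - cst C0 (- (a / b))).
    by split; apply: v; [left|right].
  have cb0 : cst C0 b != 0 by rewrite fmorph_eq0.
  move=> /ab; have -> : y - cst C0 (- (a / b)) = cst C0 b^-1 * (cst C0 a + cst C0 b * y).
    by rewrite rmorphN opprK fmorph_div fmorphV; field.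
  by apply: vgeMl; exact: vge_cst.
pose l := (2 * (d - i))%N; pose Y := pull q y.
(* Every Q is a translate sigma^i P, so the difference vanishes at all Q over all but finitely many
   points of the line; a nonzero function has finite support. *)
have Yl : iter l (pull sigma) Y = Y.
  apply/eqP; rewrite -subr_eq0; apply: contraT => Z0.
  have [S SP] := finite_support (iter l (pull sigma) Y - Y).
  have [V VP] := curve_infinite ([seq fpt h (fpt q R) | R <- S] ++ [seq fpt h R | R <- bad]).
  move: VP; rewrite mem_cat negb_or => /andP[VS Vb].
  have [T TV] := fpt_surj V h_degree; have [Q QT] := fpt_surj T q_degree.
  have hQ : fpt h (fpt q Q) = V by rewrite QT.
  have nb R : fpt h R = V -> R \notin bad.
    by move=> RV; apply: contra Vb => Rb; rewrite -RV map_f.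
  pose P := iter (d - i) s Q.
  have PQ : iter i s P = Q by rewrite -iterD subnKC// (aut_iter_id sigma_order).
  have [c []] := common P _ _ erefl erefl (nb _ (etrans (hq_iter _ _) (etrans (hq_iter _ _) hQ)))
    (nb _ (etrans (hq_iter _ _) (etrans (hq_iter _ _) hQ))).
  rewrite (iter_opposite _ id') PQ -/l => c1 c2.
  have up R z : vge (fpt q R) 1 z -> vge R 1 (pull q z).
    rewrite /vge fmorph_eq0 ord_pull => /orP[->//|z1].
    by apply/orP; right; have := ram_gt0 q R; nia.
  have v1 : vge Q 1 (Y - cst Ct c) by rewrite -(pull_cst q) -rmorphB up.
  have v2 : vge Q 1 (iter l (pull sigma) Y - cst Ct c).
    have ic : iter l (pull sigma) (cst Ct c) = cst Ct c.
      by elim: (l) => [//|m IH]; rewrite iterS IH pull_cst.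
    have iB a b : iter l (pull sigma) (a - b) = iter l (pull sigma) a - iter l (pull sigma) b.
      by elim: (l) => [//|m IH]; rewrite !iterS IH rmorphB.
    have i0' a : (iter l (pull sigma) a == 0) = (a == 0).
      by elim: (l) => [//|m IH]; rewrite iterS fmorph_eq0 IH.
    rewrite -ic -iB /vge i0' (aut_iter_ord sigma_order).
    by have := up _ _ c2; rewrite rmorphB pull_cst.
  have vZ : vge Q 1 (iter l (pull sigma) Y - Y).
    by rewrite -(subrKA (cst Ct c)) vgeD// -opprB vgeN.
  have /SP QS : ord Q (iter l (pull sigma) Y - Y) != 0.
    by move: vZ; rewrite (vgeE _ _ Z0); apply: contraTneq => ->.
  by case/negP: VS; rewrite -hQ; exact: (map_f (fun R => fpt h (fpt q R)) QS).
have /pull_hq_fixed[z zY] : pull sigma Y = Y /\ pull j Y = Y.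
  split; last exact: pull_jq.
  have [_ [sd _]] := sigma_order; apply: (iter_coprime _ Yl (sd Y)).
    by rewrite /l; lia.
  by apply: coprime_double; lia.
have zy : pull h z = y by exact: (fmorph_inj (pull q)).
have zn : nonconst z^-1.
  move=> c; apply/eqP => zc; have := yn c^-1; rewrite -zy -[z]invrK zc.
  by rewrite !fmorphV pull_cst eqxx.
(* P is a pole of z. As e0 and y e0 are both sections of E, the divisor of e0 plus E contains the
   poles of y = h^* z, hence the fibre over P. *)
have [P Pz] := exists_zero zn; rewrite ordV in Pz.
have [D0 D0P] := is_div_exists e0.
exists (cls (E + D0 - pull_div h << P >>)); last first.
  rewrite (O1_pt P) (pull_Pic_cls h_degree) -clsD addrC subrK; apply/cls_eqP.
  exists e0^-1; first by rewrite invr_eq0.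
  by move=> R; rewrite opprD addNKr coeffN ordV D0P.
apply/h0_effective; exists (E + D0 - pull_div h << P >>); split=> // R.
rewrite coeffB coeffD D0P (pull_divE _ _ h_degree) coeff_pt.
have L1 : Lspace E e1 by apply/spanE; exists 0, 1; rewrite rmorph0 rmorph1 mul0r add0r mul1r.
have L0 : Lspace E e0 by apply/spanE; exists 1, 0; rewrite rmorph0 rmorph1 mul0r addr0 mul1r.
have y0 : y != 0 := nonconst_neq0 yn.
have e10 : e1 != 0 by rewrite ye mulf_neq0.
have := (LspaceP _ _).1 L0 R; have := (LspaceP _ _).1 L1 R.
rewrite !vgeE// ye ordM// -zy ord_pull; have [<-|_] := eqVneq P (fpt h R).
  have := ram_gt0 h R; move: Pz; move: (ram h R) (ord P z) (coeff R E) (ord R e0).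
  by move=> r a b c; nia.
by rewrite mulr0 subr0; lia.
Qed.

Lemma theta_dualP i P' xi : (0 < i < d)%N ->
  theta_dual q sigma d i (genus C0) (fpt q P') xi <->
  Picd ((genus C0)%:Z - 1) xi /\
  forall P, (0 < h0 (Dcls q sigma d i P + (xi - Dcls q sigma d i P'))%R)%N.
Proof.
move=> /andP[_ /ltnW id]; have shift P : beta q sigma d i
    (cls (<< fpt q P >> - << fpt q P' >>)) + xi =
    Dcls q sigma d i P + (xi - Dcls q sigma d i P').
  by rewrite beta_pt// addrAC addrA.
split=> -[xid H]; split=> //.
  move=> P; rewrite -shift.
  have [|_] := (W_E (X := C0) _ _).1 (H (beta q sigma d i (cls (<< fpt q P >> - << fpt q P' >>))) _).
    by exists (fpt q P).
  by [].
move=> _ [R _ <-].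
have [P <-] := fpt_surj R q_degree; apply/W_E; rewrite shift; split=> //.
rewrite /Dcls addrCA -clsB -[_ - 1]addr0; apply: PicdD => //.
by apply/PicdP; rewrite degB !degD !deg_pt.
Qed.

Lemma Dcls_degree i P : Picd 2 (Dcls q sigma d i P).
Proof. by apply/PicdP; rewrite degD !deg_pt. Qed.

Lemma O1_degree : Picd d%:Z (pull_Pic h (O1 k)).
Proof.
have [P _] := curve_infinite (X := P1 k) [::].
rewrite (O1_pt P) (pull_Pic_cls h_degree); apply/PicdP.
by rewrite (deg_pull_div _ h_degree) deg_pt mulr1.
Qed.

Lemma theta_dual_decomposition i P' (n := genus C0) (A := pull_Pic h (O1 k))
    (K := canonical_class C0) (Di := Dcls q sigma d i P') : (0 < i < d)%N ->
  theta_dual q sigma d i n (fpt q P') =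
    [set Di + L | L in W (n%:Z - 3)] `|`
    [set Di + K - A - B | B in W (n%:Z + 1 - d%:Z)].
Proof.
move=> id; have Kd : Picd (2 * n%:Z - 2) K := deg_canonical char0 h_degree.
have RR r M : Picd r M -> (h0 M)%:Z - (h0 (K - M))%:Z = r + 1 - n%:Z.
  by move=> /PicdE <-; have := riemann_roch char0 h_degree M; rewrite -/K -/n; done.
have Did : Picd 2 Di := Dcls_degree i P'.
apply/seteqP; split=> xi; last first.
  move=> xiE; apply/theta_dualP => //; case: xiE => [[L /W_E[Ld L0] <-]|[B /W_E[Bd B0] <-]].
    rewrite -/Di -/n [Di + L]addrC addrK; split=> [|P].
      by have := PicdD Ld Did; congr Picd; lia.
    have [E [<- E0]] := (h0_effective L).1 L0; rewrite addrC /Dcls -clsD.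
    apply/h0_effective; eexists; split; first by [].
    by move=> R; rewrite !coeffD !coeff_pt addr_ge0// addr_ge0.
  have xid : Picd (n%:Z - 1) (Di + K - A - B).
    have := PicdB (PicdB (PicdD Did Kd) O1_degree) Bd; congr Picd; lia.
  split=> // P; rewrite -/Di; set M := _ + _.
  have Md : Picd (n%:Z - 1) M.
    have := PicdD (Dcls_degree i P) (PicdB xid Did); congr Picd; lia.
  (* In degree n - 1 Riemann-Roch reads h^0(M) = h^0(K - M). *)
  suff : (0 < h0 (K - M)%R)%N by have := RR _ _ Md; lia.
  have -> : K - M = A + B - Dcls q sigma d i P.
    have -> : M = Dcls q sigma d i P + (K - (A + B)).
      by rewrite /M -[Di + K - A - B]addrA -opprD -[Di + K - _]addrA [Di + _ - _]addrC addKr.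
    by rewrite opprD opprB addrCA [K + _]addrCA subrr addr0 addrC.
  have [F [<- F0]] := (h0_effective B).1 B0.
  rewrite /A (O1_pt (fpt h (fpt q P))) (pull_Pic_cls h_degree) /Dcls -clsD -clsB.
  apply/h0_effective; eexists; split; first by [].
  move=> R; rewrite coeffB coeffD subr_ge0 (le_trans (pair_le_fibre _ _ id))//.
  by rewrite lerDl.
move=> /theta_dualP[]// xid H; have [M ME] : {M | M = xi - Di} by exists (xi - Di).
have Md : Picd (n%:Z - 3) M by rewrite ME; have := PicdB xid Did; congr Picd; lia.
have xiM : xi = Di + M by rewrite ME addrC subrK.
have [M0|M0] := posnP (h0 M); [right|by left; exists M; rewrite ?W_E].
have N2 : h0 (K - M) = 2%N by have := RR _ _ Md; lia.
have HN P : (0 < h0 (K - M - Dcls q sigma d i P)%R)%N.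
  have HP : (0 < h0 (Dcls q sigma d i P + M)%R)%N by rewrite ME; exact: H.
  have -> : K - M - Dcls q sigma d i P = K - (Dcls q sigma d i P + M).
    by rewrite [Dcls _ _ _ _ _ + M]addrC opprD addrA.
  by have := RR _ _ (PicdD (Dcls_degree i P) Md); lia.
rewrite -(cls_rep (K - M)) in N2 HN; have [B B0] := pencil id N2 HN.
rewrite cls_rep -/A => KM; have BE : B = K - M - A by rewrite KM addrC addKr.
exists B; last first.
  by rewrite xiM BE [K - M - A]addrAC -[Di + K - A]addrA -[LHS]addrA subKr.
apply/W_E; split=> //; rewrite BE.
by have := PicdB (PicdB Kd Md) O1_degree; congr Picd; lia.
Qed.

End Dihedral.

Theorem proposition3p1 (R : realType) (d k g : nat)
    (Ct C C0 : curve R[i])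
    (f : morphism Ct C) (sigma : morphism Ct Ct)
    (iota : morphism C C) (j : morphism Ct Ct)
    (q : morphism Ct C0) (h : morphism C0 (P1 R[i]))
    (x : closed_point C0) (x' : closed_point Ct) :
  prime d -> d = (2 * k + 1)%N -> (2 <= g)%N -> genus C = g ->
  etale_cyclic_cover f sigma d ->
  hyperelliptic_involution iota ->
  has_order j 2 ->
  pull (mcomp f j) =1 pull (mcomp iota f) ->
  pull (mcomp (mcomp (mcomp j sigma) j) sigma) =1 id ->
  is_quotient q [set j] ->
  is_quotient (mcomp h q) [set sigma; j] ->
  fpt q x' = x ->
  let n := genus C0 in
  let b : int := n%:Z + 1 - d%:Z in
  let A : Pic C0 := pull_Pic h (O1 R[i]) in
  let K : Pic C0 := canonical_class C0 in
  forall i : nat, (1 <= i <= k)%N ->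
  let Di : Pic C0 := Dcls q sigma d i x' in
  theta_dual q sigma d i n x =
    [set Di + L | L in @W _ C0 (n%:Z - 3)] `|`
    [set Di + K - A - B | B in @W _ C0 b].
Proof.
move=> d_prime dE _ _ cover hyper j2 fj dihedral qq hqq <- n b A K i /andP[i0 ik] Di.
have d_odd : odd d by rewrite dE oddD oddM.
apply: (theta_dual_decomposition _ d_prime d_odd cover hyper j2 fj dihedral qq hqq).
  exact: pchar_num.
by rewrite i0 dE; lia.
Qed.
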